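(* Let $G$ be an odd-dimensional connected compact Lie group. Then $G$ admits a left-invariant SST structure, i.e. a left-invariant ST structure $(g,\xi,\eta,\varphi)$ whose torsion $3$-form $c=\eta\wedge d\eta+d^{\varphi}F$ is closed, $dc=0$.
   Context: Convention: $d\eta(X,Y)=X\eta(Y)-Y\eta(X)-\eta([X,Y])$. An almost contact metric manifold $(N,g,\xi,\eta,\varphi)$ is an odd-dimensional Riemannian manifold $(N,g)$ with a unit-norm vector field $\xi$, its dual $1$-form $\eta=g(\xi,\cdot)$, and a bundle endomorphism $\varphi\colon TN\to TN$ such that $\varphi(\xi)=0$, $\varphi^2=-1+\eta\otimes\xi$, and $g(\varphi(X),\varphi(Y))=g(X,Y)-\eta(X)\eta(Y)$. It is normal if, for all vector fields $X,Y$, $$S(X,Y)=[\varphi(X),\varphi(Y)]+\varphi^2[X,Y]-\varphi[\varphi(X),Y]-\varphi[X,\varphi(Y)]+d\eta(X,Y)\xi=0.$$ The fundamental $2$-form is $F=g(\varphi\cdot,\cdot)$. For a form $\alpha$, $d^{\varphi}\alpha=d\alpha(\varphi\cdot,\dots,\varphi\cdot)$. An ST (Sasaki with torsion) manifold is a normal almost contact metric manifold such that $\xi$ is a Killing vector field; its torsion $3$-form is $c=\eta\wedge d\eta+d^{\varphi}F$. It is SST (strong) if $dc=0$. An ST structure on a Lie group is left-invariant if $g,\xi,\eta,\varphi$ are all left-invariant. *)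

(* Defs.v *)
From HB Require Import structures.
From mathcomp Require Import all_boot all_order all_algebra.
From mathcomp Require Import all_classical all_reals all_analysis.
Import Order.TTheory GRing.Theory Num.Theory.
Import numFieldNormedType.Exports.

Set Implicit Arguments.
Unset Strict Implicit.
Unset Printing Implicit Defensive.

Local Open Scope classical_set_scope.
Local Open Scope ring_scope.

(* [C_on k U f]: [f] is of class C^k on [U]. The set [U] is meant to be open, *)
(* so that the values of ['D_v f] on [U] only depend on those of [f] on [U].  *)
Section SmoothMaps.
Variables (R : realType) (V W : normedModType R).

Fixpoint C_on (k : nat) (U : set V) (f : V -> W) : Prop :=
  if k is k'.+1 then
    (forall x, U x -> differentiable f x) /\
    (forall v, C_on k' U (fun x => 'D_v f x))
  else forall x, U x -> {for x, continuous f}.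

Definition smooth_on (U : set V) (f : V -> W) := forall k, C_on k U f.

End SmoothMaps.

Section SmoothMapsTheory.
Variables (R : realType) (V W : normedModType R).
Implicit Types (U : set V).

Lemma near_eq_differentiable (f g : V -> W) (x : V) :
  {near x, f =1 g} -> differentiable f x -> differentiable g x.
Proof.
move=> fg df.
pose h : V -> W := g - f.
have -> : g = f + h by rewrite /h addrC subrK.
apply: differentiableD => //.
have hx : h x = 0.
  by rewrite /h !fctE (nbhs_singleton fg) subrr.
have E : h \o shift x = cst (h x) + (\0 : {linear V -> W}) +o_ 0 id.
  apply/eqaddoP => _/posnumP[e]; rewrite hx.
  have : \forall y \near 0, f (y + x) = g (y + x).
    by move: fg; rewrite (near_shift 0 x) /= subr0.
  apply: filterS => y fgy.
  by rewrite /h !fctE /= fgy subrr addr0 subr0 normr0 mulr_ge0.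
have c0 : continuous (\0 : {linear V -> W}) by move=> z; exact: cvg_cst.
apply/diff_locallyP; rewrite (diff_unique c0 E); split=> //; exact: E.
Qed.

Lemma open_near_eq U (f g : V -> W) (x : V) : open U ->
  (forall x, U x -> f x = g x) -> U x -> {near x, f =1 g}.
Proof.
by move=> oU fg Ux; apply: filterS (open_nbhs_nbhs (conj oU Ux)) => y /fg.
Qed.

Lemma C_on_eq k U (f g : V -> W) : open U ->
  (forall x, U x -> f x = g x) -> C_on k U f -> C_on k U g.
Proof.
move=> oU; elim: k f g => [|k IH] f g fg /=.
  move=> cf x Ux; have : f @ x --> f x by exact: cf.
  rewrite (fg _ Ux); apply: cvg_trans; apply: near_eq_cvg.
  exact: open_near_eq fg Ux.
move=> [df Df]; split=> [x Ux|v].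
  exact: near_eq_differentiable (open_near_eq oU fg Ux) (df x Ux).
apply: IH (Df v) => x Ux; apply: near_eq_derive.
exact: open_near_eq fg Ux.
Qed.

Lemma C_onW k U (f : V -> W) : C_on k.+1 U f -> C_on k U f.
Proof.
elim: k f => [|k IH] f [df Df].
  by move=> x /df; exact: differentiable_continuous.
by split=> // v; exact: IH.
Qed.

Lemma C_on_cst k U (a : W) : C_on k U (fun=> a).
Proof.
elim: k a => [|k IH] a /=; first by move=> x _; exact: cvg_cst.
split=> [x _|v]; first exact: differentiable_cst.
have -> : (fun x => 'D_v (fun=> a) x) = (fun=> 0 : W).
  by apply/funext => x; exact: derive_cst.
exact: IH.
Qed.

Lemma C_onZD k U (a : R) (f g : V -> W) : open U ->
  C_on k U f -> C_on k U g -> C_on k U (a *: f + g).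
Proof.
move=> oU; elim: k f g => [|k IH] f g /=.
  move=> cf cg x Ux; apply: continuousD; last exact: cg.
  exact: continuousZl_tmp (cf x Ux).
move=> [df Df] [dg Dg]; split=> [x Ux|v].
  by apply: differentiableD; [apply: differentiableZ; exact: df|exact: dg].
apply: C_on_eq (IH _ _ (Df v) (Dg v)) => // x Ux.
have dfx : derivable f x v by exact: diff_derivable (df x Ux).
have dgx : derivable g x v by exact: diff_derivable (dg x Ux).
by rewrite deriveD// ?deriveZ//; exact: derivableZ.
Qed.

End SmoothMapsTheory.

Lemma C_onM (R : realType) (V : normedModType R) k (U : set V) (f g : V -> R) :
  open U -> C_on k U f -> C_on k U g -> C_on k U (f * g).
Proof.
move=> oU; elim: k f g => [|k IH] f g.
  by move=> cf cg x Ux; apply: continuousM; [exact: cf|exact: cg].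
move=> Cf Cg; have [df Df] := Cf; have [dg Dg] := Cg.
split=> [x Ux|v].
  by apply: differentiableM; [exact: df|exact: dg].
have := C_onZD 1 oU (IH _ _ (C_onW Cf) (Dg v)) (IH _ _ (C_onW Cg) (Df v)).
apply: C_on_eq => // x Ux; rewrite scale1r.
by rewrite deriveM//; apply: diff_derivable; [exact: df|exact: dg].
Qed.

(* A chart is a homeomorphism from the open set [dom] of [M] onto the open    *)
(* set [cod] of R^n; [fwd] and [bwd] are junk outside [dom] and [cod].        *)
Record chart (R : realType) (n : nat) (M : topologicalType) := Chart {
  dom : set M;
  cod : set 'rV[R]_n;
  fwd : M -> 'rV[R]_n;
  bwd : 'rV[R]_n -> M;
  open_dom : open dom;
  open_cod : open cod;
  fwd_cod : forall x, dom x -> cod (fwd x);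
  bwd_dom : forall u, cod u -> dom (bwd u);
  fwdK : forall x, dom x -> bwd (fwd x) = x;
  bwdK : forall u, cod u -> fwd (bwd u) = u;
  fwd_continuous : forall x, dom x -> {for x, continuous fwd};
  bwd_continuous : forall u, cod u -> {for u, continuous bwd} }.

HB.mixin Record isManifold (R : realType) (n : nat) M of Topological M := {
  manifold_hausdorff : hausdorff_space M;
  manifold_second_countable : @second_countable M;
  atlas : set (chart R n M);
  atlas_cover : forall x : M, exists2 c, atlas c & dom c x;
  atlas_compat : forall c d, atlas c -> atlas d ->
    smooth_on (cod c `&` bwd c @^-1` dom d) (fwd d \o bwd c) }.

#[short(type="manifoldType")]
HB.structure Definition Manifold (R : realType) (n : nat) :=
  { M of Topological M & isManifold R n M }.

HB.mixin Record isLieGroup (R : realType) (n : nat) G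
    of Manifold R n G & Group G := {
  lie_mul_continuous : continuous (fun p : G * G => (p.1 * p.2)%g);
  lie_inv_continuous : continuous (fun x : G => x^-1%g);
  lie_mul_smooth : forall a b c : chart R n G,
    @atlas R n G a -> @atlas R n G b -> @atlas R n G c ->
    smooth_on [set p : 'rV[R]_n * 'rV[R]_n | [/\ cod a p.1, cod b p.2 &
                 dom c (bwd a p.1 * bwd b p.2)%g]]
              (fun p => fwd c (bwd a p.1 * bwd b p.2)%g);
  lie_inv_smooth : forall a b : chart R n G,
    @atlas R n G a -> @atlas R n G b ->
    smooth_on [set u | cod a u /\ dom b (bwd a u)^-1%g]
              (fun u => fwd b (bwd a u)^-1%g) }.

#[short(type="lieGroupType")]
HB.structure Definition LieGroup (R : realType) (n : nat) :=
  { G of Manifold R n G & Group G & isLieGroup R n G }.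

Section SmoothFunctions.
Variables (R : realType) (n : nat) (M : manifoldType R n).

Definition smooth_fun (f : M -> R) :=
  forall c, atlas c -> smooth_on (cod c) (f \o bwd c).

Definition smooth_pred : {pred M -> R} := fun f => `[< smooth_fun f >].

Lemma smooth_fun_cst (a : R) : smooth_fun (cst a).
Proof. by move=> c _ k; exact: C_on_cst. Qed.

Lemma smooth_funZD (a : R) f g :
  smooth_fun f -> smooth_fun g -> smooth_fun (a *: f + g).
Proof.
move=> sf sg c Ac k.
by exact: C_onZD (@open_cod _ _ _ c) (sf c Ac k) (sg c Ac k).
Qed.

Lemma smooth_funM f g : smooth_fun f -> smooth_fun g -> smooth_fun (f * g).
Proof.
move=> sf sg c Ac k.
by exact: C_onM (@open_cod _ _ _ c) (sf c Ac k) (sg c Ac k).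
Qed.

Lemma smooth_subring_closed : subring_closed smooth_pred.
Proof.
split=> [|f g /asboolP sf /asboolP sg|f g /asboolP sf /asboolP sg];
  apply/asboolP; [exact: smooth_fun_cst| |exact: smooth_funM].
have -> : f - g = -1 *: g + f by rewrite scaleN1r addrC.
exact: smooth_funZD.
Qed.

HB.instance Definition _ := GRing.isSubringClosed.Build (M -> R) smooth_pred
  smooth_subring_closed.

Lemma smooth_scaler_closed : GRing.scaler_closed smooth_pred.
Proof.
move=> a f /asboolP sf; apply/asboolP; rewrite -[_ *: _]addr0.
by apply: smooth_funZD => //; exact: smooth_fun_cst.
Qed.

HB.instance Definition _ := GRing.isScaleClosed.Build R (M -> R) smooth_pred
  smooth_scaler_closed.

Record Cinf := MkCinf { cinf_fun :> M -> R; _ : cinf_fun \in smooth_pred }.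

HB.instance Definition _ := [isSub for cinf_fun].
HB.instance Definition _ := [Choice of Cinf by <:].
HB.instance Definition _ := GRing.SubChoice_isSubComPzRing.Build (M -> R)
  smooth_pred Cinf smooth_subring_closed.
HB.instance Definition _ := [SubZmodule_isSubLmodule of Cinf by <:].

End SmoothFunctions.

Lemma bracket_aux (A : zmodType) (a b c d e f : A) :
  a + b + (c + d) - (e + d + (f + b)) = a - e + (c - f).
Proof.
by rewrite addrACA [e + d + _]addrACA [d + b]addrC [e + f + _]addrC addrKA
  opprD addrACA.
Qed.

(* Smooth vector fields are the derivations of the R-algebra C^oo(M), and     *)
(* tensor fields the C^oo(M)-multilinear maps on them. The scalars of the     *)
(* module [vfield M] are the smooth functions; [C^o] is C^oo(M) as a module   *)
(* over itself, and [a *: f] with [a : R] is scaling by a real constant.      *)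
Section VectorFields.
Variables (R : realType) (n : nat) (M : manifoldType R n).
Local Notation C := (Cinf M).
Implicit Types f g : C.

Definition is_derivation (D : C -> C^o) : Prop :=
  [/\ forall f g, D (f + g) = D f + D g,
      forall (a : R) f, D (a *: f) = (a *: (D f : C) : C)
    & forall f g, D (f * g) = f * D g + g * D f].

Definition derivation_pred : {pred C -> C^o} := fun D => `[< is_derivation D >].

Lemma derivation_submod_closed : subsemimod_closed derivation_pred.
Proof.
split; [split|].
- apply/asboolP; split=> [f g|a f|f g].
  + exact/esym/(addr0 (0 : C)).
  + exact/esym/(@scaler0 R C).
  + by apply/esym; rewrite [LHS](_ : _ = f * 0 + g * 0)// !mulr0 addr0.
- move=> D E /asboolP[DD DZ DM] /asboolP[ED EZ EM].
  apply/asboolP; split=> [f g|a f|f g]; rewrite !fctE.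
  + by rewrite DD ED addrACA.
  + by rewrite DZ EZ; exact: esym (@scalerDr R C a (D f) (E f)).
  + by rewrite DM EM !mulrDr addrACA.
- move=> h D /asboolP[DD DZ DM].
  apply/asboolP; split=> [f g|a f|f g]; rewrite !fctE.
  + by rewrite DD scalerDr.
  + by rewrite DZ; apply: val_inj; apply/funext => x /=; exact: mulrCA.
  + by rewrite DM scalerDr; congr (_ + _); exact: mulrCA.
Qed.

HB.instance Definition _ := GRing.isSubmodClosed.Build C (C -> C^o)
  derivation_pred derivation_submod_closed.

Record vfield := VField {
  vfield_fun :> C -> C^o; _ : vfield_fun \in derivation_pred }.

HB.instance Definition _ := [isSub for vfield_fun].
HB.instance Definition _ := [Choice of vfield by <:].
HB.instance Definition _ := [SubChoice_isSubLmodule of vfield by <:].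

Lemma vfieldP (X : vfield) : is_derivation X.
Proof. by case: X => D DP; apply/asboolP. Qed.

Lemma bracket_subproof (X Y : vfield) :
  (fun f => X (Y f) - Y (X f)) \in derivation_pred.
Proof.
have [XD XZ XM] := vfieldP X; have [YD YZ YM] := vfieldP Y.
apply/asboolP; split=> [f g|a f|f g].
- by rewrite YD XD XD YD opprD addrACA.
- by rewrite YZ XZ XZ YZ; exact: esym (@scalerBr R C a (X (Y f)) (Y (X f))).
- rewrite YM XM XD YD !XM !YM !mulrBr [Y f * X g]mulrC [Y g * X f]mulrC.
  exact: bracket_aux.
Qed.

Definition bracket (X Y : vfield) : vfield := VField (bracket_subproof X Y).

End VectorFields.

Section AlmostContact.
Variables (R : realType) (n : nat) (M : manifoldType R n).
Local Notation C := (Cinf M).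
Local Notation VF := (vfield M).

(* The tangent vector [X_p] vanishes. *)
Definition vanishes_at (X : VF) (p : M) := forall f : C, X f p = 0.

Record is_riemannian (g : VF -> VF -> C) : Prop := {
  metricC : forall X Y, g X Y = g Y X;
  metricDl : forall X Y Z, g (X + Y) Z = g X Z + g Y Z;
  metricZl : forall (f : C) X Y, g (f *: X) Y = f * g X Y;
  metric_pos : forall X p, ~ vanishes_at X p -> 0 < g X X p }.

Definition killing (g : VF -> VF -> C) (X : VF) : Prop :=
  forall Y Z, X (g Y Z) = g (bracket X Y) Z + g Y (bracket X Z).

(* Exterior derivatives of 1-, 2- and 3-forms, by the invariant formula       *)
(* without 1/(k+1) factors; [wedge12] is the matching (determinant) wedge     *)
(* product of a 1-form and a 2-form.                                          *)
Definition d1 (a : VF -> C) (X Y : VF) : C :=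
  X (a Y) - Y (a X) - a (bracket X Y).

Definition d2 (a : VF -> VF -> C) (X Y Z : VF) : C :=
  X (a Y Z) - Y (a X Z) + Z (a X Y)
  - a (bracket X Y) Z + a (bracket X Z) Y - a (bracket Y Z) X.

Definition d3 (a : VF -> VF -> VF -> C) (X Y Z W : VF) : C :=
  X (a Y Z W) - Y (a X Z W) + Z (a X Y W) - W (a X Y Z)
  - a (bracket X Y) Z W + a (bracket X Z) Y W - a (bracket X W) Y Z
  - a (bracket Y Z) X W + a (bracket Y W) X Z - a (bracket Z W) X Y.

Definition wedge12 (a : VF -> C) (b : VF -> VF -> C) (X Y Z : VF) : C :=
  a X * b Y Z + a Y * b Z X + a Z * b X Y.

Record acm_structure := ACM {
  acm_g : VF -> VF -> C;
  acm_xi : VF;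
  acm_eta : VF -> C;
  acm_phi : {linear VF -> VF};
  acm_odd : odd n;
  acm_riemannian : is_riemannian acm_g;
  acm_xi_unit : acm_g acm_xi acm_xi = 1;
  acm_etaE : forall X, acm_eta X = acm_g acm_xi X;
  acm_phi_xi : acm_phi acm_xi = 0;
  acm_phi2 : forall X, acm_phi (acm_phi X) = - X + acm_eta X *: acm_xi;
  acm_g_phi : forall X Y,
    acm_g (acm_phi X) (acm_phi Y) = acm_g X Y - acm_eta X * acm_eta Y }.

Section Structure.
Variable s : acm_structure.
Local Notation g := (acm_g s).
Local Notation xi := (acm_xi s).
Local Notation eta := (acm_eta s).
Local Notation phi := (acm_phi s).

Definition normality_tensor (X Y : VF) : VF :=
  bracket (phi X) (phi Y) + phi (phi (bracket X Y))
  - phi (bracket (phi X) Y) - phi (bracket X (phi Y)) + d1 eta X Y *: xi.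

Definition normal : Prop := forall X Y, normality_tensor X Y = 0.

Definition fundamental_form (X Y : VF) : C := g (phi X) Y.

Definition dphi_fundamental_form (X Y Z : VF) : C :=
  d2 fundamental_form (phi X) (phi Y) (phi Z).

Definition torsion (X Y Z : VF) : C :=
  wedge12 eta (d1 eta) X Y Z + dphi_fundamental_form X Y Z.

Definition is_ST : Prop := normal /\ killing g xi.

Definition is_SST : Prop :=
  is_ST /\ forall X Y Z W, d3 torsion X Y Z W = 0.

End Structure.
End AlmostContact.

Section LeftInvariance.
Variables (R : realType) (n : nat) (G : lieGroupType R n).
Local Notation C := (Cinf G).
Local Notation VF := (vfield G).

(* [Y] is the push-forward of [X] by the left translation [L_a]:               *)
(* [X (f \o L_a) = (Y f) \o L_a] for all smooth [f]. Here [h] stands for      *)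
(* [f \o L_a], which is always smooth because the multiplication is.          *)
Definition left_related (a : G) (X Y : VF) : Prop :=
  forall f h : C, (forall x, h x = f (a * x)%g) ->
  forall x, X h x = Y f (a * x)%g.

Record left_invariant (s : acm_structure G) : Prop := {
  left_invariant_g : forall a X X' Y Y',
    left_related a X X' -> left_related a Y Y' ->
    forall x, acm_g s X' Y' (a * x)%g = acm_g s X Y x;
  left_invariant_xi : forall a, left_related a (acm_xi s) (acm_xi s);
  left_invariant_eta : forall a X X', left_related a X X' ->
    forall x, acm_eta s X' (a * x)%g = acm_eta s X x;
  left_invariant_phi : forall a X X', left_related a X X' ->
    left_related a (acm_phi s X) (acm_phi s X') }.

End LeftInvariance.

(* Main.v *)
(* Let a(x) be the adjoint action of G on its Lie algebra. As a(G) is bounded,   *)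
(* an invariant, uniformly convex function on the symmetric matrices has a       *)
(* unique minimizer on an invariant convex set, so there is an a(G)-invariant    *)
(* inner product B, hence an ad-invariant one. On a metric Lie algebra of odd    *)
(* dimension one constructs (xi, phi) by induction: let A be a nonzero skew      *)
(* derivation (some ad x, or a rotation if the algebra is abelian) and J the     *)
(* orthogonal part of its polar decomposition; ker A is a Lie subalgebra of      *)
(* smaller odd dimension, and phi is J on its orthogonal complement. Since A is  *)
(* a derivation, the eigenspaces of A with eigenvalue in i R_+ span a complex    *)
(* subalgebra normalized by ker A, which gives normality. Extending (xi, phi, B) *)
(* by left translations, normality and the ad-invariance of B yield              *)
(* c(X, Y, Z) = - B([X, Y], Z), whose closedness is the Jacobi identity.         *)
(* Vector fields being derivations of C^oo(G), Hadamard's lemma is what shows    *)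
(* that the left invariant ones form a basis of the C^oo(G)-module of all        *)
(* vector fields.                                                              *)
Require Import Defs.
From HB Require Import structures.
From mathcomp Require Import all_boot all_order all_algebra.
From mathcomp Require Import all_classical all_reals all_analysis.
From mathcomp Require Import complex ring lra zify.
Import Order.TTheory GRing.Theory Num.Theory.
Import numFieldNormedType.Exports.

Set Implicit Arguments.
Unset Strict Implicit.
Unset Printing Implicit Defensive.

Local Open Scope classical_set_scope.
Local Open Scope ring_scope.

(** The argument has an analytic, an algebraic and a geometric layer.

    Analysis. Since vector fields are derivations of the algebra of smooth functions, they must
    first be given components. Bump functions ([smooth_bump]) and Hadamard's lemma ([hadamard]) show
    that a derivation at a point is determined by its values on finitely many functions
    ([local_coordinates]). Translating these from the identity gives every field components
    [hat_fun] in the left invariant frame ([vfield_hat_fun]), and these components are smooth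
    ([smooth_hat]). In this frame the bracket is that of the Lie algebra plus the derivatives of the
    components ([hat_bracket]). Compactness bounds the adjoint representation [Ad] ([Ad_bounded]). A
    bounded group has a fixed point on a suitable closed convex set ([bounded_group_fixed_point]),
    which yields an [Ad]-invariant inner product ([invariant_inner_product]). Differentiating its
    invariance at the identity makes every [ad x] skew ([biinvariant_metric_lie]).

    Algebra. An odd-dimensional metric Lie algebra carries a normal pair [(xi, phi)]
    ([normal_structure_exists]). Take a nonzero skew derivation [A] and the orthogonal part [J] of
    its polar decomposition ([polar_part_exists]). The rank of [J] is even ([even_rank_cube]), so
    [ker A] is a smaller metric Lie algebra of odd dimension. Induction gives a pair there, extended
    by [J] on the orthogonal complement ([normal_structure_extend]). Normality is checked on
    eigenvectors: over the complex numbers, brackets of eigenvectors of [A] for [i lam] and [i mu]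
    lie in the eigenspace for [i (lam + mu)], and when [lam] and [mu] are positive [J] is
    multiplication by [i] on all three.

    Geometry. Left translation turns the algebraic data into tensors with constant components.
    [torsion_form] identifies the torsion with the 3-form [- B([X, Y], Z)], and [lie_form_closed]
    deduces its closedness from the Jacobi identity. *)

(** * Maps of class C^k: locality, chain rule, inverses *)

Section Calculus.
Variable R : realType.
Implicit Types V W : normedModType R.

(** At each level the definition quantifies over points of [U] only, and ['D_v f x] does not refer
    to [U]. Restriction and locality follow from this. *)
Lemma C_on_pointwise V W k (U : set V) (f : V -> W) :
  (forall x, U x -> C_on k [set x] f) <-> C_on k U f.
Proof.
elim: k f => [|k IH] f /=.
  by split=> [H x Ux|H x Ux y ->]; [exact: (H x Ux x erefl)|exact: H].
split=> [H|[df Df]].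
  split=> [x Ux|v]; first by have [d _] := H x Ux; exact: (d x erefl).
  by apply/IH => x Ux; have [_] := H x Ux; exact.
move=> x Ux; split=> [y ->|v]; first exact: df.
by have /IH := Df v; exact.
Qed.

Lemma C_on_sub V W k (U U' : set V) (f : V -> W) :
  U `<=` U' -> C_on k U' f -> C_on k U f.
Proof. by move=> UU /C_on_pointwise H; apply/C_on_pointwise => x /UU /H. Qed.

Lemma C_on_le V W k k' (U : set V) (f : V -> W) :
  (k <= k')%N -> C_on k' U f -> C_on k U f.
Proof.
move=> /subnK <-; elim: (k' - k)%N => // m IH; rewrite addSn.
by move=> /C_onW; exact: IH.
Qed.

Lemma C_on_local V W k (U : set V) (f : V -> W) :
  (forall x, U x -> exists (N : set V) (g : V -> W),
     [/\ open N, N x, (forall y, N y -> g y = f y) & C_on k N g]) ->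
  C_on k U f.
Proof.
move=> H; apply/C_on_pointwise => x /H[N [g [oN Nx gf Cg]]].
have := C_on_eq oN gf Cg; apply: C_on_sub.
by move=> _ ->.
Qed.

Lemma derive_lin_comp V (V' W : normedModType R) (l : {linear V' -> W})
    (f : V -> V') x v : continuous l -> differentiable f x ->
  'D_v (l \o f) x = l ('D_v f x).
Proof.
move=> cl df; have dl : differentiable l (f x) by exact: linear_differentiable.
rewrite !deriveE//; last exact: differentiable_comp.
by rewrite diff_comp//= diff_lin.
Qed.

Lemma C_on_lin_comp V (V' W : normedModType R) (l : {linear V' -> W}) k
    (U : set V) (f : V -> V') : open U -> continuous l ->
  C_on k U f -> C_on k U (l \o f).
Proof.
move=> oU cl; elim: k f => [|k IH] f /=.
  by move=> cf x Ux; apply: continuous_comp; [exact: cf|exact: cl].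
move=> [df Df]; split=> [x Ux|v].
  by apply: differentiable_comp; [exact: df|exact: linear_differentiable].
apply: C_on_eq (IH _ (Df v)) => // x Ux /=.
by rewrite -derive_lin_comp//; exact: df.
Qed.

Lemma C_onD V W k (U : set V) (f g : V -> W) : open U ->
  C_on k U f -> C_on k U g -> C_on k U (f + g).
Proof. by move=> oU Cf Cg; have := C_onZD 1 oU Cf Cg; rewrite scale1r. Qed.

Lemma C_on_sum V W k (U : set V) (I : Type) (r : seq I) (f : I -> V -> W) :
  open U -> (forall i, C_on k U (f i)) -> C_on k U (\sum_(i <- r) f i).
Proof.
move=> oU Cf; elim: r => [|i r IH].
  by rewrite big_nil; exact: C_on_cst.
by rewrite big_cons; exact: C_onD.
Qed.

Lemma C_on_lin V W (l : {linear V -> W}) k (U : set V) :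
  continuous l -> C_on k U l.
Proof.
move=> cl; case: k => [|k] /=; first by move=> x _; exact: cl.
split=> [x _|v]; first exact: linear_differentiable.
rewrite [X in C_on k U X](_ : _ = fun=> l v); first exact: C_on_cst.
apply/funext => x; rewrite deriveE; last exact: linear_differentiable.
by rewrite diff_lin.
Qed.

(* Finite dimensionality, as needed for the chain rule: [C_on] only speaks of
   directional derivatives, so those of a composite must be finite sums. *)
Definition has_coords V := exists (m : nat) (e : 'I_m -> V)
  (l : 'I_m -> {linear V -> R}),
  (forall j, continuous (l j : V -> R)) /\ forall x, x = \sum_j l j x *: e j.

Lemma derive_coords V (V' W : normedModType R) m (e : 'I_m -> V')
    (l : 'I_m -> {linear V' -> R}) (f : V -> V') (g : V' -> W) x v :
  (forall x, x = \sum_j l j x *: e j) ->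
  differentiable f x -> differentiable g (f x) ->
  'D_v (g \o f) x = \sum_j l j ('D_v f x) *: 'D_(e j) g (f x).
Proof.
move=> le df dg; rewrite deriveE; last exact: differentiable_comp.
rewrite diff_comp//= -(deriveE _ df) [in LHS](le ('D_v f x)) linear_sum.
by apply: eq_bigr => j _; rewrite linearZ (deriveE _ dg).
Qed.

(** By [derive_coords] a directional derivative of [g \o f] is a finite sum of products of
    components of ['D_v f] with [('D_(e j) g) \o f]. Each factor has one degree of smoothness less,
    so induction applies. *)
Lemma C_on_comp_real V (V' : normedModType R) k (U : set V) (U' : set V')
    (f : V -> V') (g : V' -> R) : has_coords V' -> open U ->
  (forall x, U x -> U' (f x)) -> C_on k U f -> C_on k U' g ->
  C_on k U (g \o f).
Proof.
move=> [m [e [l [cl le]]]] oU fU.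
elim: k f g fU => [|k IH] f g fU.
  by move=> cf cg x Ux; apply: continuous_comp; [exact: cf|exact: cg (fU _ Ux)].
move=> Cf Cg; have [df Df] := Cf; have [dg Dg] := Cg.
split=> [x Ux|v].
  by apply: differentiable_comp; [exact: df|exact: dg (fU _ Ux)].
have : C_on k U (\sum_j ((l j : V' -> R) \o (fun x => 'D_v f x)) *
                        ((fun y => 'D_(e j) g y) \o f)).
  apply: C_on_sum => // j; apply: C_onM => //.
    by have := C_on_lin_comp oU (cl j) (Df v).
  by apply: IH (C_onW Cf) (Dg _).
apply: C_on_eq => // x Ux; rewrite fct_sumE.
rewrite (derive_coords _ le); [|exact: df|exact: dg (fU _ Ux)].
by [].
Qed.

Definition rcoord m (i : 'I_m) (M : 'rV[R]_m) : R := M 0 i.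
Lemma rcoord_linear m i : linear (@rcoord m i).
Proof. by move=> a u v; rewrite /rcoord !mxE. Qed.
HB.instance Definition _ m i := GRing.isLinear.Build R 'rV[R]_m R *:%R
  (@rcoord m i) (@rcoord_linear m i).

Definition scale_on W (w : W) (a : R) := a *: w.
Lemma scale_on_linear W (w : W) : linear (scale_on w).
Proof. by move=> a u v; rewrite /scale_on scalerDl scalerA. Qed.
HB.instance Definition _ W w := GRing.isLinear.Build R R W *:%R
  (@scale_on W w) (@scale_on_linear W w).

Lemma has_coords_rV m : has_coords 'rV[R]_m.
Proof.
exists m, (fun i => 'e_i), (fun i => rcoord i).
by split=> [j|x]; [exact: coord_continuous|rewrite {1}(row_sum_delta x)].
Qed.

Definition in_left V W (v : V) : V * W := (v, 0).
Lemma in_left_linear V W : linear (@in_left V W).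
Proof. by move=> a u v; congr pair; rewrite /= scaler0 addr0. Qed.
HB.instance Definition _ V W := GRing.isLinear.Build R V (V * W)%type *:%R
  (@in_left V W) (@in_left_linear V W).

Definition in_right V W (w : W) : V * W := (0, w).
Lemma in_right_linear V W : linear (@in_right V W).
Proof. by move=> a u v; congr pair; rewrite /= scaler0 addr0. Qed.
HB.instance Definition _ V W := GRing.isLinear.Build R W (V * W)%type *:%R
  (@in_right V W) (@in_right_linear V W).

Lemma C_on_pair V (V1 V2 : normedModType R) k (U : set V) (f : V -> V1)
    (g : V -> V2) : open U ->
  C_on k U f -> C_on k U g -> C_on k U (fun x => (f x, g x)).
Proof.
move=> oU Cf Cg.
have -> : (fun x => (f x, g x)) = (@in_left V1 V2 \o f) +
                                  (@in_right V1 V2 \o g).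
  by apply/funext => x /=; congr pair; rewrite /= ?addr0 ?add0r.
apply: C_onD => //; apply: C_on_lin_comp => // x.
  by apply: cvg_pair; [exact: cvg_id|exact: cvg_cst].
by apply: cvg_pair; [exact: cvg_cst|exact: cvg_id].
Qed.

Lemma has_coords_pair V W : has_coords V -> has_coords W ->
  has_coords (V * W)%type.
Proof.
move=> [m [e [l [cl le]]]] [m' [e' [l' [cl' le']]]].
pose E (j : 'I_(m + m')) : V * W :=
  match fintype.split j with inl i => (e i, 0) | inr i => (0, e' i) end.
pose L (j : 'I_(m + m')) : {linear (V * W)%type -> R} :=
  match fintype.split j with inl i => (l i \o fst)%FUN : {linear _ -> _}
  | inr i => (l' i \o snd)%FUN : {linear _ -> _} end.
exists (m + m')%N, E, L; split=> [j|[x y]].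
  rewrite /L; case: fintype.split => i p; apply: continuous_comp.
  - exact: cvg_fst.
  - exact: cl.
  - exact: cvg_snd.
  - exact: cl'.
rewrite big_split_ord /= /L /E.
under eq_bigr => i _ do rewrite (unsplitK (inl i)).
under [X in _ + X]eq_bigr => i _ do rewrite (unsplitK (inr i)).
rewrite [LHS](_ : _ = (x, 0) + (0, y)); last first.
  by congr pair; rewrite /= ?addr0 ?add0r.
congr (_ + _).
  rewrite {1}(le x) [LHS](linear_sum (@in_left V W)).
  by apply: eq_bigr => i _; rewrite linearZ.
rewrite {1}(le' y) [LHS](linear_sum (@in_right V W)).
by apply: eq_bigr => i _; rewrite linearZ.
Qed.

Lemma C_onV V k (U : set V) (f : V -> R) : open U ->
  (forall x, U x -> f x != 0) -> C_on k U f -> C_on k U (fun x => (f x)^-1).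
Proof.
move=> oU f0; elim: k => [|k IH].
  by move=> cf x Ux; apply: continuousV; [exact: f0|exact: cf].
move=> Cf; have [df Df] := Cf.
split=> [x Ux|v].
  by apply: differentiableV; [exact: df|exact: f0].
have CV := IH (C_onW Cf).
have := C_onM oU (C_onM oU CV CV)
  (C_onZD (-1) oU (Df v) (C_on_cst k U (0 : R))).
apply: C_on_eq => // x Ux.
rewrite deriveV ?f0//; last by apply: diff_derivable; exact: df.
by rewrite [LHS]/GRing.mul /= !fctE /= addr0 scaleN1r -invfM expr2 mulrN scaleNr.
Qed.

End Calculus.

(** * Smooth bump functions *)

Section Bump.
Variable R : realType.
Implicit Type P : {poly R}.

(** Each monomial satisfies [x^i exp(-x) <= i!] for nonnegative [x], from one term of the
    exponential series. *)
Lemma poly_expRN_bounded P : exists2 c : R, 0 <= c &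
  forall x, 0 <= x -> `|P.[x]| * expR (- x) <= c.
Proof.
elim/poly_ind: P => [|P a _].
  by exists 0 => // x _; rewrite horner0 normr0 mul0r.
set Q := _ + _.
exists (\sum_(i < size Q) `|Q`_i| * i`!%:R); first exact: sumr_ge0.
move=> x x0; rewrite expRN ler_pdivrMr ?expR_gt0// horner_coef.
apply: (le_trans (ler_norm_sum _ _ _)); rewrite mulr_suml.
apply: ler_sum => i _; rewrite normrM -mulrA; apply: ler_wpM2l => //.
rewrite normrX ger0_norm//.
case: (nat_of_ord i) => [|m]; first by rewrite expr0 fact0 mul1r -expR0 ler_expR.
have /(ler_wpM2l (ler0n R m.+1`!)) := expR_ge1Dxn m x0.
apply: le_trans; rewrite mulrDr mulrCA divff ?mulr1 ?lerDr ?mulr_ge0//.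
Qed.

(* Allowing a polynomial factor in [1/t] makes the family stable under
   derivation. *)
Definition flat P (t : R) : R :=
  if 0 < t then P.[t^-1] * expR (- t^-1) else 0.

(** The preceding bound for ['X^2 * P] at [1/t]. A quadratic bound is what makes the derivative at 0
    vanish. *)
Lemma flat_le_sqr P : exists2 c : R, 0 <= c & forall t, `|flat P t| <= c * t ^+ 2.
Proof.
have [c c0 H] := poly_expRN_bounded ('X^2 * P).
exists c => // t; rewrite /flat; case: ifPn => [t0|_]; last first.
  by rewrite normr0 mulr_ge0// sqr_ge0.
have := H t^-1; rewrite invr_ge0 ltW// => /(_ isT).
rewrite hornerM hornerXn [`|_ * _|]normrM [X in _ -> X <= _]normrM.
rewrite (ger0_norm (expR_ge0 _)) ger0_norm ?exprn_ge0 ?invr_ge0 ?(ltW t0)//.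
by rewrite exprVn -mulrA ler_pdivrMl ?exprn_gt0// [t ^+ 2 * c]mulrC.
Qed.

(** With [s = 1/t] and [ds/dt = - s^2], the derivative of [P(s) exp(-s)] in [t] is
    [s^2 (P - P')(s) exp(-s)]. *)
Definition flat_deriv_poly P := 'X^2 * (P - P^`()).

Lemma is_derive_flat P (t : R) :
  is_derive t 1 (flat P) (flat (flat_deriv_poly P) t).
Proof.
have [t0|t0|<-] := ltgtP 0 t.
- have H : is_derive t 1 (fun t => P.[t^-1] * expR (- t^-1))
       (flat (flat_deriv_poly P) t).
    have tn0 : t != 0 by rewrite gt_eqF.
    have iv : is_derive t 1 (fun t : R => t^-1) (- t ^- 2).
      refine (is_derive_eq (@is_deriveV R id t 1 1 tn0 (is_derive_id _ _)) _).
      by rewrite -[LHS]/(_ * _) mulr1.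
    have ivN : is_derive t 1 (fun t : R => - t^-1) (t ^- 2).
      by have := is_deriveN iv; rewrite opprK.
    have d1 := is_derive1_comp (is_derive_poly P t^-1) iv.
    have d2 := @is_derive1_comp R expR (fun t => - t^-1) t _ _
      (is_derive_expR (- t^-1)) ivN.
    refine (is_derive_eq (is_deriveM d1 d2) _).
    rewrite /flat t0 /flat_deriv_poly hornerM hornerXn hornerD hornerN.
    rewrite -![_ *: _]/(_ * _) /= exprVn; ring.
  apply: near_eq_is_derive H.
  have : \forall s \near t, 0 < s by exact: lt_nbhsr.
  by apply: filterS => s s0; rewrite /flat s0.
- have H : is_derive t 1 (cst (0 : R)) (flat (flat_deriv_poly P) t).
    by rewrite /flat ltNge (ltW t0)/=; exact: is_derive_cst.
  apply: near_eq_is_derive H.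
  have : \forall s \near t, s < 0 by exact: lt_nbhsl.
  by apply: filterS => s s0; rewrite /flat ltNge (ltW s0).
(* At 0 the difference quotient is at most [c * |h|] in absolute value, hence tends to 0. *)
- have [c c0 H] := flat_le_sqr P.
  have f0 Q : flat Q 0 = 0 by rewrite /flat ltxx.
  have cv : h^-1 *: ((flat P \o shift 0) (h *: 1) - flat P 0) @[h --> 0^'] --> (0 : R).
    apply/cvgrPdist_le => /= e e0; near=> h.
    rewrite sub0r normrN f0 subr0 addr0 normrM normrV ?unitfE; last first.
      by near: h; exact: nbhs_dnbhs_neq.
    have hn0 : h != 0 by near: h; exact: nbhs_dnbhs_neq.
    rewrite ler_pdivrMl ?normr_gt0//.
    rewrite [h *: _](_ : _ = h); last by rewrite -[LHS]/(_ * _) mulr1.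
    apply: le_trans (H h) _; rewrite -real_normK ?num_real// expr2 mulrA mulrC.
    apply: ler_wpM2l => //.
    apply: (@le_trans _ _ ((c + 1) * `|h|)); first by rewrite ler_wpM2r// lerDl.
    rewrite -ler_pdivlMl; last by rewrite ltr_wpDl.
    near: h; apply: dnbhs0_le; rewrite mulr_gt0// invr_gt0 ltr_wpDl//.
  apply: DeriveDef; first by apply/cvg_ex; exists 0.
  by rewrite f0; apply/cvg_lim.
Unshelve. all: by end_near. Qed.

Lemma C_on_flat k (U : set R) P : C_on k U (flat P).
Proof.
have df Q t : differentiable (flat Q) t.
  by apply/derivable1_diffP; have [] := is_derive_flat Q t.
elim: k U P => [|k IH] U P.
  by move=> t _; exact/differentiable_continuous/df.
split=> [t _|v]; first exact: df.
have -> : (fun t => 'D_v (flat P) t) = flat (v *: flat_deriv_poly P).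
  apply/funext => t; rewrite deriveE// -[v in LHS]mulr1 -[v * 1]/(v *: 1).
  rewrite linearZ /= -deriveE//; have [_ ->] := is_derive_flat P t.
  by rewrite /flat; case: ifP; rewrite ?scaler0// hornerZ -[LHS]/(_ * _) mulrA.
exact: IH.
Qed.

Lemma has_coords_real : @has_coords R R.
Proof.
exists 1%N, (fun=> 1), (fun=> idfun); split=> [_ x|x]; first exact: cvg_id.
by rewrite big_ord1 /= -[RHS]/(_ * _) mulr1.
Qed.

(** The flat function is composed with [r^2] minus the Euclidean square distance to [u], which is a
    polynomial, and normalized at [u]. The norm of the statement is the maximum norm, which the
    Euclidean one dominates. *)
Lemma smooth_bump m (u : 'rV[R]_m) (r : R) : 0 < r ->
  exists rho : 'rV[R]_m -> R, [/\ smooth_on setT rho, rho u = 1 &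
    forall v, r < `|u - v| -> rho v = 0].
Proof.
move=> r0.
pose q (v : 'rV[R]_m) := r ^+ 2 - \sum_i (v 0 i - u 0 i) ^+ 2.
pose e := flat 1 (r ^+ 2).
have e0 : e != 0.
  by rewrite /e /flat exprn_gt0// hornerE mul1r gt_eqF// expR_gt0.
exists (fun v => e^-1 * flat 1 (q v)); split.
- move=> k; apply: C_onM (@openT _) (C_on_cst k setT e^-1) _.
  have Cq : C_on k setT q.
    have -> : q = (fun=> r ^+ 2) + (-1) *: (\sum_i (fun v : 'rV[R]_m =>
         (rcoord i v - u 0 i) * (rcoord i v - u 0 i))).
      apply/funext => v; rewrite /q [RHS]/GRing.add /= fctE fct_sumE.
      by rewrite -[_ *: _]/(_ * _) mulN1r; under eq_bigr do rewrite expr2.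
    apply: C_onD openT (C_on_cst _ _ _) _.
    rewrite -[_ *: _]addr0; apply: C_onZD openT _ (C_on_cst _ _ (0 : R)).
    apply: C_on_sum openT _ => i.
    have Ci : C_on k setT (fun v : 'rV[R]_m => rcoord i v - u 0 i).
      apply: C_onD openT _ (C_on_cst _ _ _).
      by apply: C_on_lin; exact: coord_continuous.
    exact: (C_onM openT Ci Ci).
  exact: (C_on_comp_real (U' := setT) has_coords_real openT (fun _ _ => I) Cq
    (C_on_flat k setT 1)).
- rewrite /q big1 ?subr0 ?mulVf// => i _.
  by rewrite subrr expr0n.
- move=> v rv; rewrite /flat ifF ?mulr0//; apply/negbTE; rewrite -leNgt subr_le0.
  (* The maximum norm is attained at a coordinate [j], whose square alone already exceeds [r^2]. *)
  have [[i j] /= E] := mx_norm_neq0 (x := u - v) (lt0r_neq0 (lt_trans r0 rv)).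
  rewrite ord1 in E.
  rewrite (bigD1 j)//= -[leLHS]addr0 lerD ?sumr_ge0// => [|l _]; last exact: sqr_ge0.
  have : r < `|u 0 j - v 0 j|.
    move: rv; rewrite [X in _ < X -> _]E !mxE.
    by [].
  rewrite distrC -[X in _ -> _ <= X]real_normK ?num_real// => /ltW ru.
  by rewrite lerXn2r// ?nnegrE// ltW.
Qed.
End Bump.

(** * Differentials from remainder estimates, integrals over the unit interval *)

Lemma differentiable_remainder (R : realType) (V W : normedModType R)
    (F : V -> W) (L : {linear V -> W}) (x : V) : continuous L ->
  (forall e : {posnum R}, \forall h \near 0,
     `|F (x + h) - (F x + L h)| <= e%:num * `|h|) ->
  differentiable F x /\ forall w, 'D_w F x = L w.
Proof.
move=> cL H.
have E : F \o shift x = cst (F x) + L +o_ 0 id.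
  apply/eqaddoP => _/posnumP[e]; have := H e; apply: filterS => h.
  by rewrite !fctE /= [h + x]addrC.
have dL := diff_unique cL E.
have dF : differentiable F x by apply/diff_locallyP; rewrite dL; split=> //; exact: E.
by split=> // w; rewrite deriveE// dL.
Qed.

Section UnitIntegral.
Variable R : realType.
Local Notation mu := (@lebesgue_measure R).

Definition int01 (f : R -> R) : R := (\int[mu]_(t in `[0%R, 1%R]) f t)%R.

(** Continuity is two-sided even at the endpoints. The integrands below satisfy this, and it
    composes without subspace topologies. *)
Definition cont01 (f : R -> R) := forall t, 0 <= t <= 1 -> {for t, continuous f}.

Lemma cont01_within f : cont01 f -> {within `[0%R, 1%R], continuous f}.
Proof.
move=> cf; apply: continuous_in_subspaceT => t; rewrite inE /= in_itv /=.
exact: cf.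
Qed.

Lemma cont01_integrable f : cont01 f ->
  mu.-integrable `[0%R, 1%R] (EFin \o f).
Proof.
move=> cf; apply: continuous_compact_integrable; first exact: segment_compact.
exact: cont01_within.
Qed.

Lemma int01D f g : cont01 f -> cont01 g ->
  int01 (fun t => f t + g t) = int01 f + int01 g.
Proof. by move=> cf cg; apply: RintegralD => //; exact: cont01_integrable. Qed.

Lemma int01Z a f : cont01 f -> int01 (fun t => a * f t) = a * int01 f.
Proof. by move=> cf; apply: RintegralZl => //; exact: cont01_integrable. Qed.

Lemma cont01_cst (a : R) : cont01 (fun=> a).
Proof. by move=> t _; exact: cvg_cst. Qed.

Lemma cont01D f g : cont01 f -> cont01 g -> cont01 (fun t => f t + g t).
Proof. by move=> cf cg t t01; apply: cvgD; [exact: cf|exact: cg]. Qed.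

Lemma cont01M f g : cont01 f -> cont01 g -> cont01 (fun t => f t * g t).
Proof. by move=> cf cg t t01; apply: cvgM; [exact: cf|exact: cg]. Qed.

Lemma cont01_sum (I : Type) (r : seq I) (f : I -> R -> R) :
  (forall i, cont01 (f i)) -> cont01 (fun t => \sum_(i <- r) f i t).
Proof.
move=> cf; elim: r => [|i r IH].
  by under eq_fun do rewrite big_nil; exact: cont01_cst.
by under eq_fun do rewrite big_cons; exact: cont01D.
Qed.

Lemma int01_sum (I : Type) (r : seq I) (f : I -> R -> R) :
  (forall i, cont01 (f i)) ->
  int01 (fun t => \sum_(i <- r) f i t) = \sum_(i <- r) int01 (f i).
Proof.
move=> cf; elim: r => [|i r IH].
  rewrite big_nil /int01; under eq_Rintegral do rewrite big_nil.
  by rewrite Rintegral_cst// mul0r.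
rewrite big_cons -IH -int01D//; last exact: cont01_sum.
by rewrite /int01; under eq_Rintegral do rewrite big_cons.
Qed.

Lemma int01_norm_le f c : cont01 f ->
  (forall t, 0 <= t <= 1 -> `|f t| <= c) -> `|int01 f| <= c.
Proof.
move=> cf fc; apply: (le_trans (le_normr_Rintegral _ (cont01_integrable cf))) => //.
have -> : c = (\int[mu]_(t in `[0%R, 1%R]) c)%R.
  by rewrite Rintegral_cst//= lebesgue_measure_itv/= lte01 oppr0 adde0 mulr1.
apply: le_Rintegral => //.
- apply: cont01_integrable => t t01; apply: cvg_norm; exact: cf.
- by apply: cont01_integrable; exact: cont01_cst.
Qed.

Lemma int01_FTC (f F : R -> R) : cont01 f ->
  (forall t : R, 0 <= t <= 1 -> is_derive t 1 F (f t)) -> int01 f = F 1 - F 0.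
Proof.
move=> cf dF.
have cF (t : R) : 0 <= t <= 1 -> {for t, continuous F}.
  move=> /dF[d _]; apply: differentiable_continuous.
  exact/derivable1_diffP.
have dL : derivable_oo_LRcontinuous F 0 1.
  split.
  - by move=> t; rewrite in_itv /= => /andP[/ltW t0 /ltW t1]; have [|] := dF t; rewrite ?t0 ?t1.
  - by apply: cvg_at_right_filter; apply: cF; rewrite lexx ler01.
  - by apply: cvg_at_left_filter; apply: cF; rewrite lexx ler01.
rewrite /int01 /Rintegral (continuous_FTC2 ltr01 (cont01_within cf) dL)//.
move=> t; rewrite in_itv /= => /andP[/ltW t0 /ltW t1].
by rewrite derive1E; have [|] := dF t; rewrite ?t0 ?t1.
Qed.

End UnitIntegral.

(** * Restriction to lines, mean values and symmetry of second derivatives *)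

Section AlongLines.
Variables (R : realType) (V : normedModType R).
Implicit Types (f : V -> R) (p h : V).

Lemma is_derive_line f p h (s : R) : differentiable f (p + s *: h) ->
  is_derive s 1 (fun s => f (p + s *: h)) ('D_h f (p + s *: h)).
Proof.
move=> df.
have E : (fun s => p + s *: h) = (fun=> p) + scale_on h by [].
have cs : continuous (scale_on h).
  by move=> x; apply: cvgZr_tmp; exact: cvg_id.
have ds : differentiable (scale_on h) s by exact: linear_differentiable.
have dr : differentiable (fun s : R => p + s *: h) s.
  by rewrite E; apply: differentiableD => //; exact: differentiable_cst.
apply: DeriveDef.
  by apply: diff_derivable; exact: differentiable_comp.
rewrite deriveE; last exact: differentiable_comp.
rewrite (diff_comp dr df) /= -(deriveE _ dr) E deriveD; last 2 first.
- exact: derivable_cst.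
- exact: diff_derivable.
by rewrite derive_cst add0r (deriveE _ ds) diff_lin//= /scale_on scale1r deriveE.
Qed.

Lemma line_MVT f p h :
  (forall s : R, 0 <= s <= 1 -> differentiable f (p + s *: h)) ->
  exists2 s : R, 0 <= s <= 1 & f (p + h) - f p = 'D_h f (p + s *: h).
Proof.
move=> df.
have [] := @MVT R (fun s => f (p + s *: h)) (fun s => 'D_h f (p + s *: h)) 0 1
  ltr01.
- move=> s; rewrite in_itv /= => /andP[/ltW s0 /ltW s1].
  by apply/is_derive_line/df; rewrite s0.
- apply: cont01_within => s s01.
  have [d _] := is_derive_line (df _ s01).
  exact/differentiable_continuous/derivable1_diffP.
- move=> s; rewrite in_itv /= => /andP[/ltW s0 /ltW s1].
  rewrite scale1r scale0r addr0 subr0 mulr1 => E.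
  by exists s => //; rewrite s0.
Qed.

Lemma deriveZv f p (a : R) h : differentiable f p ->
  'D_(a *: h) f p = a * 'D_h f p.
Proof. by move=> df; rewrite !deriveE// linearZ. Qed.

(** Two mean value theorems: the first along [v] for [y |-> f (y + s w) - f y], the second along [w]
    for ['D_v f]. *)
Lemma second_difference (U : set V) f x v w (s : R) : C_on 2 U f ->
  (forall a b : R, 0 <= a <= 1 -> 0 <= b <= 1 ->
     U (x + a *: (s *: v) + b *: (s *: w))) ->
  exists p : R * R, [/\ 0 <= p.1 <= 1, 0 <= p.2 <= 1 &
    f (x + s *: v + s *: w) - f (x + s *: v) - (f (x + s *: w) - f x) =
    s ^+ 2 * 'D_w (fun y => 'D_v f y) (x + p.1 *: (s *: v) + p.2 *: (s *: w))].
Proof.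
move=> [df Df] Ux; have [dDv _] := Df v.
have i0 : 0 <= (0 : R) <= 1 by rewrite lexx ler01.
have i1 : 0 <= (1 : R) <= 1 by rewrite lexx ler01.
pose g y := f (y + s *: w) - f y.
have dg a : 0 <= a <= 1 -> differentiable g (x + a *: (s *: v)) /\
   'D_v g (x + a *: (s *: v)) =
     'D_v f (x + a *: (s *: v) + s *: w) - 'D_v f (x + a *: (s *: v)).
  move=> a01.
  have d1 : differentiable f (x + a *: (s *: v) + s *: w).
    by apply: df; have := Ux a 1 a01 i1; rewrite scale1r.
  have d2 : differentiable f (x + a *: (s *: v)).
    by apply: df; have := Ux a 0 a01 i0; rewrite scale0r addr0.
  have ds y : differentiable (shift (s *: w) : V -> V) y.
    by apply: differentiableD.
  have dfs : differentiable (f \o shift (s *: w)) (x + a *: (s *: v)).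
    exact: differentiable_comp.
  have -> : g = f \o shift (s *: w) - f by [].
  split; first exact: differentiableB.
  rewrite deriveB; [|exact: diff_derivable..]; congr (_ - _).
  rewrite deriveE// diff_comp//= deriveE//; congr ('d _ _ _).
  rewrite -deriveE// -[LHS]/('D_v (id + cst (s *: w)) (x + a *: (s *: v))).
  rewrite deriveD; [|exact: derivable_id|exact: derivable_cst].
  by rewrite derive_id derive_cst addr0.
have [a a01] := @line_MVT g x (s *: v) (fun a a01 => (dg a a01).1).
rewrite deriveZv; last by have [] := dg a a01.
have [_ ->] := dg a a01.
have [b b01] := @line_MVT (fun y => 'D_v f y) (x + a *: (s *: v)) (s *: w)
  (fun b b01 => dDv _ (Ux a b a01 b01)).
rewrite deriveZv; last by apply: dDv; exact: Ux.
move=> -> E; exists (a, b); split=> //.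
by rewrite expr2 -mulrA -E.
Qed.

(** The second difference is symmetric in [v] and [w], and it equals [s^2] times either mixed
    derivative at some point of a small parallelogram. Continuity of both mixed derivatives at [x]
    then forces them to agree. *)
Lemma schwarz (U : set V) f x v w : open U -> U x -> C_on 2 U f ->
  'D_w (fun y => 'D_v f y) x = 'D_v (fun y => 'D_w f y) x.
Proof.
move=> oU Ux Cf; have [_ Df] := Cf.
have [_ /(_ w) Cvw] := Df v; have [_ /(_ v) Cwv] := Df w.
apply/eqP; rewrite -subr_eq0 -normr_le0; apply/ler_addgt0Pr => e e0.
rewrite add0r.
have e20 : 0 < e / 2 by rewrite divr_gt0.
have key (y1 y2 z1 z2 : R) : `|y1 - z1| <= e / 2 -> `|y2 - z2| <= e / 2 ->
    z1 = z2 -> `|y1 - y2| <= e.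
  move=> yz1 yz2 z12; rewrite (splitr e) -(subrKA z1) {2}z12.
  by apply: le_trans (ler_normD _ _) _; rewrite lerD// distrC.
have nU : \forall y \near x, U y by exact: open_nbhs_nbhs.
have : \forall y \near x, [/\ U y,
    `|'D_w (fun y => 'D_v f y) x - 'D_w (fun y => 'D_v f y) y| <= e / 2 &
    `|'D_v (fun y => 'D_w f y) x - 'D_v (fun y => 'D_w f y) y| <= e / 2].
  have nC1 : \forall y \near x,
      `|'D_w (fun y => 'D_v f y) x - 'D_w (fun y => 'D_v f y) y| <= e / 2.
    by have /cvgrPdist_le := Cvw x Ux; apply.
  have nC2 : \forall y \near x,
      `|'D_v (fun y => 'D_w f y) x - 'D_v (fun y => 'D_w f y) y| <= e / 2.
    by have /cvgrPdist_le := Cwv x Ux; apply.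
  by move: nU nC1 nC2; apply: filterS3 => y Uy C1 C2; split.
move=> /nbhs_ballP[d /= d0 dB].
(* This scale keeps the whole parallelogram spanned by [s v] and [s w] in the ball of radius [d];
   the added 1 avoids division by zero. *)
pose s := d / (`|v| + `|w| + 1).
have s0 : 0 < s by rewrite divr_gt0// ltr_wpDl ?addr_ge0.
have sB (a b : R) v1 w1 : `|v1| + `|w1| = `|v| + `|w| -> 0 <= a <= 1 -> 0 <= b <= 1 ->
    ball x d (x + a *: (s *: v1) + b *: (s *: w1)).
  move=> vw1 /andP[a0 a1] /andP[b0 b1]; rewrite -ball_normE /= -addrA opprD addNKr normrN.
  apply: le_lt_trans (ler_normD _ _) _.
  rewrite (normrZ a) (normrZ b) (normrZ s v1) (normrZ s w1).
  rewrite (ger0_norm a0) (ger0_norm b0) (gtr0_norm s0).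
  apply: (@le_lt_trans _ _ (s * `|v1| + s * `|w1|)).
    by apply: lerD; rewrite ler_piMl ?mulr_ge0// ltW.
  rewrite -mulrDr vw1 /s mulrAC ltr_pdivrMr ?ltr_wpDl ?addr_ge0//.
  by rewrite ltr_pM2l// ltrDl.
have [[a b] /= [a01 b01 E1]] := second_difference Cf
  (fun a b a01 b01 => let: And3 h _ _ := dB _ (sB a b v w erefl a01 b01) in h).
have [[a' b'] /= [a01' b01' E2]] := second_difference Cf
  (fun a b a01 b01 => let: And3 h _ _ := dB _ (sB a b w v (addrC _ _) a01 b01) in h).
have : s ^+ 2 * 'D_w (fun y => 'D_v f y) (x + a *: (s *: v) + b *: (s *: w)) =
   s ^+ 2 * 'D_v (fun y => 'D_w f y) (x + a' *: (s *: w) + b' *: (s *: v)).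
  rewrite -E1 -E2 [x + s *: w + s *: v]addrAC.
  have swap (y1 y2 y3 y4 : R) : y1 - y2 - (y3 - y4) = y1 - y3 - (y2 - y4) by ring.
  exact: swap.
move=> /(mulfI (lt0r_neq0 (exprn_gt0 2 s0))) E.
have [_ H1 _] := dB _ (sB a b v w erefl a01 b01).
have [_ _ H2] := dB _ (sB a' b' w v (addrC _ _) a01' b01').
exact: key H1 H2 E.
Qed.

End AlongLines.

(** * Hadamard's lemma *)

Section Hadamard.
Variables (R : realType) (m : nat) (u : 'rV[R]_m) (r : R).
Local Notation V := 'rV[R]_m.
Let B : set V := ball u r.

Definition ray (t : R) (v : V) : V := u + t *: (v - u).

Lemma ball_open_set : open B. Proof. exact: ball_open. Qed.

Lemma ballE v : B v <-> `|u - v| < r.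
Proof. by rewrite /B -ball_normE. Qed.

Lemma ray_ball t v : 0 <= t <= 1 -> B v -> B (ray t v).
Proof.
move=> /andP[t0 t1] /ballE Bv; apply/ballE.
rewrite /ray opprD addNKr normrN normrZ ger0_norm// distrC.
by apply: le_lt_trans Bv; exact: ler_piMl.
Qed.

Lemma ray_continuous t v : {for (t, v), continuous (fun p : R * V => ray p.1 p.2)}.
Proof.
apply: cvgD; first exact: cvg_cst.
apply: cvgZ; first exact: cvg_fst.
by apply: cvgB; [exact: cvg_snd|exact: cvg_cst].
Qed.

Lemma ray_continuous1 v t : {for t, continuous (fun t => ray t v)}.
Proof.
apply: cvgD; first exact: cvg_cst.
by apply: cvgZ; [exact: cvg_id|exact: cvg_cst].
Qed.

Lemma cont01_ray (f : V -> R) v : C_on 0 B f -> B v ->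
  cont01 (fun t => f (ray t v)).
Proof.
move=> cf Bv t t01; apply: continuous_comp; first exact: ray_continuous1.
by apply: cf; exact: ray_ball.
Qed.

(** Compactness of the unit interval makes the neighbourhood of [v] independent of [t]. *)
Lemma ray_uniform (f : V -> R) v e : C_on 0 B f -> B v -> 0 < e ->
  \forall w \near v, forall t, 0 <= t <= 1 -> `|f (ray t w) - f (ray t v)| <= e.
Proof.
move=> cf Bv e0.
have := @segment_compact R 0 1.
move=> /compact_near_coveringP /(_ V (nbhs v)
  (fun w t => `|f (ray t w) - f (ray t v)| <= e)) H.
have : \forall w \near v, `[0%R, 1%R] `<=` (fun t => `|f (ray t w) - f (ray t v)| <= e).
  apply: H => t; rewrite /= in_itv /= => t01.
  have ct : {for (t, v), continuous (fun p : R * V => f (ray p.1 p.2) - f (ray p.1 v))}.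
    apply: cvgB.
      apply: (@continuous_comp _ _ _ (fun p : R * V => ray p.1 p.2) f).
        exact: ray_continuous.
      by apply: cf; exact: ray_ball.
    apply: (@continuous_comp _ _ _ (fun p : R * V => p.1) (fun t => f (ray t v))).
      exact: cvg_fst.
    exact: cont01_ray.
  move/cvgrPdist_le : ct => /(_ e e0).
  rewrite /= subrr; under eq_near do rewrite sub0r normrN.
  by [].
apply: filterS => w Hw t t01; apply: Hw.
by rewrite /= in_itv.
Qed.

(** The weight [t ^+ a] makes the family stable under derivation: the inner derivative of [ray t] is
    [t], so each derivative raises [a] by one. *)
Definition ray_int (a : nat) (f : V -> R) (v : V) : R :=
  int01 (fun t => t ^+ a * f (ray t v)).

Lemma cont01_exp (a : nat) : cont01 (fun t : R => t ^+ a).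
Proof. by move=> t _; exact: exprn_continuous. Qed.

Lemma norm_expr01 (t : R) a : 0 <= t <= 1 -> `|t ^+ a| <= 1.
Proof. by move=> /andP[t0 t1]; rewrite normrX ger0_norm// exprn_ile1. Qed.

Lemma ray_int_continuous a f : C_on 0 B f -> C_on 0 B (ray_int a f).
Proof.
move=> cf v Bv; apply: (@cvgrPdist_le _ _ _ (nbhs v) _ _ _).2 => e e0.
have nB : \forall w \near v, B w by apply: open_nbhs_nbhs; split=> //; exact: ball_open_set.
near=> w.
have Bw : B w by near: w.
have uw : forall t, 0 <= t <= 1 -> `|f (ray t w) - f (ray t v)| <= e.
  by near: w; exact: ray_uniform.
have c1 := cont01M (@cont01_exp a) (cont01_ray cf Bv).
have c2 := cont01M (@cont01_cst R (-1)) (cont01M (@cont01_exp a) (cont01_ray cf Bw)).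
have c3 := (cont01M (@cont01_exp a) (cont01_ray cf Bw)).
rewrite -[- _]mulN1r -int01Z// -int01D//.
apply: int01_norm_le; first exact: cont01D.
move=> t t01; rewrite mulN1r -mulrBr normrM distrC -[e]mul1r.
by apply: ler_pM => //; [exact: norm_expr01|exact: uw].
Unshelve. all: by end_near. Qed.

Definition dotp (c : 'I_m -> R) (h : V) : R := \sum_j c j * h 0 j.
Lemma dotp_linear c : linear (dotp c).
Proof.
move=> a x y; rewrite /dotp scaler_sumr -big_split /=; apply: eq_bigr => j _.
by rewrite !mxE -[_ *: (_ * _)]/(_ * (_ * _)); ring.
Qed.
HB.instance Definition _ c := GRing.isLinear.Build R V R *:%R
  (dotp c) (dotp_linear c).

Lemma dotp_continuous c : continuous (dotp c).
Proof.
have : C_on 0 setT (\sum_j (fun=> c j) * (rcoord j : V -> R)).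
  apply: C_on_sum openT _ => j; apply: C_onM openT (C_on_cst _ _ _) _.
  by apply: C_on_lin; exact: coord_continuous.
have -> : \sum_j (fun=> c j) * (rcoord j : V -> R) = dotp c.
  by apply/funext => h; rewrite fct_sumE.
by move=> H x; exact: H.
Qed.

Lemma derive_dotp (f : V -> R) x v : differentiable f x ->
  'D_v f x = dotp (fun j => 'D_('e_j) f x) v.
Proof.
move=> df; rewrite deriveE// {1}(row_sum_delta v) linear_sum.
apply: eq_bigr => j _; rewrite linearZ /= -deriveE//.
by rewrite mulrC.
Qed.

Lemma is_derive_ray (f : V -> R) (t s : R) v h : differentiable f (ray t (v + s *: h)) ->
  is_derive s 1 (fun s => f (ray t (v + s *: h))) (t * 'D_h f (ray t (v + s *: h))).
Proof.
have rE k : ray t (v + k *: h) = ray t v + k *: (t *: h).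
  by rewrite /ray addrAC scalerDr addrA !scalerA mulrC.
rewrite rE => df; rewrite -deriveZv//.
by under eq_fun do rewrite rE; exact: is_derive_line.
Qed.

Lemma ray_increment (f : V -> R) v h t : C_on 1 B f -> B v -> B (v + h) ->
   0 <= t <= 1 -> exists2 s, 0 <= s <= 1 &
  f (ray t (v + h)) - f (ray t v) = t * 'D_h f (ray t (v + s *: h)).
Proof.
move=> [df _] Bv Bvh t01.
have Bs s : 0 <= s <= 1 -> B (ray t (v + s *: h)).
  move=> s01; apply: ray_ball => //.
  have -> : v + s *: h = (1 - s) *: v + s *: (v + h).
    by rewrite scalerDr scalerBl scale1r addrA subrK.
  move: s01 => /andP[s0 s1]; move: Bv Bvh => /ballE Bv /ballE Bvh; apply/ballE.
  have -> : u - ((1 - s) *: v + s *: (v + h)) =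
     (1 - s) *: (u - v) + s *: (u - (v + h)).
    rewrite !scalerBr addrACA -opprD; congr (_ - _).
    by rewrite -scalerDl subrK scale1r.
  apply: le_lt_trans (ler_normD _ _) _; rewrite !normrZ !ger0_norm ?subr_ge0//.
  set M := Num.max `|u - v| `|u - (v + h)|.
  have mr : M < r by rewrite gt_max Bv.
  apply: le_lt_trans mr; rewrite [leRHS](_ : M = (1 - s) * M + s * M); last by ring.
  by apply: lerD; apply: ler_wpM2l; rewrite ?subr_ge0// le_max lexx ?orbT.
have [] := @MVT R (fun s => f (ray t (v + s *: h)))
   (fun s => t * 'D_h f (ray t (v + s *: h))) 0 1 ltr01.
- move=> s; rewrite in_itv /= => /andP[/ltW s0 /ltW s1].
  by apply/is_derive_ray/df/Bs; rewrite s0.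
- apply: cont01_within => s s01.
  have [d _] := is_derive_ray (df _ (Bs s s01)).
  exact/differentiable_continuous/derivable1_diffP.
- move=> s; rewrite in_itv /= => /andP[/ltW s0 /ltW s1].
  rewrite scale1r scale0r addr0 subr0 mulr1 => E.
  by exists s => //; rewrite s0.
Qed.

(** Differentiation under the integral sign: the mean value theorem along [h] reduces the remainder
    to the variation of the partial derivatives of [f], which is small uniformly in [t] by
    [ray_uniform]. *)
Lemma ray_int_diff a f v : C_on 1 B f -> B v ->
  differentiable (ray_int a f) v /\
  forall w, 'D_w (ray_int a f) v = ray_int a.+1 (fun x => 'D_w f x) v.
Proof.
move=> Cf Bv; have [df Df] := Cf.
have C0 : C_on 0 B f := C_onW Cf.
pose L : {linear V -> R} := dotp (fun j => ray_int a.+1 (fun x => 'D_('e_j) f x) v).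
have cD w := cont01_ray (Df w) Bv.
have LE h : L h = ray_int a.+1 (fun x => 'D_h f x) v.
  rewrite /L /= /dotp /ray_int.
  transitivity (int01 (fun t => \sum_j h 0 j *
      (t ^+ a.+1 * 'D_('e_j) f (ray t v)))).
    rewrite int01_sum => [|j]; last first.
      apply: cont01M; first exact: cont01_cst.
      by apply: cont01M (cD _); exact: cont01_exp.
    apply: eq_bigr => j _; rewrite int01Z 1?mulrC//.
    by apply: cont01M (cD _); exact: cont01_exp.
  apply: eq_Rintegral => t; rewrite inE /= in_itv /= => t01.
  rewrite derive_dotp; last by apply: df; exact: ray_ball.
  rewrite /dotp mulr_sumr; apply: eq_bigr => j _; ring.
have cL : continuous L := @dotp_continuous _.
have [|dI DI] := differentiable_remainder (F := ray_int a f) (x := v) cL; last first.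
  by split=> // w; rewrite DI LE.
move=> e.
(* The error adds up over the [m] coordinate directions, hence this share of [e]. *)
pose e' := e%:num / (m%:R + 1).
have e'0 : 0 < e' by rewrite divr_gt0// ltr_wpDl.
have : \forall w \near v, forall j t, 0 <= t <= 1 ->
    `|'D_('e_j) f (ray t w) - 'D_('e_j) f (ray t v)| <= e'.
  exact: (filter_forall (f := fun j w => forall t, 0 <= t <= 1 ->
    `|'D_('e_j) f (ray t w) - 'D_('e_j) f (ray t v)| <= e') _
    (fun j => ray_uniform (Df 'e_j) Bv e'0)).
have /[swap] : \forall w \near v, B w.
  by apply: open_nbhs_nbhs; split=> //; exact: ball_open_set.
move=> /filterI /[apply] /nbhs_ballP[d /= d0 dB].
have vd (h : V) (s : R) : `|h| < d -> 0 <= s <= 1 -> ball v d (v + s *: h).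
  move=> hd /andP[s0 s1]; rewrite -ball_normE /= opprD addNKr normrN normrZ.
  by rewrite ger0_norm// (le_lt_trans _ hd)// ler_piMl.
near=> h.
have hd : `|h| < d.
  near: h; apply/nbhs_ballP; exists d => // h.
  by rewrite -ball_normE /= sub0r normrN.
have Bvh : B (v + h).
  have /dB[_] : ball v d (v + (1 : R) *: h) by apply: vd => //; rewrite ler01 lexx.
  by rewrite scale1r.
rewrite LE.
have c1 := cont01M (@cont01_exp a) (cont01_ray C0 Bv).
have c2 := cont01M (@cont01_exp a) (cont01_ray C0 Bvh).
have c3 := cont01M (@cont01_exp a.+1) (cD h).
have c4 := cont01D c2 (cont01M (@cont01_cst R (-1)) (cont01D c1 c3)).
rewrite -[- _]mulN1r -int01D// -int01Z//; last exact: cont01D.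
rewrite -int01D//; last exact: cont01M (@cont01_cst R (-1)) (cont01D c1 c3).
apply: int01_norm_le => // t t01.
(* The intermediate [s] depends on [t], which does no harm: the bounds [dB] hold on the whole ball
   and for all [t]. *)
have [s s01 inc] := ray_increment Cf Bv Bvh t01.
rewrite [X in `|X|](_ : _ = t ^+ a.+1 *
   ('D_h f (ray t (v + s *: h)) - 'D_h f (ray t v))); last first.
  rewrite mulN1r opprD addrA -mulrBr inc exprS; ring.
have /dB[Dvs Bvs] := vd h s hd s01.
rewrite normrM -[leRHS]mul1r; apply: ler_pM => //; first exact: norm_expr01.
rewrite !derive_dotp; [|by apply: df; exact: ray_ball..].
rewrite /dotp -sumrB; apply: le_trans (ler_norm_sum _ _ _) _.
apply: (@le_trans _ _ (\sum_(j < m) e' * `|h|)).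
  apply: ler_sum => j _; rewrite -mulrBl normrM.
  apply: ler_pM => //; first exact: Dvs.
  rewrite [leRHS]/Num.norm /= mx_normrE; apply/bigmax_geP; right => /=.
  by exists (0, j).
rewrite sumr_const card_ord -mulrnAl ler_wpM2r// -mulr_natr /e' -mulrA.
by rewrite ler_piMr// ler_pdivrMl ?mulr1 ?lerDl// ltr_wpDl.
Unshelve. all: by end_near. Qed.

Lemma C_on_ray_int k a f : C_on k B f -> C_on k B (ray_int a f).
Proof.
elim: k a f => [|k IH] a f Cf; first exact: ray_int_continuous.
have C1 : C_on 1 B f by exact: C_on_le Cf.
split=> [v Bv|w]; first by have [] := ray_int_diff a C1 Bv.
have [_ Df] := Cf; have := IH a.+1 _ (Df w).
apply: C_on_eq ball_open_set _ => v Bv.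
by have [_ ->] := ray_int_diff a C1 Bv.
Qed.

(** The fundamental theorem of calculus along the ray from [u] to [v] gives [f v - f u] as the
    integral of ['D_(v - u) f]. Expanding [v - u] in coordinates, [g j] is the mean of the [j]-th
    partial derivative over that ray. *)
Lemma hadamard (f : V -> R) : smooth_on B f ->
  exists2 g : 'I_m -> V -> R, forall j, smooth_on B (g j) &
  forall v, B v -> f v = f u + \sum_j (v 0 j - u 0 j) * g j v.
Proof.
move=> sf; exists (fun j => ray_int 0 (fun x => 'D_('e_j) f x)).
  by move=> j k; apply: C_on_ray_int; have [_] := sf k.+1; exact.
move=> v Bv; have [df Df] := sf 1%N.
have cD w := cont01_ray (Df w) Bv.
have r1 : ray 1 v = v by rewrite /ray scale1r addrC subrK.
have r0 : ray 0 v = u by rewrite /ray scale0r addr0.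
have dF (t : R) : 0 <= t <= 1 ->
    is_derive t 1 (fun t => f (ray t v)) ('D_(v - u) f (ray t v)).
  move=> t01.
  have rE k : ray 1 (u + k *: (v - u)) = ray k v.
    by rewrite /ray scale1r addrAC subrr add0r.
  have dfk : differentiable f (ray 1 (u + t *: (v - u))).
    by rewrite rE; apply: df; exact: ray_ball.
  have := is_derive_ray dfk; rewrite mul1r rE.
  by under eq_fun do rewrite rE.
have := int01_FTC (cD (v - u)) dF; rewrite r1 r0 => FT.
rewrite -[LHS](subrK (f u)) addrC -FT.
congr (_ + _).
transitivity (int01 (fun t => \sum_j (v - u) 0 j * 'D_('e_j) f (ray t v))).
  apply: eq_Rintegral => t; rewrite inE /= in_itv /= => t01.
  rewrite derive_dotp; last by apply: df; exact: ray_ball.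
  by apply: eq_bigr => j _; rewrite mulrC.
rewrite int01_sum => [|j]; last by apply: cont01M (cD _); exact: cont01_cst.
apply: eq_bigr => j _; rewrite int01Z// !mxE; congr (_ * _).
by apply: eq_Rintegral => t _; rewrite expr0 mul1r.
Qed.

End Hadamard.

(** * Smooth functions on a manifold and derivations at a point *)

Lemma open_setI_preimage (T U : topologicalType) (f : T -> U) (A : set T)
    (N : set U) : open A -> (forall x, A x -> {for x, continuous f}) ->
  open N -> open (A `&` f @^-1` N).
Proof.
move=> oA cf oN; rewrite openE => x [Ax Nfx].
apply: filterI; first exact: open_nbhs_nbhs.
by apply: (cf x Ax); exact: open_nbhs_nbhs.
Qed.

Section SmoothOnManifold.
Variables (R : realType) (n : nat) (M : manifoldType R n).
Local Notation C := (Cinf M).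
Implicit Types (c d : chart R n M) (p : M).

(** Smoothness near each point need only be tested in one chart: in any other chart of the atlas the
    function is composed with a smooth transition map. *)
Lemma smooth_fun_local (f : M -> R) :
  (forall p, exists c (N : set 'rV[R]_n),
     [/\ atlas c, dom c p, open N, N `<=` cod c
       & N (fwd c p) /\ smooth_on N (f \o bwd c)]) -> smooth_fun f.
Proof.
move=> H d Ad k; apply: C_on_local => x dx.
have [c [N [Ac cp oN Nc [Np sN]]]] := H (bwd d x).
pose U1 := cod d `&` bwd d @^-1` dom c.
have oU1 : open U1.
  by apply: open_setI_preimage (@open_cod _ _ _ d) (@bwd_continuous _ _ _ d) (@open_dom _ _ _ c).
pose U := U1 `&` (fwd c \o bwd d) @^-1` N.
have oU : open U.
  apply: open_setI_preimage oU1 _ oN => y [dy cy].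
  by apply: continuous_comp; [exact: bwd_continuous|exact: fwd_continuous].
exists U, ((f \o bwd c) \o (fwd c \o bwd d)); split=> //.
  by move=> y [[dy cy] _] /=; rewrite fwdK.
apply: (C_on_comp_real (U' := N)) => //; first exact: has_coords_rV.
- by move=> y [].
- apply: C_on_sub (_ : U `<=` U1) _; first by move=> y [].
  exact: (atlas_compat d c Ad Ac k).
Qed.

Lemma smooth_fun_continuous (f : M -> R) : smooth_fun f -> continuous f.
Proof.
move=> sf p; have [c Ac cp] := atlas_cover p.
have : ((f \o bwd c) \o fwd c) x @[x --> p] --> f (bwd c (fwd c p)).
  apply: (@continuous_comp _ _ _ (fwd c) (f \o bwd c)); first exact: fwd_continuous.
  by apply: (sf c Ac 0%N); exact: fwd_cod.
rewrite fwdK//; apply: cvg_trans; apply: near_eq_cvg.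
have : \forall q \near p, dom c q by apply: open_nbhs_nbhs; split=> //; exact: open_dom.
by apply: filterS => q cq; rewrite /= fwdK.
Qed.

Definition mkC (f : M -> R) (sf : smooth_fun f) : C := MkCinf (introT (asboolP _) sf).

Lemma CinfP (f : C) : smooth_fun f.
Proof. by case: f => f /= /asboolP. Qed.

Lemma Cinf_eq (f g : C) : (forall x, f x = g x) -> f = g.
Proof. by move=> fg; apply/val_inj/funext. Qed.

Lemma Cinf_sumE (I : Type) (r : seq I) (P : pred I) (F : I -> C) x :
  (\sum_(i <- r | P i) F i) x = \sum_(i <- r | P i) F i x.
Proof. by elim/big_rec2 : _ => // i y1 y2 _ <-. Qed.

Definition ball_extension c (rho h : 'rV[R]_n -> R) (x : M) : R :=
  if x \in dom c then rho (fwd c x) * h (fwd c x) else 0.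

(** The product is supported in the image of a closed ball of radius [s]. This image is compact,
    hence closed because the manifold is Hausdorff, so every point not coming from the larger ball
    has a neighbourhood where the extension is zero. *)
Lemma smooth_ball_extension c u (r s : R) rho h : atlas c -> 0 < s -> s < r ->
  ball u r `<=` cod c ->
  smooth_on setT rho -> (forall v, s < `|u - v| -> rho v = 0) ->
  smooth_on (ball u r) h -> smooth_fun (ball_extension c rho h).
Proof.
move=> Ac s0 sr Bc srho rho0 sh; apply: smooth_fun_local => p.
have oB : open (ball u r) by apply: ball_open; exact: lt_trans sr.
have [[cp Bp]|ncp] := pselect (dom c p /\ ball u r (fwd c p)).
  exists c, (ball u r); split=> //; split=> // k.
  have Cr : C_on k (ball u r) (rho : 'rV[R]_n -> R).
    exact: C_on_sub (subsetT _) (srho k).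
  have := C_onM oB Cr (sh k).
  apply: C_on_eq => // y By; rewrite /ball_extension /=.
  rewrite mem_set; last by apply: bwd_dom; exact: Bc.
  by rewrite bwdK//; exact: Bc.
pose K0 := [set v : 'rV[R]_n | `|u - v| <= s].
have K0B : K0 `<=` ball u r.
  by move=> v /= vs; rewrite -ball_normE /=; exact: le_lt_trans sr.
have cK0 : compact K0.
  apply: bounded_closed_compact.
    exists (`|u| + s); split; first exact: num_real.
    move=> y yu v /= vs; apply: le_trans (ltW yu).
    rewrite -[v](subrK u) addrC; apply: le_trans (ler_normD _ _) _.
    by rewrite lerD2l distrC.
  exact: closed_closed_ball_.
pose K := bwd c @` K0.
have cK : closed K.
  apply: compact_closed; first exact: manifold_hausdorff.
  apply: continuous_compact cK0; apply: continuous_in_subspaceT => v.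
  by rewrite inE => Kv; apply: bwd_continuous; apply: Bc; exact: K0B.
have nKp : ~ K p.
  move=> [v Kv E]; apply: ncp; rewrite -E.
  have cv : cod c v by apply: Bc; exact: K0B.
  by split; [exact: bwd_dom|rewrite bwdK//; exact: K0B].
have [d Ad dp] := atlas_cover p.
exists d, (cod d `&` bwd d @^-1` ~` K); split=> //.
- apply: open_setI_preimage (@open_cod _ _ _ d) (@bwd_continuous _ _ _ d) _.
  exact: closed_openC.
split; first by split; [exact: fwd_cod|rewrite /= fwdK].
move=> k; apply: (@C_on_eq _ _ _ _ _ (fun=> 0)).
- apply: open_setI_preimage (@open_cod _ _ _ d) (@bwd_continuous _ _ _ d) _.
  exact: closed_openC.
- move=> y [dy nKy]; rewrite /ball_extension /=; case: ifPn => //.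
  rewrite inE => cy; rewrite rho0 ?mul0r// ltNge; apply/negP => ys.
  by apply: nKy; exists (fwd c (bwd d y)); rewrite ?fwdK.
- exact: C_on_cst.
Qed.

Definition derivation_at p (D : C -> R) : Prop :=
  [/\ forall f g : C, D (f + g) = D f + D g,
      forall (a : R) (f : C), D (a *: f) = a * D f
    & forall f g : C, D (f * g) = f p * D g + g p * D f].

Lemma vfield_derivation_at (X : vfield M) p : derivation_at p (fun f => X f p).
Proof.
have [XD XZ XM] := vfieldP X.
by split=> [f g|a f|f g]; [rewrite XD|rewrite XZ|rewrite XM].
Qed.

Section DerivationAt.
Variables (p : M) (D : C -> R).
Hypothesis dD : derivation_at p D.

Lemma derivation_at0 : D 0 = 0.
Proof. by have [_ DZ _] := dD; rewrite -(scale0r (0 : C)) DZ mul0r. Qed.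

Lemma derivation_at_sum (I : Type) (r : seq I) (F : I -> C) :
  D (\sum_(i <- r) F i) = \sum_(i <- r) D (F i).
Proof.
have [DD _ _] := dD; elim: r => [|i r IH]; first by rewrite !big_nil derivation_at0.
by rewrite !big_cons DD IH.
Qed.

End DerivationAt.

Lemma chart_ball c p : dom c p -> exists2 r : R, 0 < r & ball (fwd c p) r `<=` cod c.
Proof.
move=> cp; have : nbhs (fwd c p) (cod c).
  by apply: open_nbhs_nbhs; split; [exact: open_cod|exact: fwd_cod].
by move=> /nbhs_ballP[r r0 rB]; exists r.
Qed.

Lemma smooth_on_cst (V : normedModType R) (U : set V) (a : R) : smooth_on U (fun=> a).
Proof. by move=> k; exact: C_on_cst. Qed.

Definition chart_derive c p (v : 'rV[R]_n) (f : C) : R :=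
  'D_v (f \o bwd c) (fwd c p).

Lemma chart_differentiable c p (f : C) : atlas c -> dom c p ->
  differentiable (f \o bwd c) (fwd c p).
Proof. by move=> Ac cp; have [d _] := CinfP f Ac 1%N; apply: d; exact: fwd_cod. Qed.

Lemma chart_derivation_at c p v : atlas c -> dom c p ->
  derivation_at p (chart_derive c p v).
Proof.
move=> Ac cp; have df (f : C) : derivable (f \o bwd c) (fwd c p) v.
  by apply: diff_derivable; exact: chart_differentiable.
rewrite /chart_derive; split=> [f g|a f|f g].
- by rewrite -[LHS]/('D_v ((f \o bwd c) + (g \o bwd c)) _) deriveD.
- by rewrite -[LHS]/('D_v (a *: (f \o bwd c)) _) deriveZ.
- rewrite -[LHS]/('D_v ((f \o bwd c) * (g \o bwd c)) _) deriveM//=.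
  by rewrite !fwdK.
Qed.

Lemma chart_deriveD c p v w (f : C) : atlas c -> dom c p ->
  chart_derive c p (v + w) f = chart_derive c p v f + chart_derive c p w f.
Proof.
move=> Ac cp; have df := chart_differentiable f Ac cp.
by rewrite /chart_derive !deriveE// linearD.
Qed.

Lemma chart_deriveZ c p a v (f : C) : atlas c -> dom c p ->
  chart_derive c p (a *: v) f = a * chart_derive c p v f.
Proof.
move=> Ac cp; have df := chart_differentiable f Ac cp.
by rewrite /chart_derive !deriveE// linearZ.
Qed.

(* By Hadamard's lemma [b^2 f = f(p) b^2 + sum_j y_j g_j] with a bump function [b]
   at [p] and [y_j = b (u_j - u_j(p))]; apply [D]. *)
Lemma local_coordinates c p : atlas c -> dom c p -> exists y : 'I_n -> C,
  (forall v j, chart_derive c p v (y j) = v 0 j) /\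
  (forall D, derivation_at p D -> (forall j, D (y j) = 0) -> forall f : C, D f = 0).
Proof.
move=> Ac cp; have [r r0 rB] := chart_ball cp.
have r20 : 0 < r / 2 by rewrite divr_gt0.
have r2r : r / 2 < r by rewrite ltr_pdivrMr// ltr_pMr// ltr1n.
set u := fwd c p in rB *.
have [rho [srho rho1 rho0]] := smooth_bump u r20.
have oB : open (ball u r) by exact: ball_open.
pose ext h (sh : smooth_on (ball u r) h) :=
  mkC (smooth_ball_extension Ac r20 r2r rB srho rho0 sh).
have scoord j : smooth_on (ball u r) (fun v : 'rV[R]_n => v 0 j - u 0 j).
  move=> k; apply: C_onD oB _ (C_on_cst _ _ _).
  by apply: (C_on_lin (l := rcoord j)); exact: coord_continuous.
pose y j := ext _ (scoord j).
exists y; split=> [v j|D dD Dy f].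
  rewrite /chart_derive.
  have E : forall v, ball u r v -> (y j \o bwd c) v = (rho * (fun v => v 0 j - u 0 j)) v.
    move=> w Bw; rewrite [LHS]/(ball_extension _ _ _ _) /ball_extension.
    rewrite mem_set; last by apply: bwd_dom; exact: (rB).
    by rewrite bwdK//; exact: (rB).
  have Bu : ball u r u by exact: ballxx.
  have oBn := open_nbhs_nbhs (conj oB Bu).
  have -> : 'D_v (y j \o bwd c) u = 'D_v (rho * (fun v => v 0 j - u 0 j)) u.
    by apply: near_eq_derive; apply: filterS oBn => w /E.
  have dc : derivable (fun v : 'rV[R]_n => v 0 j - u 0 j) u v.
    by have [d _] := scoord j 1%N; apply/diff_derivable/d.
  have dr : derivable (rho : _ -> R) u v.
    by have [d _] := srho 1%N; apply/diff_derivable/d.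
  rewrite deriveM// subrr scale0r addr0 rho1 scale1r.
  rewrite -[LHS]/('D_v ((rcoord j : 'rV[R]_n -> R) - cst (u 0 j)) u).
  have cr : continuous (rcoord j : 'rV[R]_n -> R) by exact: coord_continuous.
  have drc : differentiable (rcoord j : 'rV[R]_n -> R) u by exact: linear_differentiable.
  rewrite deriveB; [|exact: diff_derivable|exact: derivable_cst].
  by rewrite derive_cst subr0 deriveE// diff_lin.
have Cf : smooth_on (ball u r) (f \o bwd c).
  by move=> k; apply: C_on_sub rB (CinfP f Ac k).
have [g sg fE] := hadamard Cf.
pose b := ext _ (smooth_on_cst (ball u r) 1).
have E : b * b * f = f p *: (b * b) + \sum_j y j * ext _ (sg j).
  apply: Cinf_eq => x.
  transitivity (b x * b x * f x) => //.
  transitivity (f p * (b x * b x) + \sum_j (y j x * ext _ (sg j) x)); last first.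
    have -> : \sum_j y j x * ext _ (sg j) x = (\sum_j y j * ext _ (sg j)) x.
      by rewrite Cinf_sumE.
    by [].
  have bE : b x = ball_extension c rho (fun=> 1) x by [].
  have yE j : y j x = ball_extension c rho (fun v => v 0 j - u 0 j) x by [].
  have gE j : ext _ (sg j) x = ball_extension c rho (g j) x by [].
  rewrite bE; under eq_bigr do rewrite yE gE.
  rewrite /ball_extension; case: ifPn => [|_]; last first.
    by rewrite !mul0r mulr0 add0r big1// => j _; rewrite mul0r.
  rewrite inE => cx; rewrite mulr1.
  have [xr|rx] := leP `|u - fwd c x| (r / 2); last first.
    by rewrite rho0// !mul0r mulr0 add0r big1// => j _; rewrite !mul0r.
  have Bx : ball u r (fwd c x).
    by rewrite -ball_normE /=; exact: (le_lt_trans xr r2r).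
  have := fE _ Bx; rewrite /= !fwdK// => ->.
  rewrite mulrDr; congr (_ + _); first by rewrite mulrC.
  by rewrite mulr_sumr; apply: eq_bigr => j _; ring.
have [DD DZ DM] := dD.
have bp : b p = 1.
  by rewrite [b p]/(ball_extension _ _ _ _) /ball_extension mem_set// rho1 mulr1.
have yp j : y j p = 0.
  by rewrite [y j p]/(ball_extension _ _ _ _) /ball_extension mem_set// subrr mulr0.
have := congr1 D E; rewrite DD DZ DM (derivation_at_sum dD) big1 => [|j _]; last first.
  by rewrite DM Dy yp mul0r mulr0 addr0.
have bbp : (b * b) p = 1 by transitivity (b p * b p) => //; rewrite bp mulr1.
by rewrite addr0 bbp mul1r => /eqP; rewrite -subr_eq0 addrK => /eqP.
Qed.

End SmoothOnManifold.

(** * Left and right invariant vector fields *)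

Section LieGroupFields.
Variables (R : realType) (n : nat) (G : lieGroupType R n).
Local Notation C := (Cinf G).
Local Notation V := 'rV[R]_n.
Implicit Types (f : C) (b c d : chart R n G) (x a p : G) (v w : V).

Lemma bwd_mul_continuous b c (q : V * V) : cod b q.1 -> cod c q.2 ->
  {for q, continuous (fun q : V * V => (bwd b q.1 * bwd c q.2)%g)}.
Proof.
move=> bq cq.
apply: (@continuous_comp _ _ _ (fun q : V * V => (bwd b q.1, bwd c q.2))
  (fun r : G * G => (r.1 * r.2)%g)); last exact: lie_mul_continuous.
apply: cvg_pair.
  apply: (@continuous_comp _ _ _ fst (bwd b)); first exact: cvg_fst.
  exact: bwd_continuous.
apply: (@continuous_comp _ _ _ snd (bwd c)); first exact: cvg_snd.
exact: bwd_continuous.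
Qed.

Definition chart_rect b c : set (V * V) := [set q | cod b q.1 /\ cod c q.2].

Lemma open_chart_rect b c : open (chart_rect b c).
Proof.
rewrite openE => -[u v] [/= bu cv].
exists (cod b, cod c); last by move=> [u' v'] [].
by split; apply: open_nbhs_nbhs; split=> //; exact: open_cod.
Qed.

(** Near each pair of points the product stays in the domain of one chart [d], and the function
    factors through [fwd d]. *)
Lemma smooth_on_mul b c f : atlas b -> atlas c ->
  smooth_on (chart_rect b c) (fun q => f (bwd b q.1 * bwd c q.2)%g).
Proof.
move=> Ab Ac k; apply: C_on_local => -[u v] [/= bu cv].
have [d Ad dm] := atlas_cover (bwd b u * bwd c v)%g.
pose m (q : V * V) := (bwd b q.1 * bwd c q.2)%g.
have oU : open (chart_rect b c `&` m @^-1` dom d).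
  refine (@open_setI_preimage _ _ m (chart_rect b c) (dom d) (@open_chart_rect b c) _ _).
    by move=> q [bq cq]; exact: bwd_mul_continuous.
  exact: open_dom.
exists (chart_rect b c `&` m @^-1` dom d), ((f \o bwd d) \o (fun q => fwd d (m q))).
split=> //.
  by move=> q [_ dq] /=; rewrite fwdK.
apply: (C_on_comp_real (U' := cod d)) => //.
- exact: has_coords_rV.
- by move=> q [_ dq]; exact: fwd_cod.
- apply: C_on_sub (lie_mul_smooth b c d Ab Ac Ad k).
  by move=> q [[bq cq] dq].
- exact: (CinfP f Ad k).
Qed.

Lemma has_coordsVV : has_coords (V * V)%type.
Proof. exact: has_coords_pair (has_coords_rV R n) (has_coords_rV R n). Qed.

Lemma C_on_id (W : normedModType R) k (U : set W) : C_on k U (fun x : W => x).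
Proof. by apply: (C_on_lin (l := idfun)) => x; exact: cvg_id. Qed.

Lemma smooth_left_translation a f : smooth_fun (fun x => f (a * x)%g).
Proof.
apply: smooth_fun_local => p.
have [b Ab ba] := atlas_cover a; have [c Ac cp] := atlas_cover p.
exists c, (cod c); split=> //; first exact: open_cod.
split; first exact: fwd_cod.
move=> k; have oc := @open_cod _ _ _ c.
have Cp := C_on_pair oc (C_on_cst k _ (fwd b a)) (@C_on_id _ k _).
have sub y : cod c y -> chart_rect b c (fwd b a, y).
  by split=> //; exact: fwd_cod.
apply: C_on_eq oc _ (C_on_comp_real has_coordsVV oc sub Cp (smooth_on_mul f Ab Ac k)).
by move=> y cy; rewrite /= fwdK.
Qed.

Lemma smooth_right_translation a f : smooth_fun (fun x => f (x * a)%g).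
Proof.
apply: smooth_fun_local => p.
have [b Ab ba] := atlas_cover a; have [c Ac cp] := atlas_cover p.
exists c, (cod c); split=> //; first exact: open_cod.
split; first exact: fwd_cod.
move=> k; have oc := @open_cod _ _ _ c.
have Cp := C_on_pair oc (@C_on_id _ k _) (C_on_cst k _ (fwd b a)).
have sub y : cod c y -> chart_rect c b (y, fwd b a).
  by split=> //; exact: fwd_cod.
apply: C_on_eq oc _ (C_on_comp_real has_coordsVV oc sub Cp (smooth_on_mul f Ac Ab k)).
by move=> y cy; rewrite /= fwdK.
Qed.

Definition left_translate a f : C := mkC (smooth_left_translation a f).
Definition right_translate a f : C := mkC (smooth_right_translation a f).

Local Notation Lc := left_translate.
Local Notation Rc := right_translate.

Lemma left_translateM a p f : Lc a (Lc p f) = Lc (p * a)%g f.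
Proof. by apply: Cinf_eq => x /=; rewrite mulgA. Qed.

Lemma left_translate1 f : Lc 1%g f = f.
Proof. by apply: Cinf_eq => x /=; rewrite mul1g. Qed.

Section Frame.
Variables (c0 : chart R n G).
Hypotheses (Ac0 : atlas c0) (c01 : dom c0 1%g).
Local Notation T := (chart_derive c0 1%g).
Let u0 := fwd c0 1%g.

Lemma derive_right (F : V * V -> R) (p q v : V) :
  'D_(0, v) F (p, q) = 'D_v (fun y => F (p, y)) q.
Proof.
rewrite /derive; apply: (congr1 (fun F => lim (F @ 0^'))); apply/funext => h /=.
have -> : h *: ((0 : V), v) + (p, q) = (p, h *: v + q).
  by congr pair; rewrite /= scaler0 add0r.
by [].
Qed.

Lemma derive_left (F : V * V -> R) (p q v : V) :
  'D_(v, 0) F (p, q) = 'D_v (fun y => F (y, q)) p.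
Proof.
rewrite /derive; apply: (congr1 (fun F => lim (F @ 0^'))); apply/funext => h /=.
have -> : h *: (v, (0 : V)) + (p, q) = (h *: v + p, q).
  by congr pair; rewrite /= scaler0 add0r.
by [].
Qed.

(** In charts this is the partial derivative of [(x, y) |-> f (x * y)] in the second variable at
    [y = 1]. As an operator on [f] it will be the left invariant field with value [v] at the
    identity. *)
Lemma smooth_left_field v f : smooth_fun (fun x => T v (Lc x f)).
Proof.
apply: smooth_fun_local => p; have [b Ab bp] := atlas_cover p.
exists b, (cod b); split=> //; first exact: open_cod.
split; first exact: fwd_cod.
move=> k; have ob := @open_cod _ _ _ b.
have Cp := C_on_pair ob (@C_on_id _ k _) (C_on_cst k _ u0).
have sub y : cod b y -> chart_rect b c0 (y, u0).
  by split=> //; exact: fwd_cod.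
have [_ /(_ (0, v)) Df] := smooth_on_mul f Ab Ac0 k.+1.
apply: C_on_eq ob _ (C_on_comp_real has_coordsVV ob sub Cp Df).
by move=> w bw; rewrite /= derive_right.
Qed.

(** The same with the first variable, for the right invariant fields. They serve only to define [Ad]
    and to compute its derivative. *)
Lemma smooth_right_field v f : smooth_fun (fun x => T v (Rc x f)).
Proof.
apply: smooth_fun_local => p; have [b Ab bp] := atlas_cover p.
exists b, (cod b); split=> //; first exact: open_cod.
split; first exact: fwd_cod.
move=> k; have ob := @open_cod _ _ _ b.
have Cp := C_on_pair ob (C_on_cst k _ u0) (@C_on_id _ k _).
have sub y : cod b y -> chart_rect c0 b (u0, y).
  by split=> //; exact: fwd_cod.
have [_ /(_ (v, 0)) Df] := smooth_on_mul f Ac0 Ab k.+1.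
apply: C_on_eq ob _ (C_on_comp_real has_coordsVV ob sub Cp Df).
by move=> w bw; rewrite /= derive_left.
Qed.

Let dT v := chart_derivation_at v Ac0 c01.

Definition left_field_fun v f : C^o := mkC (smooth_left_field v f).
Lemma left_field_subproof v : left_field_fun v \in @derivation_pred R n G.
Proof.
have [TD TZ TM] := dT v.
apply/asboolP; split=> [f g|a f|f g]; apply: Cinf_eq => x.
- transitivity (T v (Lc x (f + g))) => //.
  by rewrite (_ : Lc x (f + g) = Lc x f + Lc x g) ?TD//; exact: Cinf_eq.
- transitivity (T v (Lc x (a *: f))) => //.
  by rewrite (_ : Lc x (a *: f) = a *: Lc x f) ?TZ//; exact: Cinf_eq.
- transitivity (f x * T v (Lc x g) + g x * T v (Lc x f)) => //.
  transitivity (T v (Lc x (f * g))) => //.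
  rewrite (_ : Lc x (f * g) = Lc x f * Lc x g); last exact: Cinf_eq.
  by rewrite TM /= mulg1.
Qed.
(* The key keeps conversion tests from unfolding down to derivatives. *)
Fact left_field_key : unit. Proof. exact: tt. Qed.
Definition left_field v : vfield G :=
  locked_with left_field_key (VField (left_field_subproof v)).
Local Notation E := left_field.

Definition right_field_fun v f : C^o := mkC (smooth_right_field v f).
Lemma right_field_subproof v : right_field_fun v \in @derivation_pred R n G.
Proof.
have [TD TZ TM] := dT v.
apply/asboolP; split=> [f g|a f|f g]; apply: Cinf_eq => x.
- transitivity (T v (Rc x (f + g))) => //.
  by rewrite (_ : Rc x (f + g) = Rc x f + Rc x g) ?TD//; exact: Cinf_eq.
- transitivity (T v (Rc x (a *: f))) => //.
  by rewrite (_ : Rc x (a *: f) = a *: Rc x f) ?TZ//; exact: Cinf_eq.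
- transitivity (f x * T v (Rc x g) + g x * T v (Rc x f)) => //.
  transitivity (T v (Rc x (f * g))) => //.
  rewrite (_ : Rc x (f * g) = Rc x f * Rc x g); last exact: Cinf_eq.
  by rewrite TM /= mul1g.
Qed.
Fact right_field_key : unit. Proof. exact: tt. Qed.
Definition right_field v : vfield G :=
  locked_with right_field_key (VField (right_field_subproof v)).
Local Notation Z := right_field.

Lemma left_fieldE v f x : E v f x = T v (Lc x f).
Proof. by rewrite /left_field; case: left_field_key. Qed.
Lemma right_fieldE v f x : Z v f x = T v (Rc x f).
Proof. by rewrite /right_field; case: right_field_key. Qed.

Lemma left_field_linear (r : R) v w f :
  E (r *: v + w) f = r *: (E v f : C) + E w f.
Proof.
apply: Cinf_eq => x; rewrite left_fieldE chart_deriveD// chart_deriveZ//.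
by rewrite -!left_fieldE.
Qed.

(** Both sides are mixed second derivatives of [(x, y) |-> f (x * y)] at [(1, 1)], one variable for
    each field, so [schwarz] applies. *)
Lemma left_right_commute v w f : E v (Z w f) 1%g = Z w (E v f) 1%g.
Proof.
pose F (q : V * V) := f (bwd c0 q.1 * bwd c0 q.2)%g.
rewrite left_fieldE right_fieldE /chart_derive.
have -> : Lc 1%g (Z w f) \o bwd c0 = (fun y => 'D_(w, 0) F (u0, y)).
  by apply/funext => y /=; rewrite mul1g derive_left right_fieldE.
have -> : Rc 1%g (E v f) \o bwd c0 = (fun y => 'D_(0, v) F (y, u0)).
  by apply/funext => y /=; rewrite mulg1 derive_right left_fieldE.
rewrite -(derive_right (fun q => 'D_(w, 0) F q)) -(derive_left (fun q => 'D_(0, v) F q)).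
apply: schwarz (@open_chart_rect c0 c0) _ (smooth_on_mul f Ac0 Ac0 2%N).
by split; exact: fwd_cod.
Qed.

End Frame.
End LieGroupFields.

(** * The left invariant frame, the Lie algebra and the adjoint representation *)

Section Frame.
Variables (R : realType) (n : nat) (G : lieGroupType R n).
Variables (c0 : chart R n G) (Ac0 : atlas c0) (c01 : dom c0 1%g).
Local Notation C := (Cinf G).
Local Notation VF := (vfield G).
Local Notation V := 'rV[R]_n.
Implicit Types (f : C) (x a p : G) (v w : V) (X Y : VF).
Local Notation T := (chart_derive c0 1%g).
Local Notation E := (left_field Ac0 c01).
Local Notation Z := (right_field Ac0 c01).
Local Notation Lc := left_translate.
Local Notation Rc := right_translate.

Lemma frame_coord_exists : exists y : 'I_n -> C,
  (forall v j, T v (y j) = v 0 j) /\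
  (forall D, derivation_at 1%g D -> (forall j, D (y j) = 0) ->
     forall f : C, D f = 0).
Proof. exact: local_coordinates. Qed.

Definition frame_coord : 'I_n -> C := projT1 (cid frame_coord_exists).

Lemma frame_coordE v j : T v (frame_coord j) = v 0 j.
Proof. by rewrite /frame_coord; case: cid => y [yE yD] /=. Qed.

Lemma derivation_at1_eq0 D : derivation_at 1%g D ->
  (forall j, D (frame_coord j) = 0) -> forall f, D f = 0.
Proof. by rewrite /frame_coord; case: cid => y [yE yD] /=; exact: yD. Qed.

Fact hat_key : unit. Proof. exact: tt. Qed.
(** The components of [X] at [p] in the left invariant frame, obtained by carrying the coordinate
    functions at the identity to [p] by left translation. *)
Definition hat_fun X p : V :=
  locked_with hat_key (\row_j X (Lc p^-1%g (frame_coord j)) p).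

Lemma hat_funE X p j : hat_fun X p 0 j = X (Lc p^-1%g (frame_coord j)) p.
Proof. by rewrite /hat_fun; case: hat_key; rewrite mxE. Qed.

(** Carried back to the identity, the difference of both sides is a derivation at 1 that kills the
    coordinate functions, hence is zero. *)
Lemma vfield_hat_fun X f p : X f p = E (hat_fun X p) f p.
Proof.
have [XD XZ XM] := vfield_derivation_at X p.
have [TD TZ TM] := chart_derivation_at (hat_fun X p) Ac0 c01.
pose D h := X (Lc p^-1%g h) p - T (hat_fun X p) h.
have dD : derivation_at 1%g D.
  split=> [h k|r h|h k]; rewrite /D.
  - rewrite (_ : Lc _ (h + k) = Lc p^-1%g h + Lc p^-1%g k); last exact: Cinf_eq.
    by rewrite XD TD opprD addrACA.
  - rewrite (_ : Lc _ (r *: h) = r *: Lc p^-1%g h); last exact: Cinf_eq.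
    by rewrite XZ TZ mulrBr.
  - rewrite (_ : Lc _ (h * k) = Lc p^-1%g h * Lc p^-1%g k); last exact: Cinf_eq.
    by rewrite XM TM /= mulVg !mulrBr opprD addrACA.
have D0 j : D (frame_coord j) = 0 by rewrite /D frame_coordE hat_funE subrr.
have := derivation_at1_eq0 dD D0 (Lc p f).
rewrite /D left_translateM mulgV left_translate1 => /eqP.
by rewrite left_fieldE subr_eq0 => /eqP.
Qed.

Lemma left_field_coord v p j : E v (Lc p^-1%g (frame_coord j)) p = v 0 j.
Proof. by rewrite left_fieldE left_translateM mulVg left_translate1 frame_coordE. Qed.

Lemma hat_left_field v p : hat_fun (E v) p = v.
Proof. by apply/rowP => j; rewrite hat_funE left_field_coord. Qed.

Lemma left_field_inj v w p : (forall f, E v f p = E w f p) -> v = w.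
Proof. by move=> vw; apply/rowP => j; rewrite -(left_field_coord v p) vw left_field_coord. Qed.

Lemma hatD X Y p : hat_fun (X + Y) p = hat_fun X p + hat_fun Y p.
Proof. by apply/rowP => j; rewrite mxE !hat_funE. Qed.

Lemma hatZ (h : C) X p : hat_fun (h *: X) p = h p *: hat_fun X p.
Proof. by apply/rowP => j; rewrite mxE !hat_funE. Qed.

Lemma hatN X p : hat_fun (- X) p = - hat_fun X p.
Proof. by apply/rowP => j; rewrite mxE !hat_funE. Qed.

Lemma hat0 p : hat_fun 0 p = 0.
Proof. by apply/rowP => j; rewrite mxE hat_funE. Qed.

Lemma hat_inj X Y : (forall p, hat_fun X p = hat_fun Y p) -> X = Y.
Proof.
move=> XY; apply/val_inj/funext => f; apply: Cinf_eq => p.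
by rewrite [LHS]vfield_hat_fun [RHS]vfield_hat_fun XY.
Qed.

Lemma left_field_sum v f : E v f = \sum_i v 0 i *: (E 'e_i f : C).
Proof.
have El : forall (r : R) v w, E (r *: v + w) f = r *: (E v f : C) + E w f.
  by move=> r v1 w; exact: left_field_linear.
have E0 : E 0 f = 0.
  have := El 1 0 0; rewrite !scale1r addr0 => /eqP.
  by rewrite -{1}[E 0 f]addr0 => /eqP/addrI/esym.
rewrite {1}(row_sum_delta v); elim/big_rec2 : _ => [//|i y1 y2 _ <-].
by rewrite El.
Qed.

Section EvalMorphism.
Variable p : G.
(** Evaluation as a ring morphism, so that determinants and adjugates over the smooth functions can
    be computed pointwise. *)
Definition ev (f : C) : R := f p.
Lemma ev_is_zmod_morphism : zmod_morphism ev. Proof. by []. Qed.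
Lemma ev_is_monoid_morphism : monoid_morphism ev. Proof. by []. Qed.
HB.instance Definition _ := GRing.isZmodMorphism.Build C R ev ev_is_zmod_morphism.
HB.instance Definition _ := GRing.isMonoidMorphism.Build C R ev ev_is_monoid_morphism.
End EvalMorphism.

Lemma smooth_fun_quotient (h : G -> R) :
  (forall p0, exists N d : C, d p0 != 0 /\ forall p, h p * d p = N p) ->
  smooth_fun h.
Proof.
move=> H; apply: smooth_fun_local => p0; have [N [d [d0 hE]]] := H p0.
have [b Ab bp] := atlas_cover p0.
have ob := @open_cod _ _ _ b.
have cd y : cod b y -> {for y, continuous (d \o bwd b)} := CinfP d Ab 0%N y.
have o0 : open [set r : R | r != 0].
  rewrite (_ : [set _ | _] = ~` [set 0]); first exact/closed_openC/closed_eq.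
  by apply/seteqP; split=> r /=; [move=> /eqP|move=> /eqP].
have oU := open_setI_preimage ob cd o0.
exists b, (cod b `&` (d \o bwd b) @^-1` [set r : R | r != 0]); split=> //.
split; first by split; [exact: fwd_cod|rewrite /= fwdK].
move=> k.
have CN := C_on_sub (@subIsetl _ _ _) (CinfP N Ab k).
have Cd := C_on_sub (@subIsetl _ _ _) (CinfP d Ab k).
have Cdi := C_onV oU (fun y => @proj2 _ _) (Cd _).
apply: C_on_eq oU _ (C_onM oU (CN _) Cdi) => y [_ /= dy].
rewrite -[LHS]/(N (bwd b y) / d (bwd b y)) -hE mulfK//.
Qed.

(** Smoothness is not immediate, as the test functions defining [hat_fun X p] vary with [p]. Fix
    those of [p0] instead, the functions [z k]: the components solve a linear system with smooth
    matrix [M = (E 'e_j (z k))] and right-hand side [X (z k)], and [M] is the identity at [p0].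
    Cramer's rule exhibits them as quotients. *)
Lemma smooth_hat X i : smooth_fun (fun p => hat_fun X p 0 i).
Proof.
apply: smooth_fun_quotient => p0.
pose z k := Lc p0^-1%g (frame_coord k).
pose M : 'M[C]_n := \matrix_(j, k) (E 'e_j (z k) : C).
pose Xz : 'rV[C]_n := \row_k (X (z k) : C).
exists ((Xz *m \adj M) 0 i), (\det M).
have evM p : map_mx (ev p) M = \matrix_(j, k) E 'e_j (z k) p.
  by apply/matrixP => j k; rewrite !mxE.
split=> [|p].
  rewrite -[_ p0]/(ev p0 (\det M)) -det_map_mx evM.
  rewrite (_ : \matrix_(j, k) _ = 1%:M) ?det1 ?oner_eq0//.
  by apply/matrixP => j k; rewrite !mxE left_field_coord mxE eqxx /= eq_sym.
have hM : hat_fun X p *m map_mx (ev p) M = map_mx (ev p) Xz.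
  apply/rowP => k; rewrite !mxE /ev vfield_hat_fun left_field_sum Cinf_sumE.
  by apply: eq_bigr => j _; rewrite !mxE.
have := congr1 (fun A => (A *m \adj (map_mx (ev p) M)) 0 i) hM.
rewrite -mulmxA mul_mx_adj mul_mx_scalar mxE mulrC det_map_mx => ->.
by rewrite -map_mx_adj -map_mxM mxE.
Qed.

Definition coef X i : C := mkC (smooth_hat X i).

Lemma coefE X i p : coef X i p = hat_fun X p 0 i. Proof. by []. Qed.

(* The derivative of [Y] along [X] for the flat connection that makes the left
   invariant fields parallel. *)
Definition dhat X Y p : V := \row_k X (coef Y k) p.

Lemma vfield_coef Y f : Y f = \sum_k coef Y k * (E 'e_k f : C).
Proof.
apply: Cinf_eq => p; rewrite Cinf_sumE vfield_hat_fun left_field_sum Cinf_sumE.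
by [].
Qed.

(** The Leibniz rule applied to [Y f], a combination of the [E 'e_k f] with coefficients the
    components of [Y]. *)
Lemma vfield_comp X Y f p : X (Y f) p =
  E (hat_fun X p) (E (hat_fun Y p) f) p + E (dhat X Y p) f p.
Proof.
have dX := vfield_derivation_at X p; have [XD XZ XM] := dX.
have Xs (F : 'I_n -> C) : X (\sum_i F i) p = \sum_i X (F i) p.
  exact: (derivation_at_sum dX).
rewrite (vfield_coef Y) Xs; under eq_bigr do rewrite XM.
rewrite big_split -(vfield_hat_fun X) (left_field_sum (hat_fun Y p)) Xs.
rewrite left_field_sum Cinf_sumE; congr (_ + _); apply: eq_bigr => k _.
  by rewrite XZ.
by rewrite mulrC -[RHS]/(_ * _) mxE.
Qed.

Fact lie_key : unit. Proof. exact: tt. Qed.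
Definition lie v w : V :=
  locked_with lie_key (hat_fun (bracket (E v) (E w)) 1%g).

Lemma lie_hat v w : lie v w = hat_fun (bracket (E v) (E w)) 1%g.
Proof. by rewrite /lie; case: lie_key. Qed.

(** The frame is left invariant, so push-forward by a translation leaves components unchanged. *)
Lemma left_relatedP a X Y :
  left_related a X Y <-> forall x, hat_fun Y (a * x)%g = hat_fun X x.
Proof.
split=> [XY x|XY f h hf x].
  apply/rowP => j; rewrite !hat_funE; apply/esym/XY => z /=.
  by rewrite invgM -mulgA mulKg.
rewrite [LHS]vfield_hat_fun [RHS]vfield_hat_fun XY !left_fieldE; congr (T _ _).
by apply: Cinf_eq => z; rewrite /= hf mulgA.
Qed.

Lemma left_field_related a v : left_related a (E v) (E v).
Proof. by apply/left_relatedP => x; rewrite !hat_left_field. Qed.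

Lemma bracket_related a X X' Y Y' : left_related a X X' -> left_related a Y Y' ->
  left_related a (bracket X Y) (bracket X' Y').
Proof.
move=> XX YY f h hf x.
rewrite -[LHS]/(X (Y h) x - Y (X h) x) -[RHS]/(X' (Y' f) _ - Y' (X' f) _).
by congr (_ - _); [apply: XX => z; exact: YY|apply: YY => z; exact: XX].
Qed.

Lemma bracket_left_field v w : bracket (E v) (E w) = E (lie v w).
Proof.
apply: hat_inj => p; rewrite hat_left_field lie_hat -[p in LHS]mulg1.
have /left_relatedP := bracket_related (@left_field_related p v) (@left_field_related p w).
exact.
Qed.

Lemma left_fieldD v w f p : E (v + w) f p = E v f p + E w f p.
Proof. by have := left_field_linear Ac0 c01 1 v w f; rewrite !scale1r => ->. Qed.

Lemma left_fieldN v f p : E (- v) f p = - E v f p.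
Proof.
apply/eqP; rewrite -addr_eq0 -left_fieldD addNr left_field_sum big1// => i _.
by rewrite mxE scale0r.
Qed.

(** The torsion formula of the flat connection [dhat]: in [X Y - Y X] the derivatives of components
    give the first two terms, and the constant coefficient part is the bracket of left invariant
    fields. *)
Lemma hat_bracket X Y p : hat_fun (bracket X Y) p =
  dhat X Y p - dhat Y X p + lie (hat_fun X p) (hat_fun Y p).
Proof.
apply: (@left_field_inj _ _ p) => f.
rewrite -(vfield_hat_fun (bracket X Y)).
rewrite -[LHS]/(X (Y f) p - Y (X f) p) (vfield_comp X) (vfield_comp Y).
rewrite 2!left_fieldD left_fieldN -bracket_left_field.
rewrite -[bracket _ _ f p]/(E _ (E _ f) p - E _ (E _ f) p).
by rewrite opprD addrACA [LHS]addrC.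
Qed.

Lemma lieE v w j : lie v w 0 j =
  E v (E w (Lc (1^-1)%g (frame_coord j))) 1%g -
  E w (E v (Lc (1^-1)%g (frame_coord j))) 1%g.
Proof. by rewrite lie_hat hat_funE. Qed.

Lemma lie_linearl (r : R) u v w : lie (r *: u + v) w = r *: lie u w + lie v w.
Proof.
apply/rowP => j. rewrite [RHS]mxE [(r *: lie u w) _ _]mxE !lieE.
set f := Lc _ _; have [ED EZ _] := vfield_derivation_at (E w) 1%g.
have -> : E w (E (r *: u + v) f) 1%g = r * E w (E u f) 1%g + E w (E v f) 1%g.
  by rewrite left_field_linear ED EZ.
have -> : E (r *: u + v) (E w f) 1%g = r * E u (E w f) 1%g + E v (E w f) 1%g.
  by rewrite left_field_linear.
by rewrite mulrBr opprD addrACA.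
Qed.

Lemma lie_anti v w : lie v w = - lie w v.
Proof. by apply/rowP => j; rewrite [RHS]mxE !lieE opprB. Qed.

Lemma lie_jacobi u v w :
  lie u (lie v w) = lie (lie u v) w + lie v (lie u w).
Proof.
apply: (@left_field_inj _ _ 1%g) => f; rewrite left_fieldD.
have bE (x y : V) (g : C) p : E (lie x y) g p = E x (E y g) p - E y (E x g) p.
  by rewrite -bracket_left_field.
have bEf (x y : V) (g : C) : E (lie x y) g = (E x (E y g) : C) - E y (E x g).
  by rewrite -bracket_left_field.
have EB (x : V) (g h : C) p : E x ((g : C) - h) p = E x g p - E x h p.
  have [ED EZ _] := vfield_derivation_at (E x) p.
  by rewrite -scaleN1r ED EZ mulN1r.
rewrite (bE u (lie v w)) (bE (lie u v) w) (bE v (lie u w)) (bE v w) (bE u v).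
rewrite (bE u w) (bEf v w) (bEf u v) (bEf u w).
rewrite (EB u (E v _)) (EB w (E u _)) (EB v (E u _)).
move: (E u _ 1%g) (E u _ 1%g) => a1 a2.
move: (E v _ 1%g) (E v _ 1%g) => a3 a4.
move: (E w _ 1%g) (E w _ 1%g) => a5 a6.
by ring.
Qed.

Section Ad.

(* [Ad p] acts on row vectors and is the adjoint action of [p^-1]. *)
Definition Ad p : 'M[R]_n := \matrix_i hat_fun (Z 'e_i) p.

Lemma right_field_sum v f p : Z v f p = \sum_i v 0 i * Z 'e_i f p.
Proof.
rewrite right_fieldE {1}(row_sum_delta v).
elim/big_rec2 : _ => [|i y1 y2 _ <-].
  by rewrite -(scale0r (0 : V)) chart_deriveZ// mul0r.
by rewrite chart_deriveD// chart_deriveZ// right_fieldE.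
Qed.

Lemma hat_right_field v p : hat_fun (Z v) p = v *m Ad p.
Proof.
apply/rowP => j; rewrite hat_funE mxE right_field_sum; apply: eq_bigr => i _.
by rewrite mxE hat_funE.
Qed.

(** Identifies [v *m Ad p] with the image of [v] under the differential at 1 of the conjugation
    [y |-> p^-1 y p]. *)
Lemma Ad_conj v p f (h : C) : (forall y, h y = f (p^-1 * y * p)%g) ->
  T v h = T (v *m Ad p) f.
Proof.
move=> hE; have := vfield_hat_fun (Z v) (Lc p^-1%g f) p.
rewrite hat_right_field left_fieldE left_translateM mulVg left_translate1 => <-.
rewrite right_fieldE; congr (T v _); apply: Cinf_eq => y /=.
by rewrite hE mulgA.
Qed.

Lemma Ad1 : Ad 1%g = 1%:M.
Proof.
apply/row_matrixP => i; rewrite rowK row1; apply/rowP => j; rewrite hat_funE.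
rewrite right_fieldE -(frame_coordE 'e_i j); congr (T _ _).
by apply: Cinf_eq => y; rewrite /= invg1 mul1g mulg1.
Qed.

(** Conjugations compose. Acting on row vectors by the inverse element reverses the order twice, so
    [Ad] is multiplicative as it stands. *)
Lemma AdM p q : Ad (p * q)%g = Ad p *m Ad q.
Proof.
apply/row_matrixP => i; rewrite !rowE mulmxA; apply/rowP => j.
pose y := frame_coord j.
pose h1 := Rc (p * q)%g (Lc (p * q)^-1%g y); pose h2 := Rc q (Lc q^-1%g y).
rewrite -!frame_coordE -/y.
rewrite -(@Ad_conj _ _ _ h1) => [|z]; last by rewrite /= mulgA.
rewrite -mulmxA mulmxA -(@Ad_conj _ _ _ h2) => [|z]; last by rewrite /= mulgA.
by rewrite -(@Ad_conj _ _ _ h1) => [|z] //=; rewrite invgM !mulgA.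
Qed.

Lemma continuous_Ad i j : continuous (fun p => Ad p i j).
Proof.
rewrite (_ : (fun p => _) = (fun p => hat_fun (Z 'e_i) p 0 j)).
  exact: smooth_fun_continuous (smooth_hat (Z 'e_i) j).
by apply/funext => p; rewrite mxE.
Qed.

Lemma dhat_left_field X v p : dhat X (E v) p = 0.
Proof.
apply/rowP => k; rewrite !mxE (_ : coef (E v) k = v 0 k *: (1 : C)); last first.
  apply: Cinf_eq => q; rewrite coefE hat_left_field.
  by rewrite -[RHS]/(v 0 k * 1) mulr1.
have [XD XZ XM] := vfield_derivation_at X p.
have := XM 1 1; rewrite mulr1 mul1r => /eqP.
rewrite -{1}[X 1 p]addr0 => /eqP/addrI X1.
by rewrite XZ -X1 mulr0.
Qed.

(** The differential of [Ad] at the identity is [- ad]. At 1 a left and a right invariant field have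
    zero bracket, and [E v] has constant components, so [hat_bracket] leaves just this relation. *)
Lemma dhat_right_field v w : dhat (E v) (Z w) 1%g = - lie v w.
Proof.
have : hat_fun (bracket (E v) (Z w)) 1%g = 0.
  apply/rowP => j; rewrite hat_funE mxE.
  rewrite -[LHS]/(E v (Z w _) _ - Z w (E v _) _).
  by rewrite left_right_commute subrr.
rewrite hat_bracket dhat_left_field subr0 hat_left_field hat_right_field Ad1 mulmx1.
by move=> /eqP; rewrite addr_eq0 => /eqP.
Qed.

End Ad.

End Frame.

(** * Fixed points of bounded matrix groups *)

Section SumOfSquares.
Variables (R : realType).

Definition sqn m (v : 'rV[R]_m) : R := \sum_k v 0 k ^+ 2.

Lemma sqn_ge0 m (v : 'rV[R]_m) : 0 <= sqn v.
Proof. by apply: sumr_ge0 => k _; exact: sqr_ge0. Qed.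

Lemma sqn_eq0 m (v : 'rV[R]_m) : sqn v = 0 -> v = 0.
Proof.
move=> /eqP; rewrite psumr_eq0 => [|k _]; last exact: sqr_ge0.
move=> /allP v0; apply/rowP => k; rewrite mxE; apply/eqP.
by rewrite -sqrf_eq0; apply: v0; rewrite mem_index_enum.
Qed.

(** The case of Cauchy-Schwarz against the constant vector 1, by expanding the sum of the squares
    [(m x_i - y)^2]. *)
Lemma sqr_sum_le m (x : 'I_m -> R) :
  (\sum_i x i) ^+ 2 <= m%:R * \sum_i x i ^+ 2.
Proof.
case: m x => [|m] x; first by rewrite !big_ord0 expr0n mulr0.
set y := \sum_i x i; set z := \sum_i x i ^+ 2.
have : 0 <= \sum_i (m.+1%:R * x i - y) ^+ 2.
  by apply: sumr_ge0 => i _; exact: sqr_ge0.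
rewrite (_ : \sum_i _ = m.+1%:R * (m.+1%:R * z - y ^+ 2)).
  by rewrite pmulr_rge0// subr_ge0.
rewrite (eq_bigr (fun i => m.+1%:R ^+ 2 * x i ^+ 2 +
   ((- 2 * m.+1%:R * y) * x i + y ^+ 2))) => [|i _]; last by ring.
rewrite big_split big_split /= -!mulr_sumr sumr_const card_ord -/y -/z.
by rewrite -mulr_natl; ring.
Qed.

Lemma sqn_mulmx_le m (A : 'M[R]_m) (K : R) (v : 'rV[R]_m) :
  (forall i j, `|A i j| <= K) -> sqn (v *m A) <= (m%:R * K) ^+ 2 * sqn v.
Proof.
move=> AK.
apply: (@le_trans _ _ (\sum_(j < m) m%:R * (K ^+ 2 * sqn v))); last first.
  by rewrite sumr_const card_ord -mulr_natl exprMn; lra.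
apply: ler_sum => j _; rewrite mxE; apply: le_trans (sqr_sum_le _) _.
rewrite ler_wpM2l// mulr_sumr; apply: ler_sum => i _.
rewrite exprMn mulrC ler_wpM2r ?sqr_ge0//.
by rewrite -real_normK ?num_real// lerXn2r// ?nnegrE// (le_trans _ (AK i j)).
Qed.

Lemma sqn_parallelogram m (v w : 'rV[R]_m) :
  sqn (2^-1 *: (v + w)) = 2^-1 * sqn v + 2^-1 * sqn w - 4^-1 * sqn (v - w).
Proof.
rewrite /sqn !mulr_sumr -big_split -sumrB; apply: eq_bigr => k _ /=.
by rewrite !mxE; field.
Qed.

Lemma continuous_real_poly m (f : 'rV[R]_m -> R) :
  C_on 0 setT f -> continuous f.
Proof. by move=> Cf v; exact: Cf. Qed.

Lemma continuous_sqn_mulmx m (A : 'M[R]_m) :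
  continuous (fun v : 'rV[R]_m => sqn (v *m A)).
Proof.
apply: continuous_real_poly.
have Ck k : C_on 0 setT (dotp (fun i => A i k)) by move=> v _; exact: dotp_continuous.
have := C_on_sum (index_enum 'I_m) openT (fun k => C_onM openT (Ck k) (Ck k)).
rewrite (_ : \sum_(k < m) _ = (fun v : 'rV[R]_m => sqn (v *m A)))//.
apply/funext => v; rewrite fct_sumE; apply: eq_bigr => k _.
rewrite mxE expr2 -[LHS]/(dotp _ v * dotp _ v) /dotp.
by congr (_ * _); apply: eq_bigr => i _; rewrite mulrC.
Qed.

(* [sup_x |v rho(x)|^2] is an invariant function of [v]; boundedness of the group
   makes it uniformly convex, so its minimizer on [S] is unique, hence fixed. *)
Lemma bounded_group_fixed_point m (T : groupType) (rho : T -> 'M[R]_m) (c : R)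
    (S : set 'rV[R]_m) : 0 < c ->
  (forall x y, rho (x * y)%g = rho y *m rho x) -> rho 1%g = 1%:M ->
  (forall x v, sqn (v *m rho x) <= c * sqn v) ->
  closed S -> S !=set0 ->
  (forall v w, S v -> S w -> S (2^-1 *: (v + w))) ->
  (forall x v, S v -> S (v *m rho x)) ->
  exists2 v, S v & forall x, v *m rho x = v.
Proof.
move=> c0 rhoM rho1 rhoc cS [s Ss] midS invS.
pose bnd v b := forall x, sqn (v *m rho x) <= b.
pose B := [set b | exists2 v, S v & bnd v b].
have infB : has_inf B.
  split; first by exists (c * sqn s), s => // x; exact: rhoc.
  by exists 0 => b [v _ /(_ 1%g)]; apply: le_trans; exact: sqn_ge0.
set I := inf B.
have Ib b v : S v -> bnd v b -> I <= b.
  by move=> Sv vb; apply: inf_lbound; [case: infB|exists v].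
(* By the parallelogram identity the midpoint of [v] and [w] has a strictly better bound than [b]
   when they are far apart. It cannot go below the infimum [I], so almost minimizing vectors are
   close together. *)
have key v w b : S v -> S w -> bnd v b -> bnd w b ->
    sqn (v - w) <= 4 * c * (b - I).
  move=> Sv Sw vb wb.
  have : bnd (2^-1 *: (v + w)) (b - (4 * c)^-1 * sqn (v - w)).
    move=> x; rewrite -scalemxAl mulmxDl sqn_parallelogram -mulmxBl.
    have : sqn (v - w) <= c * sqn ((v - w) *m rho x).
      have := rhoc x^-1%g ((v - w) *m rho x).
      by rewrite -mulmxA -rhoM mulVg rho1 mulmx1.
    rewrite -ler_pdivrMl// => h.
    have := vb x; have := wb x; rewrite invfM; lra.
  move=> /(Ib _ _ (midS _ _ Sv Sw)) h.
  by rewrite -ler_pdivrMl ?mulr_gt0//; lra.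
(* The sets of almost minimizing vectors form a filter containing the compact [K]; a cluster point
   is a minimizer. *)
pose A e := [set v | S v /\ bnd v (I + e)].
pose F := filter_from [set e : R | 0 < e] A.
have FF : ProperFilter F.
  apply: filter_from_proper; last first.
    move=> e e0; have [b [v Sv vb] bI] := inf_adherent e0 infB.
    by exists v; split=> // x; apply: le_trans (vb x) (ltW bI).
  apply: filter_from_filter; first by exists 1; exact: ltr01.
  move=> e e' e0 e'0; exists (Num.min e e'); first by rewrite /= lt_min e0.
  move=> v [Sv vb]; split; split=> // x; apply: le_trans (vb x) _.
    by rewrite lerD2l ge_min lexx.
  by rewrite lerD2l ge_min lexx orbT.
pose K := [set v : 'rV[R]_m | forall i, v 0 i ^+ 2 <= I + 1].
have cK : compact K.
  pose k := I + 1 + 1.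
  have kb (r : R) : r ^+ 2 <= I + 1 -> `|r| <= k.
    move=> r2; have := sqr_ge0 (`|r| - 1); rewrite sqrrB expr1n mulr1.
    rewrite -mulr_natl real_normK ?num_real// /k; nra.
  apply: (@subclosed_compact _ _ [set v : 'rV[R]_m | forall i, v ord0 i \in `[(- k), k]%R]).
  - rewrite (_ : K = \bigcap_(i in setT) [set v : 'rV[R]_m | v 0 i ^+ 2 <= I + 1]).
      apply: closed_bigI => i _.
      apply: (@closed_comp _ _ (fun u : 'rV[R]_m => u 0 i) [set r | r ^+ 2 <= I + 1]).
        by move=> u _; exact: coord_continuous.
      apply: (@closed_comp _ _ (fun r : R => r ^+ 2) [set r | r <= I + 1]).
        by move=> u _; exact: exprn_continuous.
      exact: closed_le.
    by apply/seteqP; split=> v /= vK i; [move=> _|]; exact: vK.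
  - apply: (@rV_compact _ _ (fun=> `[(- k), k]%classic)) => _.
    exact: segment_compact.
  - by move=> v vK i; rewrite in_itv /= -ler_norml; apply: kb; exact: vK.
have FK : F K.
  exists 1; first exact: ltr01.
  move=> v [_ /(_ 1%g)]; rewrite rho1 mulmx1 => vb i; apply: le_trans vb.
  by rewrite /sqn (bigD1 i)//= lerDl; apply: sumr_ge0 => j _; exact: sqr_ge0.
have [v [_ clv]] := cK F FF FK.
have cl (D : set 'rV[R]_m) e : 0 < e -> closed D -> A e `<=` D -> D v.
  move=> e0 cD AD; apply: cD => N Nv.
  have [u [Au Nu]] := clv (A e) N (ex_intro2 _ _ e e0 (@subset_refl _ _)) Nv.
  by exists u; split=> //; exact: AD.
have Sv : S v by apply: (cl S 1) => // u [].
have vI : bnd v I.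
  move=> x; apply/ler_addgt0Pr => e e0.
  apply: (cl [set u | sqn (u *m rho x) <= I + e] e) => //; last first.
    by move=> u [_]; exact.
  apply: (@closed_comp _ _ (fun u : 'rV[R]_m => sqn (u *m rho x)) [set r | r <= I + e]).
    by move=> u _; exact: continuous_sqn_mulmx.
  exact: closed_le.
exists v => // x; apply/eqP; rewrite -subr_eq0; apply/eqP/sqn_eq0/eqP.
rewrite eq_le sqn_ge0 andbT.
have := key (v *m rho x) v I (invS x _ Sv) Sv _ vI.
rewrite subrr mulr0; apply => y.
by rewrite -mulmxA -rhoM.
Qed.

End SumOfSquares.

(** * Invariant inner product of a bounded representation *)

Lemma linear_rV_continuous (R : realType) m (f : 'rV[R]_m -> R) :
  linear f -> continuous f.
Proof.
move=> fl; have f0 : f 0 = 0.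
  by have := fl (-1) 0 0; rewrite scaler0 addr0 scaleN1r addNr.
suff -> : f = dotp (fun j => f 'e_j) by exact: dotp_continuous.
apply/funext => v; rewrite {1}(row_sum_delta v) /dotp.
elim/big_rec2 : _ => // i y1 y2 _ <-.
by rewrite fl mulrC.
Qed.

Section InvariantForm.
Variables (R : realType) (n : nat) (G : groupType) (a : G -> 'M[R]_n).
Hypotheses (aM : forall x y, a (x * y)%g = a x *m a y) (a1 : a 1%g = 1%:M).
Variable K : R.
Hypothesis aK : forall x i j, `|a x i j| <= K.

Let conjugate x (Q : 'M[R]_n) : 'M[R]_n := a x *m Q *m (a x)^T.

Let conjugate_linear x : linear (conjugate x).
Proof.
move=> r P Q; rewrite /conjugate mulmxDr mulmxDl -scalemxAr -scalemxAl.
by [].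
Qed.

Let rho x : 'M[R]_(n * n) := lin_mx (mulmxr (a x)^T \o mulmx (a x)).

Let rhoE x q : q *m rho x = mxvec (conjugate x (vec_mx q)).
Proof. by rewrite -[q in LHS]vec_mxK mul_vec_lin. Qed.

Let rho_bound x i j : `|rho x i j| <= K * K.
Proof.
case: (mxvec_indexP i) => k l; case: (mxvec_indexP j) => s t.
have -> : rho x (mxvec_index k l) (mxvec_index s t) = a x s k * a x t l.
  have := rhoE x (delta_mx 0 (mxvec_index k l)).
  rewrite -rowE => /rowP /(_ (mxvec_index s t)); rewrite mxE => ->.
  rewrite mxvecE vec_mx_delta /conjugate mxE (bigD1 l)//= big1 ?addr0 => [|l' l'l].
    rewrite mxE (bigD1 k)//= big1 ?addr0 => [|k' k'k].
      by rewrite !mxE !eqxx mulr1.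
    by rewrite !mxE (negbTE k'k) mulr0.
  rewrite mxE big1 ?mul0r// => k' _.
  by rewrite !mxE (negbTE l'l) andbF mulr0.
by rewrite normrM ler_pM.
Qed.

(** The group acts on matrices, seen as row vectors of length [n * n], by the congruences
    [Q |-> a x *m Q *m (a x)^T], again with bounded entries. The fixed point lemma applies to
    symmetric forms bounded below by the standard one, a bound that keeps the fixed point positive
    definite. *)
Lemma invariant_inner_product : exists2 Q : 'M[R]_n,
  Q^T = Q /\ (forall v : 'rV[R]_n, v != 0 -> 0 < (v *m Q *m v^T) 0 0) &
  forall x, a x *m Q *m (a x)^T = Q.
Proof.
have sq (v : 'rV[R]_n) : (v *m v^T) 0 0 = sqn v.
  by rewrite mxE; apply: eq_bigr => k _; rewrite mxE expr2.
have conjM x y Q : conjugate x (conjugate y Q) = conjugate (x * y)%g Q.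
  by rewrite /conjugate aM trmx_mul !mulmxA.
have aT x (v : 'rV[R]_n) (M : 'M[R]_n) :
    (v *m conjugate x M *m v^T) 0 0 = (v *m a x *m M *m (v *m a x)^T) 0 0.
  by rewrite /conjugate trmx_mul !mulmxA.
have [F FE] : exists F : G -> 'rV[R]_n -> 'rV[R]_(n * n) -> R,
    forall x v q, F x v q = (v *m conjugate x (vec_mx q) *m v^T) 0 0.
  by exists (fun x v q => (v *m conjugate x (vec_mx q) *m v^T) 0 0).
have FD x v r q q' : F x v (r *: q + q') = r * F x v q + F x v q'.
  rewrite !FE linearP conjugate_linear mulmxDr mulmxDl -scalemxAr -scalemxAl.
  by rewrite !mxE.
(* The lower bound is imposed on all conjugates at once, which makes [S] invariant; it is a family
   of closed linear inequalities, so [S] is closed and convex. *)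
pose S := [set q : 'rV[R]_(n * n) | (vec_mx q)^T = vec_mx q :> 'M[R]_n /\
  forall x v, sqn v <= F x v q].
have [||||||||q Sq qrho] := @bounded_group_fixed_point R (n * n) G rho
  (((n * n)%:R * (K * K)) ^+ 2 + 1) S.
- by rewrite ltr_wpDl ?sqr_ge0.
- move=> x y; apply/row_matrixP => i; rewrite !rowE mulmxA !rhoE mxvecK.
  by rewrite conjM.
- apply/row_matrixP => i; rewrite !rowE rhoE /conjugate a1 trmx1 mul1mx mulmx1.
  by rewrite vec_mxK mulmx1.
- move=> x v; apply: le_trans (sqn_mulmx_le _ (rho_bound x)) _.
  by rewrite ler_wpM2r ?sqn_ge0// lerDl.
- have -> : S = (\bigcap_(ij in [set: 'I_n * 'I_n])
       (fun q => vec_mx q ij.2 ij.1 - vec_mx q ij.1 ij.2) @^-1` [set 0 : R]) `&`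
     (\bigcap_(xv in [set: G * 'rV[R]_n])
       F xv.1 xv.2 @^-1`
         [set r | sqn xv.2 <= r]).
    apply/seteqP; split=> q.
      move=> [qT qS]; split=> [[i j] _|[x v] _] /=; last exact: qS.
      by move/matrixP : qT => /(_ i j); rewrite mxE => ->; rewrite subrr.
    move=> [qT qS]; split=> [|x v]; last exact: (qS (x, v)).
    apply/matrixP => i j; rewrite mxE; apply/eqP; rewrite -subr_eq0; apply/eqP.
    exact: (qT (i, j)).
  apply: closedI; apply: closed_bigI.
    move=> [i j] _; apply: closed_comp; last exact: closed_eq.
    move=> q _; apply: linear_rV_continuous => r q1 q2 /=.
    by rewrite !linearP !mxE -[_ *: _]/(_ * _); ring.
  move=> [x v] _; apply: closed_comp; last exact: closed_ge.
  by move=> q _; apply: linear_rV_continuous => r q1 q2; exact: FD.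
(* This multiple of the standard form lies in [S]: [v] is the image of [v *m a x] under [a x^-1], so
   its square norm grows by at most [(n K)^2]. *)
- exists (mxvec (((n%:R * K) ^+ 2)%:M)); split.
    by rewrite mxvecK tr_scalar_mx.
  move=> x v; rewrite FE aT mxvecK mul_mx_scalar -scalemxAl mxE sq.
  have := sqn_mulmx_le (v *m a x) (aK x^-1%g).
  by rewrite -mulmxA -aM mulgV a1 mulmx1.
- move=> q q' [qT qS] [q'T q'S]; split.
    by rewrite !linearZ !linearD /= qT q'T.
  move=> x v.
  have -> : 2^-1 *: (q + q') = 2^-1 *: q + (2^-1 *: q' + 0).
    by rewrite addr0 scalerDr.
  have F0 : F x v 0 = 0.
    by rewrite FE linear0 /conjugate mulmx0 mul0mx mulmx0 mul0mx mxE.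
  by rewrite !FD F0; have := qS x v; have := q'S x v; lra.
- move=> x q [qT qS]; rewrite rhoE; split.
    by rewrite mxvecK /conjugate !trmx_mul trmxK qT mulmxA.
  by move=> y v; rewrite FE mxvecK conjM -FE; exact: qS.
have [qT qS] := Sq.
exists (vec_mx q); first split=> //.
  move=> v v0; have := qS 1%g v; rewrite FE /conjugate a1 trmx1 mul1mx mulmx1.
  apply: lt_le_trans; rewrite lt_neqAle sqn_ge0 andbT eq_sym.
  by apply: contra v0 => /eqP/sqn_eq0 ->.
by move=> x; rewrite -[RHS](congr1 vec_mx (qrho x)) rhoE mxvecK.
Qed.

End InvariantForm.

(** * Real factorization and interpolation of polynomials *)

Lemma real_poly_root_or_quadratic (R : rcfType) (p : {poly R}) : (1 < size p)%N ->
  (exists a, root p a) \/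
  exists a b, b != 0 /\ dvdp (('X - a%:P) ^+ 2 + (b ^+ 2)%:P) p.
Proof.
move=> sp.
pose f : {rmorphism R -> complex.complex R} := complex.real_complex R.
have sfp : size (map_poly f p) != 1 by rewrite size_map_poly gtn_eqF.
have /closed_rootP[z rz] := sfp.
pose a := complex.Re z; pose b := complex.Im z.
have [b0|b0] := eqVneq b 0.
  left; exists a; rewrite -(fmorph_root f).
  by move: rz; rewrite (_ : z = f a)//; move: b0; rewrite /a /b; case: (z) => x y /= ->.
right; exists a, b; split=> //.
set q := _ + _.
have sq : size q = 3%N.
  by rewrite size_polyDl size_exp_XsubC// size_polyC; case: (_ != 0).
have rq : (map_poly f q).[z] = 0.
  rewrite rmorphD rmorphXn rmorphB /= map_polyX !map_polyC !hornerE.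
  rewrite /a /b; case: (z) => x y /=.
  rewrite expr2; apply/eqP; rewrite complex.eq_complex /=.
  rewrite !subrr !mul0r !mulr0 !addr0 !sub0r !eqxx.
  by rewrite andbT subr0 expr2 addNr.
have : (map_poly f (modp p q)).[z] = 0.
  move: rz; rewrite rootE {1}(divp_eq p q) rmorphD rmorphM /= hornerD hornerM rq.
  by rewrite mulr0 add0r => /eqP.
(* The remainder is real, of degree at most one, and vanishes at the nonreal root [z]; its two
   coefficients are therefore zero. *)
have : (size (modp p q) <= 2)%N by rewrite -ltnS -sq ltn_modp -size_poly_eq0 sq.
rewrite /dvdp; move: (modp p q) => r sr.
have -> : r = r`_1 *: 'X + (r`_0)%:P.
  apply/polyP => i; rewrite coefD coefZ coefX coefC.
  case: i => [|[|i]] /=; rewrite ?mulr0 ?mulr1 ?add0r ?addr0//.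
  by apply: nth_default; apply: leq_trans sr _.
rewrite rmorphD /= map_polyZ map_polyX map_polyC !hornerE.
move: b0; rewrite /b; case: (z) => x y /= y0 /eqP; rewrite eq_complex /=.
rewrite !mul0r subr0 !addr0 => /andP[/eqP E1 /eqP E2].
move: E2 => /eqP; rewrite mulf_eq0 (negbTE y0) orbF => /eqP r1.
by move: E1; rewrite r1 mul0r add0r => ->; rewrite scale0r add0r polyC0.
Qed.

Lemma real_poly_factor (R : rcfType) (p : {poly R}) : p != 0 -> (1 < size p)%N ->
  exists2 r : {poly R}, r != 0 /\ (size r < size p)%N &
  (exists a, p = r * ('X - a%:P)) \/
  exists a b, b != 0 /\ p = r * (('X - a%:P) ^+ 2 + (b ^+ 2)%:P).
Proof.
move=> p0 sp.
have r0 (r q : {poly R}) : p = r * q -> r != 0.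
  by move=> pE; apply: contra_neq p0; rewrite pE => ->; rewrite mul0r.
have [[a /factor_theorem[r pE]]|[a [b [b0 /dvdpP[r pE]]]]] :=
    real_poly_root_or_quadratic sp.
  exists r; last by left; exists a.
  split; first exact: r0 pE.
  by rewrite pE size_Mmonic ?monicXsubC ?(r0 _ _ pE)// size_XsubC addn2.
exists r; last by right; exists a, b.
split; first exact: r0 pE.
have sq : size (('X - a%:P) ^+ 2 + (b ^+ 2)%:P) = 3%N.
  by rewrite size_polyDl size_exp_XsubC// size_polyC; case: (_ != 0).
rewrite pE size_mul ?(r0 _ _ pE) ?sq ?addn3//.
by rewrite -size_poly_eq0 sq.
Qed.

Lemma interpolation (R : fieldType) (s : seq R) (f : R -> R) :
  exists q : {poly R}, forall x, x \in s -> q.[x] = f x.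
Proof.
elim: s => [|x s [q qs]]; first by exists 0.
have [xs|xs] := boolP (x \in s).
  by exists q => y; rewrite inE => /predU1P[->|]; exact: qs.
pose w := \prod_(y <- s) ('X - y%:P).
have wx : w.[x] != 0 by rewrite -rootE root_prod_XsubC.
exists (q + ((f x - q.[x]) / w.[x]) *: w) => y; rewrite inE => /predU1P[->|ys].
  by rewrite hornerD hornerZ divfK// addrC subrK.
rewrite hornerD hornerZ qs// (_ : w.[y] = 0) ?mulr0 ?addr0//.
by apply/eqP; rewrite -rootE root_prod_XsubC.
Qed.

(** * Inner products and the spectral theorem for symmetric matrices *)

Record inner_product (R : realType) n (B : 'rV[R]_n -> 'rV[R]_n -> R) : Prop := {
  innerC : forall u v, B u v = B v u;
  innerl : forall r u v w, B (r *: u + v) w = r * B u w + B v w;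
  inner_gt0 : forall v, v != 0 -> 0 < B v v }.

Section InnerTheory.
Variables (R : realType) (n : nat) (B : 'rV[R]_n -> 'rV[R]_n -> R).
Hypothesis iB : inner_product B.

Lemma innerDl u v w : B (u + v) w = B u w + B v w.
Proof. by have := innerl iB 1 u v w; rewrite scale1r mul1r. Qed.
Lemma inner0l w : B 0 w = 0.
Proof. by apply: (@addrI _ (B 0 w)); rewrite addr0 -innerDl addr0. Qed.
Lemma innerZl r u w : B (r *: u) w = r * B u w.
Proof. by have := innerl iB r u 0 w; rewrite !addr0 inner0l addr0. Qed.
Lemma innerNl u w : B (- u) w = - B u w.
Proof. by rewrite -scaleN1r innerZl mulN1r. Qed.
Lemma innerDr u v w : B w (u + v) = B w u + B w v.
Proof. by rewrite !(innerC iB w) innerDl. Qed.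
Lemma inner0r w : B w 0 = 0.
Proof. by rewrite (innerC iB) inner0l. Qed.
Lemma innerZr r u w : B w (r *: u) = r * B w u.
Proof. by rewrite !(innerC iB w) innerZl. Qed.
Lemma innerNr u w : B w (- u) = - B w u.
Proof. by rewrite !(innerC iB w) innerNl. Qed.
Lemma inner_eq0 v : B v v = 0 -> v = 0.
Proof. by apply: contra_eq => /(inner_gt0 iB)/lt0r_neq0. Qed.
Lemma inner_ge0 v : 0 <= B v v.
Proof. by have [->|/(inner_gt0 iB)/ltW//] := eqVneq v 0; rewrite inner0l. Qed.
End InnerTheory.

Section Spectral.
Variables (R : realType) (n : nat) (B : 'rV[R]_n.+1 -> 'rV[R]_n.+1 -> R).
Hypothesis iB : inner_product B.
Variable H : 'M[R]_n.+1.
Hypothesis symH : forall u v, B (u *m H) v = B u (v *m H).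
Local Notation V := 'rV[R]_n.+1.
Implicit Types (u v w : V) (a b mu : R).

(** Sums of eigenvectors with eigenvalues in [s]. The inductive form lets statements about all
    vectors be proved by induction on such a sum. *)
Inductive eigenspan (s : seq R) : V -> Prop :=
| Eigenspan0 : eigenspan s 0
| EigenspanD u v : eigenspan s u -> eigenspan s v -> eigenspan s (u + v)
| Eigenspan1 mu v : mu \in s -> v *m H = mu *: v -> eigenspan s v.

(** For symmetric [H] the kernel of [(H - a)^2] is that of [H - a]: with [w = v (H - a)],
    [B w w = B v (w (H - a)) = 0]. *)
Lemma symmetric_double_ker a v :
  (v *m H - a *: v) *m H = a *: (v *m H - a *: v) -> v *m H = a *: v.
Proof.
set w := v *m H - a *: v => wH; apply/eqP; rewrite -subr_eq0 -/w; apply/eqP.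
apply: (inner_eq0 iB); rewrite {1}/w innerDl// innerNl// innerZl// symH wH.
by rewrite innerZr// subrr.
Qed.

(** With [M = H - a], pairing with [v] gives [B (v M) (v M) + b^2 B v v = 0], a sum of nonnegative
    terms. *)
Lemma symmetric_quadratic_ker a b v : b != 0 ->
  v *m horner_mx H (('X - a%:P) ^+ 2 + (b ^+ 2)%:P) = 0 -> v = 0.
Proof.
move=> b0; pose M := H - a%:M.
have -> : horner_mx H (('X - a%:P) ^+ 2 + (b ^+ 2)%:P) = M *m M + (b ^+ 2)%:M.
  by rewrite rmorphD rmorphXn rmorphB /= horner_mx_X !horner_mx_C expr2.
have symM u w : B (u *m M) w = B u (w *m M).
  rewrite !mulmxBr !mul_mx_scalar innerDl// innerDr// innerNl// innerNr// innerZl//.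
  by rewrite innerZr// symH.
move=> vq; have : B (v *m (M *m M + (b ^+ 2)%:M)) v = 0 by rewrite vq inner0l.
rewrite mulmxDr mul_mx_scalar innerDl// mulmxA symM innerZl// => E.
apply: (inner_eq0 iB); apply/eqP.
have h1 := inner_ge0 iB (v *m M); have h2 := inner_ge0 iB v.
have : b ^+ 2 * B v v = 0.
  apply/eqP; rewrite eq_le mulr_ge0 ?sqr_ge0// andbT -E; lra.
by move/eqP; rewrite mulf_eq0 sqrf_eq0 (negbTE b0).
Qed.

(** Induction on the degree, splitting off a real factor. An irreducible quadratic factor acts
    injectively and is dropped; a linear factor contributes its root to the list of eigenvalues. *)
Lemma annihilated_eigenspan (p : {poly R}) : p != 0 ->
  exists s, forall v, v *m horner_mx H p = 0 -> eigenspan s v.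
Proof.
have [k] := ubnP (size p); elim: k p => // k IH p; rewrite ltnS => pk p0.
have [sp|sp] := leqP (size p) 1.
  exists [::] => v; have := size1_polyC sp => pE; rewrite pE horner_mx_C.
  rewrite mul_mx_scalar => /eqP; rewrite scaler_eq0 => /orP[/eqP c0|/eqP ->].
    by move: p0; rewrite pE c0 polyC0 eqxx.
  exact: Eigenspan0.
have [r [r0 rp] rE] := real_poly_factor p0 sp.
have [s sE] := IH r (leq_trans rp pk) r0.
case: rE => [[a pE]|[a [b [b0 pE]]]].
  exists (a :: s) => v; rewrite pE mulrC rmorphM /= mulmxA => /sE.
  rewrite rmorphB /= horner_mx_X horner_mx_C mulmxBr mul_mx_scalar => ews.
  (* [H - a] is invertible on eigenvectors for other eigenvalues; these are lifted to [u], and [wa]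
     collects those for [a]. Then [v - u] is killed by [(H - a)^2], hence by [H - a]. *)
  have [u [wa [us waH wE]]] : exists u (wa : V), [/\ eigenspan (a :: s) u,
      wa *m H = a *: wa & v *m H - a *: v = (u *m H - a *: u) + wa].
    elim: ews => [|w1 w2 _ [u1 [a1 [u1s a1H ->]]] _ [u2 [a2 [u2s a2H ->]]]|mu w mus wH].
    - exists 0, 0; split; rewrite ?mul0mx ?scaler0 ?subrr ?addr0//.
      exact: Eigenspan0.
    - exists (u1 + u2), (a1 + a2); split; first exact: EigenspanD.
        by rewrite mulmxDl a1H a2H scalerDr.
      by rewrite mulmxDl scalerDr opprD addrACA [X in _ = X + _]addrACA.
    - have [E|mua] := eqVneq mu a.
        rewrite E in wH.
        exists 0, w; split; rewrite ?mul0mx ?scaler0 ?subrr ?add0r//.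
        exact: Eigenspan0.
      exists ((mu - a)^-1 *: w), 0; split.
      + apply: (@Eigenspan1 _ mu); first by rewrite inE mus orbT.
        by rewrite -scalemxAl wH !scalerA mulrC.
      + by rewrite mul0mx scaler0.
      + rewrite addr0 -scalemxAl wH !scalerA [a * _]mulrC -scalerBl -mulrBr.
        by rewrite mulVf ?subr_eq0// scale1r.
  have vuH : (v - u) *m H = a *: (v - u).
    apply: symmetric_double_ker; rewrite [_ - a *: _](_ : _ = wa)//.
    rewrite mulmxBl scalerBr opprD opprK addrACA wE -[X in _ + wa + X = _]opprK.
    by rewrite [- (- _ + _)]opprD opprK addrAC subrr add0r.
  rewrite -(subrK u v); apply: EigenspanD us.
  by apply: Eigenspan1 vuH; rewrite inE eqxx.
exists s => v; rewrite pE rmorphM /= mulmxA.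
by move=> /(symmetric_quadratic_ker b0)/sE.
Qed.

Lemma symmetric_eigenspan : exists s, forall v, eigenspan s v.
Proof.
have [s sE] := annihilated_eigenspan (monic_neq0 (char_poly_monic H)).
by exists s => v; apply: sE; rewrite Cayley_Hamilton mulmx0.
Qed.

(** Eigenvectors for distinct eigenvalues are orthogonal, so an eigenvector for a value outside [s]
    would be orthogonal to everything, itself included. *)
Lemma eigenvalue_in_span s mu v : (forall v, eigenspan s v) ->
  v != 0 -> v *m H = mu *: v -> mu \in s.
Proof.
move=> sE v0 vH; apply: contraNT v0 => nmu; apply/eqP/(inner_eq0 iB).
suff H0 w : eigenspan s w -> B v w = 0 by exact: H0.
elim=> [|u1 u2 _ IH1 _ IH2|nu u nus uH]; first exact: inner0r.
  by rewrite innerDr// IH1 IH2 addr0.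
have := symH v u; rewrite vH uH innerZl// innerZr// => /eqP.
rewrite -subr_eq0 -mulrBl mulf_eq0 subr_eq0 => /orP[/eqP E|/eqP//].
by move: nmu; rewrite E nus.
Qed.

End Spectral.

(** * Polar decomposition of a skew matrix *)

Section SkewPolar.
Variables (R : realType) (n : nat) (B : 'rV[R]_n.+1 -> 'rV[R]_n.+1 -> R).
Hypothesis iB : inner_product B.
Variable A : 'M[R]_n.+1.
Hypothesis skewA : forall u v, B (u *m A) v = - B u (v *m A).
Local Notation V := 'rV[R]_n.+1.
Local Notation H := (A *m A).
Implicit Types (u v w : V) (mu lam : R).

Let symH u v : B (u *m H) v = B u (v *m H).
Proof. by rewrite !mulmxA !skewA opprK. Qed.

Lemma eigen_horner_mx (M : 'M[R]_n.+1) mu v (q : {poly R}) :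
  v *m M = mu *: v -> v *m horner_mx M q = q.[mu] *: v.
Proof.
move=> vM; elim/poly_ind: q => [|q c IH].
  by rewrite rmorph0 mulmx0 horner0 scale0r.
rewrite rmorphD rmorphM /= horner_mx_X horner_mx_C mulmxDr mulmxA IH.
by rewrite -scalemxAl vM mul_mx_scalar scalerA -scalerDl !hornerE.
Qed.

Lemma skew_eigen_le0 mu v : v != 0 -> v *m H = mu *: v -> mu <= 0.
Proof.
move=> v0 vH; have := inner_ge0 iB (v *m A).
rewrite skewA -mulmxA vH innerZr// oppr_ge0.
by rewrite pmulr_lle0//; exact: inner_gt0.
Qed.

Lemma skew_sqr_ker v : v *m H = 0 -> v *m A = 0.
Proof.
by move=> vH; apply: (inner_eq0 iB); rewrite skewA -mulmxA vH inner0r// oppr0.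
Qed.

(* [J] is [A (- A^2)^(-1/2)] on the orthogonal complement of [ker A] and vanishes
   on [ker A]. *)
Definition polar_part (J : 'M[R]_n.+1) : Prop :=
  [/\ forall u v, B (u *m J) v = - B u (v *m J),
      forall lam v, 0 < lam -> v *m H = - lam ^+ 2 *: v -> v *m J = lam^-1 *: (v *m A),
      forall v, v *m A = 0 -> v *m J = 0
    & forall P : V -> Prop, P 0 -> (forall u v, P u -> P v -> P (u + v)) ->
        (forall v, v *m A = 0 -> P v) ->
        (forall lam v, 0 < lam -> v *m H = - lam ^+ 2 *: v -> P v) ->
        forall v, P v].

(** [A^2] is symmetric with nonpositive eigenvalues. [J] is [A] times a polynomial in [A^2]
    interpolating the inverse square root of [- mu] on the spectrum, so it commutes with what it
    should and is skew. *)
Lemma polar_part_exists : exists J, polar_part J.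
Proof.
have [s sE] := symmetric_eigenspan iB symH.
(* Only negative [mu] matter: on the kernel of [A^2], which is that of [A], the factor [A] gives
   zero whatever [q] is. *)
have [q qE] := interpolation s (fun mu => (Num.sqrt (- mu))^-1).
have commA : comm_mx A (horner_mx H q).
  by apply: comm_mx_horner; rewrite /comm_mx mulmxA.
have symq u v : B (u *m horner_mx H q) v = B u (v *m horner_mx H q).
  elim/poly_ind: (q) u v => [|p c IH] u v.
    by rewrite rmorph0 !mulmx0 inner0l// inner0r.
  rewrite rmorphD rmorphM /= horner_mx_X horner_mx_C !mulmxDr innerDl// innerDr//.
  rewrite !mul_mx_scalar innerZl// innerZr//; congr (_ + _).
  have commH : comm_mx H (horner_mx H p) by apply: comm_mx_horner.
  rewrite [u *m _]mulmxA symH IH; congr (B u _).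
  by rewrite -[v *m H *m _]mulmxA commH.
exists (A *m horner_mx H q); split.
- move=> u v; rewrite mulmxA symq skewA; congr (- B u _).
  by rewrite -!mulmxA commA.
- move=> lam v lam0 vH; have [->|v0] := eqVneq v 0.
    by rewrite !mul0mx scaler0.
  have ms := eigenvalue_in_span iB symH sE v0 vH.
  have vAH : (v *m A) *m H = - lam ^+ 2 *: (v *m A).
    by rewrite mulmxA -[v *m A *m A]mulmxA vH -scalemxAl.
  by rewrite mulmxA (eigen_horner_mx _ vAH) qE// opprK sqrtr_sqr gtr0_norm.
- by move=> v vA; rewrite mulmxA vA mul0mx.
- move=> P P0 PD Pker Plam v.
  elim: (sE v) => {v} [//|u w _ Pu _ Pw|mu v _ vH]; first exact: PD.
  have [->//|v0] := eqVneq v 0.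
  have := skew_eigen_le0 v0 vH; rewrite le_eqVlt => /predU1P[mu0|mu0].
    by apply: Pker; apply: skew_sqr_ker; rewrite vH mu0 scale0r.
  apply: (Plam (Num.sqrt (- mu))); first by rewrite sqrtr_gt0 oppr_gt0.
  by rewrite sqr_sqrtr ?opprK// oppr_ge0 ltW.
Qed.

Section PolarTheory.
Variable J : 'M[R]_n.+1.
Hypothesis JP : polar_part J.

Lemma polar_eigenA lam v : v *m H = - lam ^+ 2 *: v ->
  (v *m A) *m H = - lam ^+ 2 *: (v *m A).
Proof. by move=> vH; rewrite mulmxA -[v *m A *m A]mulmxA vH -scalemxAl. Qed.

Lemma polar_eigenJA lam v : 0 < lam -> v *m H = - lam ^+ 2 *: v ->
  v *m J *m A = - lam *: v.
Proof.
have [_ Jlam _ _] := JP; move=> l0 vH; rewrite (Jlam _ _ l0 vH) -scalemxAl -mulmxA vH.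
have ln0 := lt0r_neq0 l0.
have E : lam^-1 * - lam ^+ 2 = - lam by field.
by rewrite scalerA E.
Qed.

Lemma polar_eigenJJ lam v : 0 < lam -> v *m H = - lam ^+ 2 *: v -> v *m J *m J = - v.
Proof.
have [_ Jlam _ _] := JP; move=> l0 vH; rewrite {1}(Jlam _ _ l0 vH) -scalemxAl.
rewrite (Jlam _ _ l0 (polar_eigenA vH)) -mulmxA vH scalerA scalerA -[- v]scaleN1r.
have ln0 := lt0r_neq0 l0.
have E : lam^-1 * lam^-1 * - lam ^+ 2 = -1 by field.
by rewrite E.
Qed.

(** [J^2] is [-1] on the eigenvectors outside the kernel, and [J] is 0 on the kernel. *)
Lemma polar_cube : J *m J *m J = - J.
Proof.
have [_ _ Jker Jgen] := JP; apply/row_matrixP => i; rewrite !rowE !mulmxA.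
move: 'e_i; apply: Jgen => [|u v uE vE|v vA|lam v l0 vH].
- by rewrite !mul0mx.
- by rewrite !mulmxDl uE vE.
- by rewrite mulmxN (Jker _ vA) !mul0mx oppr0.
- by rewrite (polar_eigenJJ l0 vH) mulNmx mulmxN.
Qed.

Lemma polar_ker v : v *m J = 0 -> v *m A = 0.
Proof.
have [_ _ Jker Jgen] := JP.
have E : A = - (J *m J *m A).
  apply/row_matrixP => i; rewrite !rowE.
  move: 'e_i; apply: Jgen => [|u w uE wE|w wA|lam w l0 wH].
  - by rewrite !mul0mx.
  - by rewrite !mulmxDl uE wE.
  - by rewrite wA mulmxN !mulmxA (Jker _ wA) !mul0mx oppr0.
  - by rewrite mulmxN !mulmxA (polar_eigenJJ l0 wH) mulNmx opprK.
by move=> vJ; rewrite E mulmxN !mulmxA vJ !mul0mx oppr0.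
Qed.

End PolarTheory.
End SkewPolar.

(** * Metric Lie algebras and their skew derivations *)

Record metric_lie (R : realType) n (L : 'rV[R]_n -> 'rV[R]_n -> 'rV[R]_n)
    (B : 'rV[R]_n -> 'rV[R]_n -> R) : Prop := {
  lie_inner : inner_product B;
  lie_bilinear : forall r u v w, L (r *: u + v) w = r *: L u w + L v w;
  lie_skew : forall u v, L u v = - L v u;
  lie_leibniz : forall u v w, L u (L v w) = L (L u v) w + L v (L u w);
  lie_invariant : forall u v w, B (L u v) w = - B v (L u w) }.

(* The algebraic form of a normal almost contact metric structure on a Lie
   algebra, with [phi] acting on row vectors from the right. *)
Definition normal_structure (R : realType) n (L : 'rV[R]_n -> 'rV[R]_n -> 'rV[R]_n)
    (B : 'rV[R]_n -> 'rV[R]_n -> R) (xi : 'rV[R]_n) (phi : 'M[R]_n) : Prop :=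
  [/\ B xi xi = 1, xi *m phi = 0,
      forall u, u *m phi *m phi = - u + B xi u *: xi,
      forall u v, B (u *m phi) (v *m phi) = B u v - B xi u * B xi v
    & forall u v, L (u *m phi) (v *m phi) - L u v =
        (L (u *m phi) v + L u (v *m phi)) *m phi].

Section LieTheory.
Variables (R : realType) (n : nat) (L : 'rV[R]_n -> 'rV[R]_n -> 'rV[R]_n).
Variable B : 'rV[R]_n -> 'rV[R]_n -> R.
Hypothesis ml : metric_lie L B.

Lemma lieDl u v w : L (u + v) w = L u w + L v w.
Proof. by have := lie_bilinear ml 1 u v w; rewrite !scale1r. Qed.
Lemma lie0l w : L 0 w = 0.
Proof. by apply: (@addrI _ (L 0 w)); rewrite addr0 -lieDl addr0. Qed.
Lemma lieZl r u w : L (r *: u) w = r *: L u w.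
Proof. by have := lie_bilinear ml r u 0 w; rewrite !addr0 lie0l addr0. Qed.
Lemma lieNl u w : L (- u) w = - L u w.
Proof. by rewrite -scaleN1r lieZl scaleN1r. Qed.
Lemma lieDr u v w : L w (u + v) = L w u + L w v.
Proof. by rewrite !(lie_skew ml w) lieDl opprD. Qed.
Lemma lieZr r u w : L w (r *: u) = r *: L w u.
Proof. by rewrite !(lie_skew ml w) lieZl scalerN. Qed.
Lemma lie0r w : L w 0 = 0.
Proof. by rewrite (lie_skew ml) lie0l oppr0. Qed.
End LieTheory.

Lemma linear_rV_matrix (R : pzRingType) m n (f : 'rV[R]_m -> 'rV[R]_n) :
  linear f -> exists M : 'M[R]_(m, n), forall u, u *m M = f u.
Proof.
move=> fl; have f0 : f 0 = 0.
  by have := fl (-1) 0 0; rewrite scaler0 addr0 scaleN1r addNr.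
exists (\matrix_i f 'e_i) => u; rewrite mulmx_sum_row [in RHS](row_sum_delta u).
elim/big_rec2 : _ => // i y1 y2 _ ->.
by rewrite fl rowK.
Qed.

Definition skew_derivation (R : realType) n (L : 'rV[R]_n -> 'rV[R]_n -> 'rV[R]_n)
    (B : 'rV[R]_n -> 'rV[R]_n -> R) (A : 'M[R]_n) : Prop :=
  (forall u v, B (u *m A) v = - B u (v *m A)) /\
  (forall u v, L u v *m A = L (u *m A) v + L u (v *m A)).

(** A nonzero [ad x] is skew by invariance and a derivation by Jacobi. If the bracket vanishes,
    every matrix is a derivation, and an infinitesimal rotation in the plane of the first two basis
    vectors does. *)
Lemma skew_derivation_exists (R : realType) n
    (L : 'rV[R]_n.+2 -> 'rV[R]_n.+2 -> 'rV[R]_n.+2) B : metric_lie L B ->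
  exists2 A, skew_derivation L B A & A != 0.
Proof.
move=> ml; have iB := lie_inner ml.
have [[x [y Lxy]]|nL] := pselect (exists x y, L x y != 0).
  have [A AE] : exists A, forall u, u *m A = L x u.
    by apply: linear_rV_matrix => r u v; rewrite (lieDr ml) (lieZr ml).
  exists A; first split=> u v; rewrite ?AE.
  - exact: lie_invariant ml _ _ _.
  - exact: lie_leibniz ml _ _ _.
  - by apply: contraNneq Lxy => A0; rewrite -AE A0 mulmx0.
have L0 u v : L u v = 0.
  by apply/eqP; apply: contrapT => /negP Luv; apply: nL; exists u, v.
pose u : 'rV[R]_n.+2 := 'e_0; pose v : 'rV[R]_n.+2 := 'e_1.
have [A AE] : exists A, forall x, x *m A = B x u *: v - B x v *: u.
  apply: linear_rV_matrix => r x y; rewrite !(innerl iB) !scalerDl scalerBr !scalerA.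
  by rewrite opprD addrACA.
exists A; first split=> x y.
- rewrite !AE (innerDl iB) (innerDr iB) (innerNl iB) (innerNr iB).
  rewrite !(innerZl iB) !(innerZr iB) (innerC iB y u) (innerC iB y v); ring.
- by rewrite !L0 mul0mx addr0.
(* The second coordinate of [u *m A] is [B u u], which is positive. *)
- apply/eqP => A0; have := AE u; rewrite A0 mulmx0 => /rowP /(_ 1).
  have u0 : u != 0.
    by apply/eqP => /rowP /(_ 0); rewrite !mxE => /eqP; rewrite oner_eq0.
  have := inner_gt0 iB u0; rewrite !mxE /= mulr1 mulr0 subr0 => /[swap] <-.
  by rewrite ltxx.
Qed.

Lemma row_base_inverse (F : fieldType) m n (M : 'M[F]_(m, n)) :
  exists (K : 'M[F]_(\rank M, n)) (K' : 'M[F]_(n, \rank M)),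
    [/\ K *m K' = 1%:M, (K <= M)%MS &
      forall k (u : 'M[F]_(k, n)), (u <= M)%MS -> u *m K' *m K = u].
Proof.
exists (row_base M), (pinvmx (row_base M)); split.
- by apply: mulmxVp; exact: row_base_free.
- by rewrite eq_row_base.
- by move=> k u uM; rewrite mulmxKpV// eq_row_base.
Qed.

(** On its image [J] induces a matrix of square [-1]. The square of its determinant is [(-1)] to the
    rank and is nonnegative, so the rank is even. *)
Lemma even_rank_cube (R : realFieldType) n (J : 'M[R]_n) :
  J *m J *m J = - J -> ~~ odd (\rank J).
Proof.
move=> J3; have [K [K' [KK' KJ JK]]] := row_base_inverse J.
have [X KE] := submxP KJ.
have KJJ : K *m J *m J = - K by rewrite KE -mulmxN -J3 !mulmxA.
have TT : (K *m J *m K') *m (K *m J *m K') = - 1%:M.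
  by rewrite !mulmxA JK ?submxMl// KJJ mulNmx KK'.
apply/negP => oddr; have := congr1 determinant TT.
rewrite det_mulmx -scaleN1r detZ det1 mulr1 -signr_odd oddr expr1 -expr2 => E.
by have := sqr_ge0 (\det (K *m J *m K')); rewrite E ler0N1.
Qed.

(** * Extending a normal structure from the kernel of a skew derivation *)

Section Extension.
Variables (R : realType) (n : nat).
Variables (L : 'rV[R]_n.+1 -> 'rV[R]_n.+1 -> 'rV[R]_n.+1).
Variables (B : 'rV[R]_n.+1 -> 'rV[R]_n.+1 -> R) (A J : 'M[R]_n.+1).
Hypotheses (ml : metric_lie L B) (dA : skew_derivation L B A).
Hypothesis JP : polar_part B A J.

Let iB := lie_inner ml.
Variables (m : nat) (K : 'M[R]_(m, n.+1)) (p : 'M[R]_(n.+1, m)).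
Hypotheses (KJ : K *m J = 0) (Jp : J *m p = 0) (Kp : K *m p = 1%:M).
Hypothesis pK : p *m K = 1%:M + J *m J.
Local Notation H := (A *m A).

Let skewA : forall u v, B (u *m A) v = - B u (v *m A) := dA.1.
Let derA : forall u v, L u v *m A = L (u *m A) v + L u (v *m A) := dA.2.
Let skewJ u v : B (u *m J) v = - B u (v *m J).
Proof. by have [] := JP. Qed.

Let J3 : J *m J *m J = - J. Proof. exact: (polar_cube JP). Qed.

Let KA : K *m A = 0.
Proof.
apply/row_matrixP => i; rewrite row_mul row0.
by apply: (polar_ker JP); rewrite -row_mul KJ row0.
Qed.

Let K_inj (u v : 'rV_m) : u *m K = v *m K -> u = v.
Proof. by move=> E; rewrite -[u]mulmx1 -[v]mulmx1 -Kp !mulmxA E. Qed.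

Let L' (u v : 'rV_m) := L (u *m K) (v *m K) *m p.
Let B' (u v : 'rV_m) := B (u *m K) (v *m K).

Let L'K u v : L' u v *m K = L (u *m K) (v *m K).
Proof.
rewrite /L' -mulmxA pK mulmxDr mulmx1 mulmxA.
suff -> : L (u *m K) (v *m K) *m J = 0 by rewrite mul0mx addr0.
have [_ _ Jker _] := JP; apply: Jker.
by rewrite derA -!mulmxA KA !mulmx0 (lie0l ml) (lie0r ml) addr0.
Qed.

(** The rows of [K] form a basis of [ker A], and [p] gives the coordinates of the orthogonal
    projection [1 + J^2] onto it. As [A] is a derivation, [ker A] is closed under the bracket
    ([L'K]) and inherits all the axioms. *)
Lemma metric_lie_kernel : metric_lie L' B'.
Proof.
split.
- split=> [u v|r u v w|v v0]; first exact: innerC iB _ _.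
    by rewrite /B' mulmxDl -scalemxAl (innerl iB).
  apply: (inner_gt0 iB); apply: contra_neq v0 => vK.
  by apply: K_inj; rewrite vK mul0mx.
- by move=> r u v w; rewrite /L' mulmxDl -scalemxAl (lie_bilinear ml) mulmxDl -scalemxAl.
- by move=> u v; rewrite /L' (lie_skew ml) mulNmx.
- by move=> u v w; apply: K_inj; rewrite mulmxDl !L'K (lie_leibniz ml).
- by move=> u v w; rewrite /B' !L'K (lie_invariant ml).
Qed.

Variables (xi' : 'rV[R]_m) (phi' : 'M[R]_m).
Hypothesis ns : normal_structure L' B' xi' phi'.
Let xi := xi' *m K.
Let phi := p *m phi' *m K + J.

Let KphiE (u : 'rV[R]_m) : u *m K *m phi = u *m phi' *m K.
Proof.
rewrite /phi mulmxDr -[u *m K *m J]mulmxA KJ mulmx0 addr0.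
by rewrite -!mulmxA [K *m _]mulmxA Kp mul1mx.
Qed.

Let phiJE (u : 'rV[R]_n.+1) : u *m J *m J = - u -> u *m phi = u *m J.
Proof.
move=> uJJ; have up : u *m p = 0.
  by apply: K_inj; rewrite -mulmxA pK mulmxDr mulmx1 mulmxA uJJ subrr mul0mx.
by rewrite mulmxDr !mulmxA up !mul0mx add0r.
Qed.

Let kerE (u : 'rV[R]_n.+1) : u *m A = 0 -> u = u *m p *m K.
Proof.
have [_ _ Jker _] := JP => /Jker uJ.
by rewrite -mulmxA pK mulmxDr mulmx1 mulmxA uJ mul0mx addr0.
Qed.

(** The defect of the normality axiom. It is biadditive and skew, so it can be tested on [ker A] and
    on eigenvectors of [A^2]. *)
Definition nijenhuis (u v : 'rV[R]_n.+1) : 'rV[R]_n.+1 :=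
  L (u *m phi) (v *m phi) - L u v - (L (u *m phi) v + L u (v *m phi)) *m phi.

Lemma nijenhuisDl u w v : nijenhuis (u + w) v = nijenhuis u v + nijenhuis w v.
Proof.
rewrite /nijenhuis [(u + w) *m phi]mulmxDl !(lieDl ml) [X in _ - X *m phi = _]addrACA.
by rewrite [X in _ - X]mulmxDl opprD opprD [X in X + _]addrACA [LHS]addrACA.
Qed.

Lemma nijenhuisC u v : nijenhuis u v = - nijenhuis v u.
Proof.
have E : L (u *m phi) v + L u (v *m phi) = - (L (v *m phi) u + L v (u *m phi)).
  by rewrite (lie_skew ml (u *m phi) v) (lie_skew ml u (v *m phi)) opprD addrC.
rewrite /nijenhuis E (lie_skew ml (u *m phi) (v *m phi)) (lie_skew ml u v).
by rewrite mulNmx !opprD.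
Qed.

Lemma nijenhuisDr u w v : nijenhuis v (u + w) = nijenhuis v u + nijenhuis v w.
Proof. by rewrite nijenhuisC nijenhuisDl opprD -!nijenhuisC. Qed.

Lemma nijenhuis0l v : nijenhuis 0 v = 0.
Proof. by apply: (@addrI _ (nijenhuis 0 v)); rewrite addr0 -nijenhuisDl addr0. Qed.

Lemma nijenhuis_ker_ker (u v : 'rV[R]_n.+1) : u *m A = 0 -> v *m A = 0 -> nijenhuis u v = 0.
Proof.
move=> /kerE -> /kerE ->; move: (u *m p) (v *m p) => {}u {}v.
have [_ _ _ _ N] := ns.
by rewrite /nijenhuis !KphiE -!L'K -mulmxDl KphiE -N mulmxBl subrr.
Qed.

(** For [w] in [ker A], [ad w] commutes with [A], hence preserves the eigenspaces of [A^2] and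
    commutes with [J] there ([key]). This is used for [u] and for [u *m phi], both in the kernel. *)
Lemma nijenhuis_ker_eigen (u v : 'rV[R]_n.+1) lam : u *m A = 0 -> 0 < lam ->
  v *m H = - lam ^+ 2 *: v -> nijenhuis u v = 0.
Proof.
move=> uA l0 vH; have [_ Jlam _ _] := JP.
have ln0 : lam != 0 by rewrite gt_eqF.
have vJ := Jlam _ _ l0 vH.
have vA : v *m A = lam *: (v *m J) by rewrite vJ scalerA divff// scale1r.
have vJA := polar_eigenJA JP l0 vH.
have key (w : 'rV[R]_n.+1) : w *m A = 0 -> L w v *m phi = L w (v *m J) /\
    L w (v *m J) *m phi = - L w v.
  move=> wA.
  have e1 : L w v *m A = lam *: L w (v *m J).
    by rewrite derA wA (lie0l ml) add0r vA (lieZr ml).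
  have e2 : L w (v *m J) *m A = - lam *: L w v.
    by rewrite derA wA (lie0l ml) add0r vJA (lieZr ml).
  have e3 : L w v *m H = - lam ^+ 2 *: L w v.
    by rewrite mulmxA e1 -scalemxAl e2 scalerA mulrN expr2.
  have e4 : L w (v *m J) *m H = - lam ^+ 2 *: L w (v *m J).
    by rewrite mulmxA e2 -scalemxAl e1 scalerA mulNr expr2.
  rewrite !phiJE ?(polar_eigenJJ JP l0)//; split.
    by rewrite (Jlam _ _ l0 e3) e1 scalerA mulVf// scale1r.
  by rewrite (Jlam _ _ l0 e4) e2 scalerA mulrN mulVf// scaleN1r.
have uphiA : u *m phi *m A = 0.
  by rewrite (kerE uA) KphiE -mulmxA KA mulmx0.
have vphi : v *m phi = v *m J by rewrite phiJE// (polar_eigenJJ JP l0).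
have [k1 k2] := key _ uA; have [k3 k4] := key _ uphiA.
rewrite /nijenhuis vphi mulmxDl k3 k2 opprD opprK addrACA subrr.
by rewrite addrC addNr addr0.
Qed.

(** In complex terms [u - i uJ] and [v - i vJ] are eigenvectors of [A] for [i lam] and [i mu]. Their
    bracket is [- (U + i W)] and has eigenvalue [i (lam + mu)], so [W *m J = U]. The positivity of
    [lam + mu] fixes the sign of [J]. *)
Lemma nijenhuis_eigen_eigen (u v : 'rV[R]_n.+1) lam mu : 0 < lam -> 0 < mu ->
  u *m H = - lam ^+ 2 *: u -> v *m H = - mu ^+ 2 *: v -> nijenhuis u v = 0.
Proof.
move=> l0 m0 uH vH; have [_ Jlam _ _] := JP.
have ln0 : lam != 0 by rewrite gt_eqF.
have mn0 : mu != 0 by rewrite gt_eqF.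
have uA : u *m A = lam *: (u *m J) by rewrite (Jlam _ _ l0 uH) scalerA divff// scale1r.
have vA : v *m A = mu *: (v *m J) by rewrite (Jlam _ _ m0 vH) scalerA divff// scale1r.
have uJA := polar_eigenJA JP l0 uH; have vJA := polar_eigenJA JP m0 vH.
rewrite /nijenhuis (phiJE (polar_eigenJJ JP l0 uH)) (phiJE (polar_eigenJJ JP m0 vH)).
set U := L (u *m J) (v *m J) - L u v; set W := L (u *m J) v + L u (v *m J).
have UA : U *m A = - (lam + mu) *: W.
  rewrite /U mulmxBl !derA uJA vJA uA vA !(lieZl ml) !(lieZr ml) /W.
  move: (L (u *m J) v) (L u (v *m J)) => x y.
  by apply/rowP => j; rewrite !mxE; ring.
have WA : W *m A = (lam + mu) *: U.
  rewrite /W mulmxDl !derA uJA vJA uA vA !(lieZl ml) !(lieZr ml) /U.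
  move: (L (u *m J) (v *m J)) (L u v) => x y.
  by apply/rowP => j; rewrite !mxE; ring.
have lm0 : 0 < lam + mu by exact: addr_gt0.
have WH : W *m H = - (lam + mu) ^+ 2 *: W.
  by rewrite mulmxA WA -scalemxAl UA scalerA mulrN expr2.
rewrite phiJE ?(polar_eigenJJ JP lm0)// (Jlam _ _ lm0 WH) WA scalerA.
by rewrite mulVf ?gt_eqF// scale1r subrr.
Qed.

Lemma nijenhuis_eq0 u v : nijenhuis u v = 0.
Proof.
have [_ _ _ Jgen] := JP.
elim/Jgen : u v => [v|u w uE wE v|u uA v|lam u l0 uH v].
- exact: nijenhuis0l.
- by rewrite nijenhuisDl uE wE addr0.
- elim/Jgen : v => [|v w vE wE|v vA|mu v m0 vH].
  + by rewrite nijenhuisC nijenhuis0l oppr0.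
  + by rewrite nijenhuisDr vE wE addr0.
  + exact: nijenhuis_ker_ker.
  + exact: nijenhuis_ker_eigen uA m0 vH.
- elim/Jgen : v => [|v w vE wE|v vA|mu v m0 vH].
  + by rewrite nijenhuisC nijenhuis0l oppr0.
  + by rewrite nijenhuisDr vE wE addr0.
  + by rewrite nijenhuisC (nijenhuis_ker_eigen vA l0 uH) oppr0.
  + exact: nijenhuis_eigen_eigen l0 m0 uH vH.
Qed.

(** The metric axioms hold because [phi] is block diagonal for the orthogonal sum of [ker A] and the
    image of [J], with [J^2 = -1] on the latter. *)
Lemma normal_structure_extend : normal_structure L B xi phi.
Proof.
have [xi1 xiphi phi2 gphi _] := ns.
have B'xi (u : 'rV[R]_n.+1) : B' xi' (u *m p) = B xi u.
  rewrite /B' -mulmxA pK mulmxDr mulmx1 (innerDr iB) mulmxA (innerC iB _ (_ *m J)).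
  by rewrite skewJ -[xi' *m K *m J]mulmxA KJ mulmx0 (inner0r iB) oppr0 addr0.
have uphi (u : 'rV[R]_n.+1) : u *m phi = u *m p *m phi' *m K + u *m J.
  by rewrite mulmxDr !mulmxA.
split.
- exact: xi1.
- by rewrite KphiE xiphi mul0mx.
- move=> u; rewrite (uphi u) mulmxDl KphiE phi2 uphi -[u *m J *m p]mulmxA Jp mulmx0.
  rewrite !mul0mx add0r mulmxDl mulNmx B'xi -scalemxAl -[u *m p *m K]mulmxA pK.
  rewrite mulmxDr mulmx1 mulmxA opprD addrAC; congr (_ + _).
  by rewrite -addrA addNr addr0.
- move=> u v; rewrite !uphi (innerDl iB) !(innerDr iB).
  have cross (w : 'rV[R]_m) (x : 'rV[R]_n.+1) : B (w *m K) (x *m J) = 0.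
    by rewrite (innerC iB) skewJ -mulmxA KJ mulmx0 (inner0r iB) oppr0.
  rewrite cross (innerC iB (u *m J)) cross addr0 add0r.
  rewrite -[B (_ *m K) _]/(B' _ _) gphi !B'xi /B' -[u *m p *m K]mulmxA.
  rewrite -[v *m p *m K]mulmxA pK !mulmxDr !mulmx1 !mulmxA.
  have t1 : B u (v *m J *m J) = - B (u *m J) (v *m J) by rewrite skewJ opprK.
  have t2 : B (u *m J *m J) v = - B (u *m J) (v *m J) by rewrite skewJ.
  have t3 : B (u *m J *m J) (v *m J *m J) = B (u *m J) (v *m J).
    have vJ3 : v *m J *m J *m J = - (v *m J) by rewrite -mulmxN -J3 !mulmxA.
    by rewrite skewJ vJ3 (innerNr iB) opprK.
  rewrite (innerDl iB) !(innerDr iB) t1 t2 t3.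
  move: (B u v) (B (u *m J) (v *m J)) (B xi u) (B xi v) => b1 b2 b3 b4.
  by ring.
- move=> u v; apply/eqP; rewrite -subr_eq0; apply/eqP; exact: nijenhuis_eq0.
Qed.

End Extension.

(** Strong induction on the dimension. In dimension one the bracket vanishes, and [phi = 0] with a
    unit vector [xi] works. *)
Theorem normal_structure_exists (R : realType) n
    (L : 'rV[R]_n -> 'rV[R]_n -> 'rV[R]_n) (B : 'rV[R]_n -> 'rV[R]_n -> R) :
  odd n -> metric_lie L B -> exists xi phi, normal_structure L B xi phi.
Proof.
have [k] := ubnP n; elim: k n L B => // k IH [|[|n]] L B nk on ml //.
  have iB := lie_inner ml; pose e : 'rV[R]_1 := 1%:M.
  have eE (u : 'rV[R]_1) : u = u 0 0 *: e by rewrite scalemx1 -mx11_scalar.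
  have L0 u v : L u v = 0.
    have Le : L e e = 0.
      apply/rowP => j; rewrite mxE; have := lie_skew ml e e => /rowP /(_ j).
      by rewrite mxE; lra.
    by rewrite (eE u) (eE v) (lieZl ml) (lieZr ml) Le !scaler0.
  have e0 : e != 0 by apply/eqP => /matrixP /(_ 0 0); rewrite !mxE /= => /eqP; rewrite oner_eq0.
  have Be := inner_gt0 iB e0; pose c := (Num.sqrt (B e e))^-1.
  have cc : c * c * B e e = 1.
    by rewrite -invfM -expr2 sqr_sqrtr ?ltW// mulVf// gt_eqF.
  exists (c *: e), 0; split.
  - by rewrite (innerZl iB) (innerZr iB) mulrA.
  - by rewrite mulmx0.
  - move=> u; rewrite !mulmx0 (eE u) (innerZl iB) (innerZr iB) scalerA.
    by rewrite (_ : _ * c = u 0 0) ?addNr//; rewrite -[RHS]mulr1 -cc; ring.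
  - move=> u v; rewrite !mulmx0 (inner0l iB) (eE u) (eE v) !(innerZl iB) !(innerZr iB).
    rewrite [X in 0 = X - _](_ : _ = u 0 0 * v 0 0 * (c * c * B e e) * B e e); last first.
      by rewrite cc; ring.
    by apply/eqP; rewrite eq_sym subr_eq0; apply/eqP; ring.
  - by move=> u v; rewrite !L0 subrr mulmx0.
have [A dA A0] := skew_derivation_exists ml.
have iB := lie_inner ml.
have [J JP] := polar_part_exists iB dA.1.
have J3 := polar_cube JP.
have er := even_rank_cube J3.
have J0 : (0 < \rank J)%N.
  rewrite lt0n mxrank_eq0; apply: contra_neq A0 => J0.
  apply/row_matrixP => i; rewrite row0 rowE.
  by apply: (polar_ker JP); rewrite J0 mulmx0.
have [K [K' [KK' KJ JK]]] := row_base_inverse (kermx J).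
move: K K' KK' KJ JK; rewrite mxrank_ker; set m := (n.+2 - \rank J)%N.
move=> K K' KK' /sub_kermxP KJ JK.
(* The rank of [J] is even and positive, so [ker A] has odd and strictly smaller dimension. *)
have om : odd m by rewrite /m oddB ?rank_leq_row// on (negbTE er).
have mk : (m < k)%N by rewrite /m; move: nk J0 (rank_leq_row J); lia.
pose p := (1%:M + J *m J) *m K'.
have PJ : (1%:M + J *m J) *m J = 0 by rewrite mulmxDl mul1mx J3 subrr.
have pK : p *m K = 1%:M + J *m J by apply: JK; apply/sub_kermxP.
have Kp : K *m p = 1%:M.
  by rewrite mulmxA mulmxDr mulmx1 mulmxA KJ mul0mx addr0.
have Jp : J *m p = 0.
  by rewrite mulmxA mulmxDr mulmx1 mulmxA J3 subrr mul0mx.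
have ml' := metric_lie_kernel ml dA JP KJ Kp pK.
have [xi' [phi' ns]] := IH _ _ _ mk om ml'.
exists (xi' *m K), (p *m phi' *m K + J).
exact: (normal_structure_extend ml dA JP KJ Jp Kp pK ns).
Qed.

(** * The torsion form at the level of the Lie algebra *)

Section NormalStructureTheory.
Variables (R : realType) (n : nat) (L : 'rV[R]_n -> 'rV[R]_n -> 'rV[R]_n).
Variables (B : 'rV[R]_n -> 'rV[R]_n -> R) (xi : 'rV[R]_n) (phi : 'M[R]_n).
Hypotheses (ml : metric_lie L B) (ns : normal_structure L B xi phi).
Let iB := lie_inner ml.
Local Notation V := 'rV[R]_n.
Implicit Types x y z w u v : V.

(** The cube of [phi] computed in two ways differs by [B xi (u *m phi)] times the unit vector
    [xi]. *)
Lemma phi_xi_orth u : B xi (u *m phi) = 0.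
Proof.
have [xi1 xiphi phi2 _ _] := ns.
have := phi2 (u *m phi); rewrite (phi2 u) mulmxDl mulNmx -scalemxAl xiphi scaler0 addr0.
rewrite -[LHS]addr0 => /addrI E.
by have := congr1 (B xi) E; rewrite (inner0r iB) (innerZr iB) xi1 mulr1.
Qed.

Lemma phi_skew u v : B (u *m phi) v = - B u (v *m phi).
Proof.
have [xi1 xiphi phi2 gphi _] := ns.
have := gphi u (v *m phi); rewrite phi_xi_orth mulr0 subr0 => <-.
rewrite phi2 (innerDr iB) (innerNr iB) (innerZr iB) (innerC iB _ xi) phi_xi_orth.
by rewrite mulr0 addr0 opprK.
Qed.

Lemma lie_form_cycle x y z : B (L x y) z = B (L y z) x.
Proof.
rewrite (lie_invariant ml) (lie_skew ml x z) (innerNr iB) opprK.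
by rewrite (lie_skew ml y z) (innerNl iB) (lie_invariant ml) opprK.
Qed.

Lemma lie_form_skew12 x y z : B (L x y) z = - B (L y x) z.
Proof. by rewrite (lie_skew ml) (innerNl iB). Qed.

(** Normality paired with [xi], to which the image of [phi] is orthogonal. *)
Lemma xi_lie_phi x y : B xi (L (x *m phi) (y *m phi)) = B xi (L x y).
Proof.
have [_ _ _ _ N] := ns; have := congr1 (B xi) (N x y).
by rewrite phi_xi_orth (innerDr iB) (innerNr iB) => /eqP; rewrite subr_eq0 => /eqP.
Qed.

(** The left-hand side is [eta /\ d eta + d^phi F] on left invariant fields. Compatibility of [B]
    with [phi] and [xi_lie_phi] cancel all the [eta] terms, leaving minus the cyclic sum of
    [B([phi x, phi y], z)]. Normality and skewness of [phi] rewrite one of these terms as [B([x, y],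
    z)] minus the other two. *)
Lemma torsion_form x y z :
  (B xi x * - B xi (L y z) + B xi y * - B xi (L z x) + B xi z * - B xi (L x y)) +
  (- B (L (x *m phi) (y *m phi) *m phi) (z *m phi)
   + B (L (x *m phi) (z *m phi) *m phi) (y *m phi)
   - B (L (y *m phi) (z *m phi) *m phi) (x *m phi)) = - B (L x y) z.
Proof.
have [_ _ _ gphi N] := ns.
rewrite !gphi !xi_lie_phi.
have E : B (L (x *m phi) (y *m phi)) z =
    B (L x y) z - B (L (x *m phi) y) (z *m phi) - B (L x (y *m phi)) (z *m phi).
  have := congr1 (fun u => B u z) (N x y).
  rewrite phi_skew !(innerDl iB) (innerNl iB); lra.
have E1 : B (L (x *m phi) y) (z *m phi) = B (L (z *m phi) (x *m phi)) y.
  by rewrite [RHS]lie_form_cycle.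
have E2 : B (L x (y *m phi)) (z *m phi) = B (L (y *m phi) (z *m phi)) x.
  by rewrite lie_form_cycle.
have E3 : B (L (x *m phi) (z *m phi)) y = - B (L (z *m phi) (x *m phi)) y.
  exact: lie_form_skew12.
have E4 : B xi (L z x) = - B xi (L x z) by rewrite (lie_skew ml) (innerNr iB).
rewrite E E1 E2 E3 E4; ring.
Qed.

(** The Jacobi identity for [[x, [z, w]]] paired with [y], with brackets moved across by
    invariance. *)
Lemma lie_form_jacobi x y z w :
  B (L x y) (L z w) = B (L x z) (L y w) - B (L y z) (L x w).
Proof.
rewrite (lie_invariant ml) (lie_leibniz ml) (innerDr iB) opprD; congr (_ + _).
  rewrite (lie_skew ml (L x z)) (innerNr iB) opprK.
  rewrite -[LHS]opprK -(lie_invariant ml w y) (lie_skew ml w y) (innerNl iB) opprK.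
  exact: innerC iB _ _.
by rewrite -(lie_invariant ml z y) (lie_skew ml z y) (innerNl iB).
Qed.

(* [xy] stands for the derivative of the components of [Y] along [X], etc. *)
Lemma lie_form_closed x y z w xy xz xw yx yz yw zx zy zw wx wy wz :
  let t u v s := - B (L u v) s in
  (t xy z w + t y xz w + t y z xw) - (t yx z w + t x yz w + t x z yw)
  + (t zx y w + t x zy w + t x y zw) - (t wx y z + t x wy z + t x y wz)
  - t (xy - yx + L x y) z w + t (xz - zx + L x z) y w - t (xw - wx + L x w) y z
  - t (yz - zy + L y z) x w + t (yw - wy + L y w) x z - t (zw - wz + L z w) x y = 0.
Proof.
move=> t.
have tD a b c d e : t (a - b + c) d e = t a d e - t b d e + t c d e.
  rewrite /t !(lieDl ml) (lieNl ml) !(innerDl iB) (innerNl iB); ring.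
have t12 a b c : t a b c = - t b a c by rewrite /t lie_form_skew12.
have tc a b c : t a b c = t b c a by rewrite /t lie_form_cycle.
have tL a b c d : t (L a b) c d = - B (L a b) (L c d).
  by rewrite /t lie_form_cycle (innerC iB).
rewrite !tD !tL.
have e1 := lie_form_jacobi x y z w.
have e2 : B (L y w) (L x z) = B (L x z) (L y w) by rewrite (innerC iB).
have e3 : B (L z w) (L x y) = B (L x y) (L z w) by rewrite (innerC iB).
have e4 : B (L x w) (L y z) = B (L y z) (L x w) by rewrite (innerC iB).
rewrite e2 e3 e4 e1.
have tc2 a b c : t a b c = t c a b by rewrite -tc.
rewrite (t12 y xz) (t12 x yz) (t12 x zy) (t12 x wy).
rewrite (tc2 y z xw) (tc2 x z yw) (tc2 x y zw) (tc2 x y wz).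
clearbody t; ring.
Qed.

End NormalStructureTheory.

(** * From the Lie algebra to left invariant tensors on the group *)

Section Assembly.
Variables (R : realType) (n : nat) (G : lieGroupType R n).
Hypotheses (n_odd : odd n).
Variables (c0 : chart R n G) (Ac0 : atlas c0) (c01 : dom c0 1%g).
Local Notation C := (Cinf G).
Local Notation VF := (vfield G).
Local Notation V := 'rV[R]_n.
Local Notation E := (left_field Ac0 c01).
Local Notation hat := (hat_fun Ac0 c01).
Local Notation coef := (coef Ac0 c01).
Local Notation dhat := (dhat Ac0 c01).
Local Notation lie := (lie Ac0 c01).
Local Notation Ad := (Ad Ac0 c01).
Implicit Types (X Y Z W : VF) (p : G).

Section Bilinear.
Variable b : V -> V -> R.
Hypotheses (bl : forall r u v w, b (r *: u + v) w = r * b u w + b v w)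
  (br : forall r u v w, b w (r *: u + v) = r * b w u + b w v).

(** The left invariant tensor with value [b] at the identity. Writing it as a finite sum over the
    frame makes smoothness automatic. *)
Definition bil Y Z : C :=
  \sum_i \sum_j b 'e_i 'e_j *: (coef Y i * coef Z j).

Lemma bil_sum u v : b u v = \sum_i \sum_j b 'e_i 'e_j * (u 0 i * v 0 j).
Proof.
have b0l w : b 0 w = 0.
  by have := bl (-1) 0 0 w; rewrite scaler0 addr0 mulN1r addNr.
have b0r w : b w 0 = 0.
  by have := br (-1) 0 0 w; rewrite scaler0 addr0 mulN1r addNr.
rewrite {1}(row_sum_delta u).
elim/big_rec2 : _ => [//|i y1 y2 _ <-]; rewrite bl; congr (_ + _).
rewrite {1}(row_sum_delta v) [in RHS]/=.
transitivity (u 0 i * \sum_j b 'e_i 'e_j * v 0 j); last first.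
  by rewrite mulr_sumr; apply: eq_bigr => j _; ring.
congr (_ * _); elim/big_rec2 : _ => [//|j z1 z2 _ <-].
by rewrite br mulrC.
Qed.

Lemma bilE Y Z p : bil Y Z p = b (hat Y p) (hat Z p).
Proof.
rewrite bil_sum Cinf_sumE; apply: eq_bigr => i _; rewrite Cinf_sumE.
by apply: eq_bigr => j _.
Qed.

(** Left invariant tensors are parallel for the flat connection [dhat]. *)
Lemma vfield_bil X Y Z p : X (bil Y Z) p =
  b (dhat X Y p) (hat Z p) + b (hat Y p) (dhat X Z p).
Proof.
have dX := vfield_derivation_at X p; have [_ XZ XM] := dX.
have Xs (F : 'I_n -> C) : X (\sum_i F i) p = \sum_i X (F i) p.
  exact: (derivation_at_sum dX).
rewrite !bil_sum Xs -big_split; apply: eq_bigr => i _ /=.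
rewrite Xs -big_split; apply: eq_bigr => j _ /=.
rewrite XZ XM !coefE -mulrDr; congr (_ * _).
by rewrite ![(dhat _ _ _) _ _]mxE addrC [hat Z p 0 j * _]mulrC.
Qed.
End Bilinear.

Section Trilinear.
Variable t : V -> V -> V -> R.
Hypotheses (tl : forall r u v x y, t (r *: u + v) x y = r * t u x y + t v x y)
  (tm : forall r u v x y, t x (r *: u + v) y = r * t x u y + t x v y)
  (tr : forall r u v x y, t x y (r *: u + v) = r * t x y u + t x y v).

Definition tri X Y Z : C := \sum_k coef Z k * bil (fun u v => t u v 'e_k) X Y.

Lemma tri_sum u v w : t u v w = \sum_k w 0 k * t u v 'e_k.
Proof.
have t0 : t u v 0 = 0.
  by have := tr (-1) 0 0 u v; rewrite scaler0 addr0 mulN1r addNr.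
rewrite {1}(row_sum_delta w); elim/big_rec2 : _ => [//|i y1 y2 _ <-].
by rewrite tr.
Qed.

Lemma triE X Y Z p : tri X Y Z p = t (hat X p) (hat Y p) (hat Z p).
Proof.
rewrite tri_sum Cinf_sumE; apply: eq_bigr => k _.
by rewrite -[LHS]/(coef Z k p * bil _ X Y p) bilE.
Qed.

Lemma vfield_tri X Y Z W p : X (tri Y Z W) p =
  t (dhat X Y p) (hat Z p) (hat W p) + t (hat Y p) (dhat X Z p) (hat W p) +
  t (hat Y p) (hat Z p) (dhat X W p).
Proof.
have dX := vfield_derivation_at X p; have [_ XZ XM] := dX.
have Xs (F : 'I_n -> C) : X (\sum_i F i) p = \sum_i X (F i) p.
  exact: (derivation_at_sum dX).
rewrite Xs [t (dhat _ _ _) _ _]tri_sum [t _ (dhat _ _ _) _]tri_sum.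
rewrite [t _ _ (dhat _ _ _)]tri_sum -!big_split; apply: eq_bigr => k _ /=.
rewrite XM vfield_bil// bilE// mulrDr coefE; congr (_ + _).
by rewrite mulrC [in RHS]mxE.
Qed.
End Trilinear.

Section Structure.
Variables (B : V -> V -> R) (xi : V) (phi : 'M[R]_n).
Hypotheses (ml : metric_lie lie B) (ns : normal_structure lie B xi phi).
Let iB := lie_inner ml.

Let Bl r u v w : B (r *: u + v) w = r * B u w + B v w.
Proof. exact: innerl iB _ _ _ _. Qed.
Let Br r u v w : B w (r *: u + v) = r * B w u + B w v.
Proof. by rewrite (innerDr iB) (innerZr iB). Qed.

Definition inv_metric Y Z := bil B Y Z.

Lemma inv_metricE Y Z p : inv_metric Y Z p = B (hat Y p) (hat Z p).
Proof. exact: bilE. Qed.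

Definition inv_phi X : VF := \sum_i coef X i *: E ('e_i *m phi).

Lemma hat_sum (I : Type) (r : seq I) (F : I -> VF) p :
  hat (\sum_(i <- r) F i) p = \sum_(i <- r) hat (F i) p.
Proof.
elim: r => [|i r IH]; first by rewrite !big_nil hat0.
by rewrite !big_cons hatD IH.
Qed.

Lemma hat_inv_phi X p : hat (inv_phi X) p = hat X p *m phi.
Proof.
rewrite hat_sum [in RHS](row_sum_delta (hat X p)) mulmx_suml.
by apply: eq_bigr => i _; rewrite hatZ hat_left_field scalemxAl.
Qed.

Lemma inv_phi_linear : linear inv_phi.
Proof.
move=> f X Y; apply: (@hat_inj _ _ _ _ Ac0 c01) => p.
by rewrite hatD hatZ !hat_inv_phi hatD hatZ mulmxDl scalemxAl.
Qed.
HB.instance Definition _ := GRing.isLinear.Build C VF VF *:%R inv_phi inv_phi_linear.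

Lemma dhat_inv_phi X Y p : dhat X (inv_phi Y) p = dhat X Y p *m phi.
Proof.
apply/rowP => k; rewrite !mxE.
have dX := vfield_derivation_at X p; have [_ XZ _] := dX.
have Xs (F : 'I_n -> C) : X (\sum_i F i) p = \sum_i X (F i) p.
  exact: (derivation_at_sum dX).
have -> : coef (inv_phi Y) k = \sum_i phi i k *: coef Y i.
  apply: Cinf_eq => q; rewrite coefE hat_inv_phi mxE Cinf_sumE.
  by apply: eq_bigr => i _; rewrite mulrC.
by rewrite Xs; apply: eq_bigr => i _; rewrite XZ mxE mulrC.
Qed.

Lemma inv_riemannian : is_riemannian inv_metric.
Proof.
split=> [X Y|X Y Z|f X Y|X p nX]; try (apply: Cinf_eq => p).
- by rewrite !inv_metricE (innerC iB).
- rewrite -[RHS]/(inv_metric X Z p + inv_metric Y Z p) !inv_metricE hatD.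
  exact: innerDl.
- rewrite -[RHS]/(f p * inv_metric X Y p) !inv_metricE hatZ.
  exact: innerZl.
- rewrite inv_metricE; apply: (inner_gt0 iB); apply: contra_not_neq nX => X0 f.
  by rewrite (vfield_hat_fun Ac0 c01) X0 left_field_sum big1// => i _;
     rewrite mxE scale0r.
Qed.

Lemma inv_eta_xi X p : inv_metric (E xi) X p = B xi (hat X p).
Proof. by rewrite inv_metricE hat_left_field. Qed.

Lemma inv_xi_unit : inv_metric (E xi) (E xi) = 1.
Proof.
by apply: Cinf_eq => p; rewrite inv_eta_xi hat_left_field; have [-> _ _ _ _] := ns.
Qed.

Lemma inv_phi_xi : inv_phi (E xi) = 0.
Proof.
apply: (@hat_inj _ _ _ _ Ac0 c01) => p; rewrite hat_inv_phi hat_left_field hat0.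
by have [_ -> _ _ _] := ns.
Qed.

Lemma inv_phi2 X : inv_phi (inv_phi X) = - X + inv_metric (E xi) X *: E xi.
Proof.
apply: (@hat_inj _ _ _ _ Ac0 c01) => p; rewrite !hat_inv_phi hatD hatN hatZ inv_eta_xi hat_left_field.
by have [_ _ -> _ _] := ns.
Qed.

Lemma inv_metric_phi X Y : inv_metric (inv_phi X) (inv_phi Y) =
  inv_metric X Y - inv_metric (E xi) X * inv_metric (E xi) Y.
Proof.
apply: Cinf_eq => p.
rewrite -[RHS]/(inv_metric X Y p - inv_metric (E xi) X p * inv_metric (E xi) Y p).
by rewrite !inv_eta_xi !inv_metricE !hat_inv_phi; have [_ _ _ -> _] := ns.
Qed.

Definition inv_acm : acm_structure G :=
  @ACM R n G inv_metric (E xi) (fun X => inv_metric (E xi) X)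
    (inv_phi : {linear VF -> VF})
    n_odd inv_riemannian inv_xi_unit (fun X => erefl) inv_phi_xi inv_phi2 inv_metric_phi.

Lemma inv_acm_left_invariant : left_invariant inv_acm.
Proof.
split=> [a X X' Y Y'|a|a X X'|a X X'].
- move=> /(left_relatedP Ac0 c01) XX /(left_relatedP Ac0 c01) YY x /=.
  by rewrite !inv_metricE XX YY.
- exact: left_field_related.
- move=> /(left_relatedP Ac0 c01) XX x /=.
  by rewrite !inv_eta_xi XX.
- move=> /(left_relatedP Ac0 c01) XX; apply/(left_relatedP Ac0 c01) => x /=.
  by rewrite !hat_inv_phi XX.
Qed.

(** The components of [E xi] are constant, so only the term with [ad xi] could spoil the identity,
    and [ad xi] is skew for [B]. *)
Lemma inv_killing : killing inv_metric (E xi).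
Proof.
move=> Y Z; apply: Cinf_eq => p; rewrite vfield_bil//.
rewrite -[RHS]/(inv_metric _ _ p + inv_metric _ _ p) !inv_metricE !hat_bracket.
rewrite !dhat_left_field !subr0 hat_left_field (innerDl iB) (innerDr iB).
rewrite (lie_invariant ml) addrACA.
by rewrite [X in _ = _ + X](_ : _ = 0) ?addr0//; rewrite addNr.
Qed.

Lemma d1_eta X Y p : d1 (fun X => inv_metric (E xi) X) X Y p =
  - B xi (lie (hat X p) (hat Y p)).
Proof.
rewrite -[LHS]/(X (inv_metric (E xi) Y) p - Y (inv_metric (E xi) X) p -
  inv_metric (E xi) (bracket X Y) p).
rewrite !vfield_bil// !dhat_left_field !(inner0l iB) !add0r hat_left_field.
rewrite inv_eta_xi hat_bracket !(innerDr iB) (innerNr iB).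
by rewrite opprD addrA subrr add0r.
Qed.

(** The derivatives of components cancel since [phi] is parallel. In what remains, the term
    [eta([X, Y]) xi] of [phi^2 [X, Y]] cancels against [d eta (X, Y) xi], which leaves the algebraic
    normality axiom. *)
Lemma inv_normal : normal inv_acm.
Proof.
move=> X Y; apply: (@hat_inj _ _ _ _ Ac0 c01) => p; rewrite hat0 /normality_tensor /=.
rewrite !hatD !hatN hatZ d1_eta !hat_inv_phi !hat_bracket !hat_inv_phi.
rewrite !dhat_inv_phi hat_left_field.
have [_ _ phi2 _ N] := ns.
move: (hat X p) (hat Y p) => x y.
move: (dhat (inv_phi X) Y p) (dhat (inv_phi Y) X p) (dhat X Y p) (dhat Y X p) => a' b' a b.
have := N x y; rewrite !mulmxDl !mulNmx (phi2 (lie x y)).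
move: (lie (x *m phi) (y *m phi)) (lie x y) (lie (x *m phi) y) (lie x (y *m phi)).
move=> l1 l0 l2 l3; move: (B xi l0) => r.
move: (a' *m phi) (b' *m phi) (a *m phi *m phi) (b *m phi *m phi).
move: (l2 *m phi) (l3 *m phi) => k2 k3 m1 m2 m3 m4 Nxy.
have -> : l1 = l0 + (k2 + k3) by rewrite -Nxy addrC subrK.
by apply/rowP => j; rewrite !mxE; ring.
Qed.

(** Skewness of [b] cancels every derivative of a component, so only the bracket terms survive. *)
Lemma d2_bil (b : V -> V -> R) X Y Z p :
  (forall r u v w, b (r *: u + v) w = r * b u w + b v w) ->
  (forall u v, b u v = - b v u) ->
  d2 (bil b) X Y Z p = - b (lie (hat X p) (hat Y p)) (hat Z p)
    + b (lie (hat X p) (hat Z p)) (hat Y p) - b (lie (hat Y p) (hat Z p)) (hat X p).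
Proof.
move=> bl bC.
have br r u v w : b w (r *: u + v) = r * b w u + b w v.
  by rewrite bC bl [b w u]bC [b w v]bC; ring.
rewrite -[LHS]/(X (bil b Y Z) p - Y (bil b X Z) p + Z (bil b X Y) p
  - bil b (bracket X Y) Z p + bil b (bracket X Z) Y p - bil b (bracket Y Z) X p).
rewrite !vfield_bil// !bilE// !hat_bracket.
have bD u v w z : b (u - v + w) z = b u z - b v z + b w z.
  have b1 u1 u2 : b (u1 + u2) z = b u1 z + b u2 z.
    by have := bl 1 u1 u2 z; rewrite scale1r mul1r.
  have b2 u1 : b (- u1) z = - b u1 z.
    apply/eqP; rewrite -addr_eq0 -b1 addNr.
    by have := bl (-1) 0 0 z; rewrite scaler0 addr0 mulN1r addNr => ->.
  by rewrite !b1 b2.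
rewrite !bD.
rewrite [b (hat Y p) (dhat X Z p)]bC [b (hat X p) (dhat Y Z p)]bC.
rewrite [b (hat X p) (dhat Z Y p)]bC.
move: (b _ _) (b _ _) (b _ _) (b _ _) (b _ _) (b _ _) (b _ _) (b _ _) (b _ _).
by move=> b1 b2 b3 b4 b5 b6 b7 b8 b9; ring.
Qed.

Let F u v := B (u *m phi) v.

Lemma fundamental_bil : fundamental_form inv_acm = bil F.
Proof.
apply/funext => X; apply/funext => Y; apply: Cinf_eq => p.
rewrite -[LHS]/(inv_metric (inv_phi X) Y p) inv_metricE hat_inv_phi bilE//.
  by move=> r u v w; rewrite /F mulmxDl -scalemxAl Bl.
by move=> r u v w; rewrite /F Br.
Qed.

Lemma torsionE : torsion inv_acm = tri (fun u v w => - B (lie u v) w).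
Proof.
apply/funext => X; apply/funext => Y; apply/funext => Z; apply: Cinf_eq => p.
rewrite triE; last first.
- by move=> r u v x y; rewrite Br opprD mulrN.
- by move=> r u v x y; rewrite (lieDr ml) (lieZr ml) Bl opprD mulrN.
- by move=> r u v x y; rewrite (lie_bilinear ml) Bl opprD mulrN.
rewrite -[LHS]/(inv_metric (E xi) X p * d1 (fun X => inv_metric (E xi) X) Y Z p
  + inv_metric (E xi) Y p * d1 (fun X => inv_metric (E xi) X) Z X p
  + inv_metric (E xi) Z p * d1 (fun X => inv_metric (E xi) X) X Y p
  + d2 (fundamental_form inv_acm) (inv_phi X) (inv_phi Y) (inv_phi Z) p).
rewrite fundamental_bil d2_bil; last first.
- by move=> u v; rewrite /F (phi_skew ml ns) (innerC iB).
- by move=> r u v w; rewrite /F mulmxDl -scalemxAl Bl.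
rewrite !d1_eta !inv_eta_xi !hat_inv_phi /F.
exact: torsion_form ml ns _ _ _.
Qed.

(** By [torsionE] the torsion is the left invariant form [- B([X, Y], Z)]. In its exterior
    derivative the derivatives of components cancel by skew symmetry, and the rest vanishes by the
    Jacobi identity. *)
Lemma inv_SST : is_SST inv_acm.
Proof.
split; first by split; [exact: inv_normal|exact: inv_killing].
move=> X Y Z W; rewrite torsionE; set t := (fun u v w => - B (lie u v) w).
have tr r u v x y : t x y (r *: u + v) = r * t x y u + t x y v.
  by rewrite /t Br opprD mulrN.
have tm r u v x y : t x (r *: u + v) y = r * t x u y + t x v y.
  by rewrite /t (lieDr ml) (lieZr ml) Bl opprD mulrN.
have tl r u v x y : t (r *: u + v) x y = r * t u x y + t v x y.
  by rewrite /t (lie_bilinear ml) Bl opprD mulrN.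
apply: Cinf_eq => p.
rewrite -[LHS]/(X (tri t Y Z W) p - Y (tri t X Z W) p + Z (tri t X Y W) p
  - W (tri t X Y Z) p
  - tri t (bracket X Y) Z W p + tri t (bracket X Z) Y W p
  - tri t (bracket X W) Y Z p
  - tri t (bracket Y Z) X W p + tri t (bracket Y W) X Z p
  - tri t (bracket Z W) X Y p).
rewrite !vfield_tri// !triE// !hat_bracket.
exact: (lie_form_closed ml).
Qed.

End Structure.

End Assembly.

(** * The ad-invariant inner product of a compact group *)

Section BiinvariantMetric.
Variables (R : realType) (n : nat) (G : lieGroupType R n).
Variables (c0 : chart R n G) (Ac0 : atlas c0) (c01 : dom c0 1%g).
Hypothesis G_compact : compact [set: G].
Local Notation E := (left_field Ac0 c01).
Local Notation Z := (right_field Ac0 c01).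
Local Notation lie := (lie Ac0 c01).
Local Notation Ad := (Ad Ac0 c01).

Lemma Ad_bounded : exists K, forall x i j, `|Ad x i j| <= K.
Proof.
have bnd i j : exists K, forall x, `|Ad x i j| <= K.
  have cA : {within [set: G], continuous (fun x => Ad x i j)}.
    by apply: continuous_subspaceT => x; exact: continuous_Ad.
  have /compact_bounded[M [_ bM]] := continuous_compact cA G_compact.
  exists (M + 1) => x; apply: (bM (M + 1)); first by rewrite ltrDl.
  by exists x.
have [K KP] := choice (fun ij : 'I_n * 'I_n => bnd ij.1 ij.2).
exists (\sum_ij `|K ij|) => x i j; apply: le_trans (KP (i, j) x) _.
rewrite (bigD1 (i, j))//= (le_trans (ler_norm _))// lerDl.
by apply: sumr_ge0.
Qed.

(** Infinitesimal form of [Ad]-invariance, obtained by differentiating at the identity; right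
    invariant fields carry [Ad] in their components. *)
Lemma biinvariant_metric_lie : exists B, metric_lie lie B.
Proof.
have [K AdK] := Ad_bounded.
have [Q [QT Q0] AdQ] := invariant_inner_product (AdM Ac0 c01) (Ad1 Ac0 c01) AdK.
pose B (u v : 'rV[R]_n) : R := (u *m Q *m v^T) 0 0.
have BC u v : B u v = B v u.
  have -> : B u v = (v *m Q *m u^T)^T 0 0.
    by rewrite !trmx_mul trmxK QT mulmxA.
  by rewrite mxE.
have Bl r u v w : B (r *: u + v) w = r * B u w + B v w.
  by rewrite /B !mulmxDl -!scalemxAl !mxE.
have Br r u v w : B w (r *: u + v) = r * B w u + B w v.
  by rewrite !(BC w) Bl.
exists B; split.
- by split.
- exact: lie_linearl.
- exact: lie_anti.
- exact: lie_jacobi.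
move=> u v w; apply/eqP; rewrite -addr_eq0; apply/eqP.
(* At [p] the left side is [B (v *m Ad p) (w *m Ad p)], constant by invariance. Its derivative along
   [E u] at 1 is zero, and by [dhat_right_field] it is also [- B (lie u v) w - B v (lie u w)]. *)
have cst1 : bil Ac0 c01 B (Z v) (Z w) = B v w *: (1 : Cinf G).
  apply: Cinf_eq => p; rewrite bilE// !hat_right_field.
  rewrite -[RHS]/(B v w * 1) mulr1 /B trmx_mul -[in RHS](AdQ p) !mulmxA.
  by [].
have := vfield_bil Ac0 c01 Bl Br (E u) (Z v) (Z w) 1%g.
rewrite cst1 !dhat_right_field !hat_right_field !Ad1 !mulmx1.
have [_ EZ EM] := vfield_derivation_at (E u) 1%g.
have E1 : E u 1 1%g = 0.
  have := EM 1 1; rewrite mulr1 mul1r => /eqP.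
  by rewrite -{1}[E u 1 1%g]addr0 => /eqP/addrI/esym.
rewrite EZ E1 mulr0.
have BN x y : B (- x) y = - B x y.
  have B0 : B 0 y = 0 by rewrite /B !mul0mx mxE.
  by have := Bl (-1) x 0 y; rewrite addr0 scaleN1r mulN1r B0 addr0.
rewrite (BC v) !BN (BC _ v) => /esym/eqP.
by rewrite -opprD oppr_eq0 => /eqP.
Qed.

End BiinvariantMetric.

Theorem theorem2p8 (R : realType) (n : nat) (G : lieGroupType R n)
    (n_odd : odd n) (G_connected : connected [set: G])
    (G_compact : compact [set: G]) :
  exists s : acm_structure G, left_invariant s /\ is_SST s.
Proof.
have [c0 Ac0 c01] := atlas_cover (1%g : G).
have [B ml] := biinvariant_metric_lie Ac0 c01 G_compact.
have [xi [phi ns]] := normal_structure_exists n_odd ml.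
exists (inv_acm n_odd ml ns); split.
  exact: inv_acm_left_invariant.
exact: inv_SST.
Qed.
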